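(* (Estimates) Let $q:\mathbb{R}\to\mathbb{C}$ satisfy $\int_{\mathbb{R}}(1+|x|)|q(x)|\,dx<\infty$. Then $$B_0+\frac{\nu(\mathbb{R})}{\pi}+\frac12\int_{\mathbb{R}}\operatorname{Re}q(x)\,dx\le\frac2\pi\big(1+\|q\|_1\big)+\frac2\pi r_c\big(C_0+\log r_c\big),$$ where $\|q\|_1=\int_{\mathbb{R}}|x\,q(x)|\,dx$, $r_c=\frac12\int_{\mathbb{R}}|q(x)|\,dx$ and $C_0=\log\frac{3e}{2}+\frac{3e^2}{4}+\frac{9}{16}e^4$.
   Context: $\mathbb{C}_+=\{\operatorname{Im}z>0\}$. $f_\pm(x,k)$ are the Jost solutions of $-f''+qf=k^2f$ on $\mathbb{R}$, with $f_\pm(x,k)=e^{\pm ixk}+o(1)$ as $x\to\pm\infty$; $w(k)=f_-(0,k)f_+'(0,k)-f_-'(0,k)f_+(0,k)$ (analytic in $\mathbb{C}_+$, continuous up to $\mathbb{R}$) and $\psi(k)=\frac{w(k)}{2ik}$. $k_1,\dots,k_N$ ($0\le N\le\infty$) are the zeros of $w$ in $\mathbb{C}_+$ counted with multiplicity (so $k_j^2$ are the eigenvalues of $H=-\frac{d^2}{dx^2}+q$ on $L^2(\mathbb{R})$ in $\mathbb{C}\setminus[0,\infty)$, counted with algebraic multiplicity). $B(k)=\prod_{j=1}^N\frac{k-k_j}{k-\overline{k}_j}$ and $B_0=2\sum_{j=1}^N\operatorname{Im}k_j$. $\nu\ge0$ is the finite compactly supported Borel measure on $\mathbb{R}$, singular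 with respect to Lebesgue measure, in the canonical factorization of $\psi$: for $k\in\mathbb{C}_+$, $$\psi(k)=B(k)e^{-iK(k)}e^{iM(k)},\quad K(k)=\frac1\pi\int_{\mathbb{R}}\frac{d\nu(t)}{k-t},\quad M(k)=\frac1\pi\int_{\mathbb{R}}\frac{\log|\psi(t)|}{k-t}\,dt ,$$ with $\log|\psi|\in L^1_{loc}(\mathbb{R})$. Convention: $r_c\log r_c=0$ if $r_c=0$. *)

(* Defs.v *)
From HB Require Import structures.
From mathcomp Require Import all_boot all_order all_algebra.
From mathcomp Require Import all_classical all_reals all_analysis.
From mathcomp Require Import complex.
Set Implicit Arguments.
Unset Strict Implicit.
Unset Printing Implicit Defensive.
Import Order.TTheory GRing.Theory Num.Theory.
Import numFieldNormedType.Exports.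
Local Open Scope classical_set_scope.
Local Open Scope ring_scope.
Local Open Scope complex_scope.

(* [R[i]] as a bundled [numFieldType]: its topology and its structure of normed
   module over itself are only inferred through this packaging. *)
Definition Cx (R : realType) : numFieldType := R[i].

Definition cabs (R : realType) (z : R[i]) : R := ComplexField.Normc.normc z.

Definition cexp (R : realType) (z : R[i]) : R[i] :=
  (expR (complex.Re z))%:C * (cos (complex.Im z) +i* sin (complex.Im z)).

Definition cintegral d (T : measurableType d) (R : realType)
    (mu : {measure set T -> \bar R}) (D : set T) (f : T -> R[i]) : R[i] :=
  (\int[mu]_(x in D) complex.Re (f x)) +i* (\int[mu]_(x in D) complex.Im (f x)).

Definition cderivable (R : realType) (f : R -> R[i]) (x : R) : Prop :=
  derivable (fun y => complex.Re (f y)) x 1 /\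
  derivable (fun y => complex.Im (f y)) x 1.

Definition cderiv (R : realType) (f : R -> R[i]) (x : R) : R[i] :=
  derive1 (fun y => complex.Re (f y)) x +i* derive1 (fun y => complex.Im (f y)) x.

Definition abs_continuous_on (R : realType) (a b : R) (F : R -> R[i]) : Prop :=
  forall eps : R, 0 < eps -> exists2 delta : R, 0 < delta &
    forall (n : nat) (u v : 'I_n -> R),
      (forall i, a <= u i <= v i /\ v i <= b) ->
      trivIset setT (fun i => `]u i, v i[%classic) ->
      \sum_(i < n) (v i - u i) < delta ->
      \sum_(i < n) cabs (F (v i) - F (u i)) < eps.

Definition locally_abs_continuous (R : realType) (F : R -> R[i]) : Prop :=
  forall a b : R, a <= b -> abs_continuous_on a b F.

(* The potential is only integrable, so the equation is understood in the usual
   Caratheodory sense: f' is locally absolutely continuous and the equation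
   holds almost everywhere. *)
Definition schrodinger_solution (R : realType) (q : R -> R[i]) (k : R[i])
    (f : R -> R[i]) : Prop :=
  [/\ forall x, cderivable f x,
      locally_abs_continuous (cderiv f) &
      {ae (@lebesgue_measure R), forall x,
        cderivable (cderiv f) x /\
        - cderiv (cderiv f) x + q x * f x = k ^+ 2 * f x}].

(* For Im k > 0 the exponentials exp(+-ixk) decay at +-oo, so the asymptotics
   determine the solution only when the error is relative to the exponential:
   f(x) = exp(+-ixk) (1 + o(1)). For real k this is the same as
   f(x) = exp(+-ixk) + o(1). *)
Definition jost_plus (R : realType) (q : R -> R[i]) (k : R[i])
    (f : R -> R[i]) : Prop :=
  schrodinger_solution q k f /\
  (fun x : R => cabs (f x * cexp (- ('i%C * x%:C * k)) - 1)) @ +oo --> (0 : R).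

Definition jost_minus (R : realType) (q : R -> R[i]) (k : R[i])
    (f : R -> R[i]) : Prop :=
  schrodinger_solution q k f /\
  (fun x : R => cabs (f x * cexp ('i%C * x%:C * k) - 1)) @ -oo --> (0 : R).

Definition jost_w (R : realType) (fp fm : R -> R[i] -> R[i]) (k : R[i]) : R[i] :=
  fm 0 k * cderiv (fp ^~ k) 0 - cderiv (fm ^~ k) 0 * fp 0 k.

Definition jost_psi (R : realType) (fp fm : R -> R[i] -> R[i]) (k : R[i])
  : R[i] := jost_w fp fm k / (2%:R * 'i%C * k).

(* The order is 0 when [w] is holomorphic near [z] and [w z != 0]. *)
Definition zero_order (R : realType) (w : R[i] -> R[i]) (z : R[i]) (m : nat)
  : Prop :=
  exists g : Cx R -> Cx R,
    [/\ \forall x \near (z : Cx R), derivable g x 1,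
        g z != 0 &
        \forall x \near (z : Cx R), w x = (x - z) ^+ m * g x].

(* [None] stands for infinitely many zeros; indices start from 0. *)
Definition zidx (N : option nat) (j : nat) : bool :=
  if N is Some n then (j < n)%N else true.

Definition enumerates_zeros (R : realType) (w : R[i] -> R[i])
    (N : option nat) (kz : nat -> R[i]) : Prop :=
  (forall j, zidx N j -> 0 < complex.Im (kz j)) /\
  (forall z : R[i], 0 < complex.Im z ->
    exists2 m, zero_order w z m &
      ([set j | zidx N j /\ kz j = z] #= `I_m)%card).

Definition blaschke (R : realType) (N : option nat) (kz : nat -> R[i])
    (k : R[i]) : R[i] :=
  lim ((fun n : nat => \prod_(j < n | zidx N j)
          ((k - kz j) / (k - (kz j)^*)) : Cx R) @ \oo).

Definition B0 (R : realType) (N : option nat) (kz : nat -> R[i]) : \bar R :=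
  (2%:E * \sum_(0 <= j <oo | zidx N j) (complex.Im (kz j))%:E)%E.

Definition compactly_supported (R : realType)
    (nu : {measure set (measurableTypeR R) -> \bar R}) : Prop :=
  exists2 A : set R, compact A & nu (~` A) = 0%E.

Definition lebesgue_singular (R : realType)
    (nu : {measure set (measurableTypeR R) -> \bar R}) : Prop :=
  exists A : set (measurableTypeR R),
    [/\ measurable A, @lebesgue_measure R A = 0%E & nu (~` A) = 0%E].

Definition factor_K (R : realType)
    (nu : {measure set (measurableTypeR R) -> \bar R}) (k : R[i]) : R[i] :=
  (pi^-1)%:C *
  cintegral nu setT (fun t : measurableTypeR R => (k - (t : R)%:C)^-1).

Definition factor_M (R : realType) (psi : R[i] -> R[i]) (k : R[i]) : R[i] :=
  (pi^-1)%:C *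
  cintegral (@lebesgue_measure R) setT
    (fun t => (ln (cabs (psi (t : R)%:C)))%:C / (k - (t : R)%:C)).

Definition canonical_factorization (R : realType) (psi : R[i] -> R[i])
    (N : option nat) (kz : nat -> R[i])
    (nu : {measure set (measurableTypeR R) -> \bar R}) : Prop :=
  [/\ compactly_supported nu,
      lebesgue_singular nu,
      locally_integrable setT (fun t : R => ln (cabs (psi t%:C))) &
      forall k : R[i], 0 < complex.Im k ->
        psi k = blaschke N kz k * cexp (- ('i%C * factor_K nu k))
                * cexp ('i%C * factor_M psi k)].

Section potential.
Variable R : realType.
Local Notation mu := (@lebesgue_measure R).

Definition admissible_potential (q : R -> R[i]) : Prop :=
  [/\ measurable_fun setT (fun x => complex.Re (q x)),
      measurable_fun setT (fun x => complex.Im (q x)) &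
      (\int[mu]_x ((1 + `|x|) * cabs (q x))%:E < +oo)%E].

Definition weighted_norm1 (q : R -> R[i]) : R :=
  \int[mu]_x cabs (x%:C * q x).

Definition r_c (q : R -> R[i]) : R := 2^-1 * \int[mu]_x cabs (q x).

Definition C_0 : R :=
  ln (3 * expR 1 / 2) + 3 * expR 1 ^+ 2 / 4 + 9 / 16 * expR 1 ^+ 4.

End potential.
Arguments C_0 {R}.

(* Main.v *)
Require Import Defs.
From mathcomp Require Import all_boot all_order all_algebra.
From mathcomp Require Import all_classical all_reals all_analysis.
From mathcomp Require Import measurable_realfun complex ring lra.

(** The inequality is a trace formula read at infinity.  Along [k = iy] the
logarithm of [|psi|] has two expressions.  From the Schroedinger equation,
[psi (k) = 1 - (1 / 2ik) int q + O(|k|^-2)], so that [y ln |psi (iy)|] tends to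
[(1/2) int Re q].  From the factorization, [y ln |psi (iy)|] is the sum of

  - the Blaschke part, which tends to [- 2 sum Im k_j];
  - the singular part, which tends to [- nu(R) / pi];
  - the Poisson average [(1 / pi) int (y^2 / (t^2 + y^2)) ln |psi (t)| dt].

Everything therefore comes down to bounding the last integral from above
uniformly in [y].  Its weight is even and lies between 0 and 1, so only upper
bounds for [ln |psi (t) psi (-t)|] with [t > 0] are needed
([weighted_integral_le]).  With [n] the weighted norm of [q] and [r = r_c],
there are three of them:

  - [2 n + 4 sqrt (r / t)], from [|psi (t)| <= e^n (1 + r / t)], used on
    [(0, 1)];
  - [2 r / t], from [|psi (k)| <= exp (r / |k|)], used up to [max (1, 4 r)];
  - [29 r^2 / t^2] for [t >= 4 r]: the first-order terms of [psi (t)] and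
    [psi (-t)] cancel.

Their integrals add up to at most [2 + 2 n + 2 r (C_0 + ln r)]
([split_bound_le]).

The bounds on [psi] come from the half-line equation, after factoring out the
free exponential: with [c = ik] and [f = e^(cx) m], the amplitudes
[a = (f' + c f) e^(-cx)] and [n = (f' - c f) e^(-cx)] tend to [2c] and [0].  The
energy [|a|^2 + |n|^2] times a power of [exp (int_x |q|)] is nondecreasing
([jost_energy]), which gives the second and third bounds; for small real [k]
the quantity [|m| + x |n|] times [exp (- int_x t |q|)] replaces it, which gives
the first.  At the origin [psi] is a quadratic expression in the amplitudes of
the two Jost solutions ([psi_amplitudes]).

Since [q] is only integrable, the equations hold almost everywhere and all
monotonicity arguments rest on one comparison theorem: for absolutely
continuous functions, an almost everywhere inequality [|F'| <= G'] implies the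
same inequality for the increments ([antideriv_comparison]). *)

Import Order.TTheory GRing.Theory Num.Theory.
Import numFieldNormedType.Exports.
Local Open Scope classical_set_scope.
Local Open Scope ring_scope.
Set Implicit Arguments.
Unset Strict Implicit.
Unset Printing Implicit Defensive.
Local Notation Re := complex.Re.
Local Notation Im := complex.Im.
Local Open Scope complex_scope.
Arguments cabs : simpl never.

(** * Complex modulus *)

Section Modulus.
Variable R : realType.
Implicit Types (z w : R[i]) (x y : R).

Lemma cReD z w : Re (z + w) = Re z + Re w. Proof. by case: z; case: w. Qed.
Lemma cImD z w : Im (z + w) = Im z + Im w. Proof. by case: z; case: w. Qed.
Lemma cReN z : Re (- z) = - Re z. Proof. by case: z. Qed.
Lemma cImN z : Im (- z) = - Im z. Proof. by case: z. Qed.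
Lemma cReM z w : Re (z * w) = Re z * Re w - Im z * Im w.
Proof. by case: z; case: w. Qed.
Lemma cImM z w : Im (z * w) = Re z * Im w + Im z * Re w.
Proof. by case: z => a b; case: w => c d /=. Qed.

Definition ReImE := (cReD, cImD, cReN, cImN, cReM, cImM).

Lemma cRe_conj z : Re (conjc z) = Re z. Proof. by case: z. Qed.
Lemma cIm_conj z : Im (conjc z) = - Im z. Proof. by case: z. Qed.

Lemma ReZ x z : Re (x%:C * z) = x * Re z.
Proof. by rewrite cReM /= mul0r subr0. Qed.
Lemma ImZ x z : Im (x%:C * z) = x * Im z.
Proof. by rewrite cImM /= mul0r addr0. Qed.

Lemma eq_ReIm z w : Re z = Re w -> Im z = Im w -> z = w.
Proof. by case: z => a b; case: w => c d /= -> ->. Qed.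

Lemma Re_cexp z : Re (cexp z) = expR (Re z) * cos (Im z).
Proof. by rewrite /cexp ReZ. Qed.
Lemma Im_cexp z : Im (cexp z) = expR (Re z) * sin (Im z).
Proof. by rewrite /cexp ImZ. Qed.

Lemma cabsE z : cabs z = Num.sqrt (Re z ^+ 2 + Im z ^+ 2).
Proof. by case: z. Qed.

Lemma cabs_sqr z : cabs z ^+ 2 = Re z ^+ 2 + Im z ^+ 2.
Proof. by rewrite cabsE sqr_sqrtr// addr_ge0// sqr_ge0. Qed.

Lemma cabs_ge0 z : 0 <= cabs z. Proof. by rewrite cabsE sqrtr_ge0. Qed.

Lemma cabs0 : cabs (0 : R[i]) = 0. Proof. exact: ComplexField.Normc.normc0. Qed.

Lemma cabs1 : cabs (1 : R[i]) = 1. Proof. exact: ComplexField.Normc.normc1. Qed.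

Lemma cabs_eq0 z : (cabs z == 0) = (z == 0).
Proof.
apply/eqP/eqP => [|->]; last exact: cabs0.
exact: ComplexField.Normc.eq0_normc.
Qed.

Lemma cabsM z w : cabs (z * w) = cabs z * cabs w.
Proof. exact: ComplexField.Normc.normcM. Qed.

Lemma cabsV z : cabs z^-1 = (cabs z)^-1.
Proof. exact: ComplexField.Normc.normcV. Qed.

Lemma cabsD z w : cabs (z + w) <= cabs z + cabs w.
Proof. exact: le_normcD. Qed.

Lemma cabsN z : cabs (- z) = cabs z.
Proof. by rewrite !cabsE !ReImE !sqrrN. Qed.

Lemma cabsB z w : cabs (z - w) <= cabs z + cabs w.
Proof. by rewrite -(cabsN w) cabsD. Qed.

Lemma cabsC z w : cabs (z - w) = cabs (w - z).
Proof. by rewrite -cabsN opprB. Qed.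

Lemma cabs_triangle z w u : cabs (z - u) <= cabs (z - w) + cabs (w - u).
Proof. by rewrite -[z - u](subrKA w) cabsD. Qed.

Lemma cabs_sub_le z w : `|cabs z - cabs w| <= cabs (z - w).
Proof.
have h (u v : R[i]) : cabs u - cabs v <= cabs (u - v).
  by rewrite lerBlDr; have := cabsD (u - v) v; rewrite subrK.
by rewrite ler_norml h andbT lerNl opprB cabsC h.
Qed.

Lemma cabs_real x : cabs x%:C = `|x|.
Proof. by rewrite cabsE /= expr0n addr0 sqrtr_sqr. Qed.

Lemma cabs_conj z : cabs (conjc z) = cabs z.
Proof. by case: z => a b; rewrite !cabsE /= sqrrN. Qed.

Lemma cabs_realB x y : cabs (x%:C - y%:C) = `|x - y|.
Proof. by rewrite -cabs_real rmorphB. Qed.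

Lemma cabs_conjB z w : cabs (conjc z - conjc w) = cabs (z - w).
Proof. by rewrite -[RHS]cabs_conj rmorphB. Qed.

Lemma normr_Re_le z : `|Re z| <= cabs z.
Proof. by rewrite cabsE -sqrtr_sqr ler_wsqrtr// lerDl sqr_ge0. Qed.

Lemma normr_Im_le z : `|Im z| <= cabs z.
Proof. by rewrite cabsE -sqrtr_sqr ler_wsqrtr// lerDr sqr_ge0. Qed.

Lemma Re_le_cabs z : Re z <= cabs z.
Proof. exact: le_trans (ler_norm _) (normr_Re_le z). Qed.

Lemma cabs_le_ReIm z : cabs z <= `|Re z| + `|Im z|.
Proof.
rewrite -(@ler_pXn2r _ 2)// ?nnegrE ?cabs_ge0 ?addr_ge0// cabs_sqr sqrrD.
rewrite !real_normK ?num_real// -addrA lerD2l lerDr.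
by rewrite mulrn_wge0// mulr_ge0.
Qed.

Lemma cabs_parallelogram z w :
  cabs (z + w) ^+ 2 + cabs (z - w) ^+ 2 = 2 * (cabs z ^+ 2 + cabs w ^+ 2).
Proof. by rewrite !cabs_sqr !ReImE; ring. Qed.

End Modulus.

(** * Cousin's lemma and linear approximation *)

Section Cousin.
Variable R : realType.
Implicit Types (a b u v x : R).

(** Cousin's lemma as an induction principle.  The supremum of the points that
can be reached from [a] is itself reached, since it has a good neighbourhood, and
the same neighbourhood leads beyond it unless it is [b]. *)
Lemma interval_induction (P : R -> R -> Prop) a b : a <= b ->
  (forall u v w, a <= u -> u <= v -> v <= w -> w <= b ->
     P u v -> P v w -> P u w) ->
  (forall x, a <= x <= b -> exists2 d : R, 0 < d & forall u v,
     a <= u -> u <= x -> x <= v -> v <= b -> x - d < u -> v < x + d -> P u v) ->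
  P a b.
Proof.
move=> ab Pcat Ploc.
pose S := [set x | a <= x <= b /\ P a x].
have Sa : S a.
  split; first by rewrite lexx.
  have [|d d0 dP] := Ploc a; first by rewrite lexx.
  by apply: dP => //; rewrite ?ltrDl ?gtrDl ?oppr_lt0.
have ubS : ubound S b by move=> x [/andP[]].
have hs : has_sup S by split; [exists a|exists b].
have sa : a <= sup S by apply: ub_le_sup => //; exists b.
have sb : sup S <= b by apply: ge_sup => //; exists a.
have [|d d0 dP] := Ploc (sup S); first by rewrite sa.
have [x [/andP[ax xb] Pax] dx] := sup_adherent d0 hs.
have xs : x <= sup S.
  by apply: ub_le_sup; [exists b|split=> //; rewrite ax].
pose v := Num.min b (sup S + d / 2).
have sv : sup S <= v by rewrite le_min sb /= lerDl divr_ge0// ltW.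
have vb : v <= b by rewrite ge_min lexx.
have Pv : P a v.
  apply: (Pcat a x v) => //; first exact: le_trans sv.
  apply: dP => //.
  by rewrite gt_min; apply/orP; right; rewrite ltrD2l ltr_pdivrMr// mulr_natr mulr2n ltrDl.
have : v <= sup S.
  by apply: ub_le_sup; [exists b|split=> //; rewrite vb (le_trans sa)].
rewrite /v ge_min => /orP[bs|]; last by rewrite gerDl leNgt divr_gt0.
have -> // : b = v.
by apply/eqP; rewrite eq_le vb andbT (le_trans bs).
Qed.

Lemma is_derive_linear_approx (f : R -> R) x d : is_derive x (1 : R) f d ->
  forall e : R, 0 < e -> exists2 r : R, 0 < r &
    forall y, `|y - x| < r -> `|f y - f x - (y - x) * d| <= e * `|y - x|.
Proof.
move=> fd e e0.
have H : h^-1 *: ((f \o shift x) (h *: (1 : R)) - f x) @[h --> (0:R)^'] --> d.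
  by rewrite -(@derive_val _ _ _ _ _ _ _ fd); exact: ex_derive.
move/cvgrPdist_le : H => /(_ e e0); rewrite near_withinE near_simpl.
move=> /nbhs_ballP[r r0 rP]; exists r => // y yr.
have [->|yx] := eqVneq y x; first by rewrite !subrr mul0r subr0 normr0 mulr0.
have yx0 : y - x != 0 by rewrite subr_eq0.
have := rP (y - x); rewrite /ball /= sub0r normrN => /(_ yr yx0).
rewrite /GRing.scale /= mulr1 subrK => H.
rewrite -normrN opprB (_ : _ * d - _ = (d - (y - x)^-1 * (f y - f x)) * (y - x)).
  by rewrite normrM ler_pM2r// normr_gt0.
by rewrite [RHS]mulrBl (mulrC d) mulrAC mulVf// mul1r.
Qed.

End Cousin.

(** * Derivatives of complex-valued functions *)

Section ComplexDerivative.
Variable R : realType.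
Implicit Types (F G : R -> R[i]) (d : R[i]) (x : R).

Definition cder F x d :=
  is_derive x (1 : R) (fun y => Re (F y)) (Re d) /\
  is_derive x (1 : R) (fun y => Im (F y)) (Im d).

Lemma cderivableP F x : cderivable F x -> cder F x (cderiv F x).
Proof. by move=> [fr fi]; split=> /=; rewrite derive1E; exact: derivableP. Qed.

Lemma cder_linear_approx F x d : cder F x d ->
  forall e : R, 0 < e -> exists2 r : R, 0 < r &
    forall y, `|y - x| < r -> cabs (F y - F x - (y - x)%:C * d) <= e * `|y - x|.
Proof.
move=> [/is_derive_linear_approx fr /is_derive_linear_approx fi] e e0.
have e20 : 0 < e / 2 by rewrite divr_gt0.
have [r r0 rP] := fr _ e20; have [s s0 sP] := fi _ e20.
exists (Num.min r s); first by rewrite lt_min r0.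
move=> y; rewrite lt_min => /andP[yr ys].
apply: le_trans (cabs_le_ReIm _) _.
rewrite !ReImE /= !mul0r subr0 addr0.
by apply: le_trans (lerD (rP _ yr) (sP _ ys)) _; rewrite -mulrDl -splitr.
Qed.

Lemma cder_cst (z : R[i]) x : cder (fun=> z) x 0.
Proof. by split=> /=; exact: is_derive_cst. Qed.

Lemma cder_real (f : R -> R) x (d : R) :
  is_derive x (1 : R) f d -> cder (fun y => (f y)%:C) x d%:C.
Proof. by move=> fd; split=> //=; exact: is_derive_cst. Qed.

Lemma cder_Re F x d : cder F x d -> cder (fun y => (Re (F y))%:C) x (Re d)%:C.
Proof. by case=> + _; exact: cder_real. Qed.

Lemma cderD F G x d e : cder F x d -> cder G x e ->
  cder (fun y => F y + G y) x (d + e).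
Proof.
move=> [fr fi] [gr gi]; split; rewrite !ReImE.
  by rewrite (_ : (fun y => _) = (fun y => Re (F y)) + (fun y => Re (G y)));
    [exact: is_deriveD|apply/funext => y; rewrite cReD].
by rewrite (_ : (fun y => _) = (fun y => Im (F y)) + (fun y => Im (G y)));
    [exact: is_deriveD|apply/funext => y; rewrite cImD].
Qed.

Lemma cderM F G x d e : cder F x d -> cder G x e ->
  cder (fun y => F y * G y) x (d * G x + F x * e).
Proof.
move=> [fr fi] [gr gi]; split; rewrite !ReImE.
  rewrite (_ : (fun y => _) = (fun y => Re (F y)) * (fun y => Re (G y))
      - (fun y => Im (F y)) * (fun y => Im (G y))).
    by apply: is_derive_eq; rewrite /GRing.scale/=; ring.
  by apply/funext => y; rewrite cReM.
rewrite (_ : (fun y => _) = (fun y => Re (F y)) * (fun y => Im (G y))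
      + (fun y => Im (F y)) * (fun y => Re (G y))).
  by apply: is_derive_eq; rewrite /GRing.scale/=; ring.
by apply/funext => y; rewrite cImM.
Qed.

Lemma cder_conj F x d : cder F x d -> cder (fun y => conjc (F y)) x (conjc d).
Proof.
move=> [fr fi]; split.
  rewrite (_ : (fun y => _) = (fun y => Re (F y))); last first.
    by apply/funext => y; case: (F y).
  by case: d {fi} fr.
rewrite (_ : (fun y => _) = - (fun y => Im (F y))); last first.
  by apply/funext => y; rewrite fctE; case: (F y).
rewrite (_ : Im _ = - Im d); last by case: d {fr fi}.
exact: is_deriveN.
Qed.

Lemma cder_reflect F x d : cder F (- x) d -> cder (fun y => F (- y)) x (- d).
Proof.
have dN : is_derive x (1 : R) (-%R : R -> R) (-1).
  have -> : (-%R : R -> R) = - id by apply/funext.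
  exact: is_deriveN.
move=> [fr fi]; split; rewrite !ReImE -mulrN1.
  exact: (@is_derive1_comp _ (fun y => Re (F y)) -%R).
exact: (@is_derive1_comp _ (fun y => Im (F y)) -%R).
Qed.

Lemma cder_cexp (c : R[i]) x :
  cder (fun y => cexp (y%:C * c)) x (c * cexp (x%:C * c)).
Proof.
have dl (t : R) : is_derive x (1 : R) (fun y : R => y * t) t.
  rewrite (_ : (fun y => _) = (t \*: id)); last first.
    by apply/funext => y; rewrite /= /GRing.scale/= mulrC.
  by apply: is_derive_eq; rewrite /GRing.scale/= mulr1.
split.
  rewrite (_ : (fun y => _) =
      (expR \o (fun y => y * Re c)) * (cos \o (fun y => y * Im c))); last first.
    by apply/funext => y; rewrite Re_cexp ReZ ImZ.
  apply: is_derive_eq.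
  by rewrite cReM Re_cexp Im_cexp ReZ ImZ /GRing.scale/=; ring.
rewrite (_ : (fun y => _) =
    (expR \o (fun y => y * Re c)) * (sin \o (fun y => y * Im c))); last first.
  by apply/funext => y; rewrite Im_cexp ReZ ImZ.
apply: is_derive_eq.
by rewrite cImM Re_cexp Im_cexp ReZ ImZ /GRing.scale/=; ring.
Qed.

End ComplexDerivative.

(** * Absolutely continuous functions *)

Section AbsoluteContinuity.
Variable R : realType.
Implicit Types (F G H : R -> R[i]) (a b : R).

(** Families of disjoint intervals as ordered lists, which, unlike indexed
families, concatenate. *)
Definition ordered_intervals a b (s : seq (R * R)) :=
  all (fun p => [&& a <= p.1, p.1 <= p.2 & p.2 <= b]) s /\
  pairwise (fun p q => p.2 <= q.1) s.

Lemma ordered_intervals_cat a b c s t : a <= b -> b <= c ->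
  ordered_intervals a b s -> ordered_intervals b c t ->
  ordered_intervals a c (s ++ t).
Proof.
move=> ab bc [/allP s1 s2] [/allP t1 t2]; split.
  rewrite all_cat; apply/andP; split; apply/allP => p ps.
    by have /and3P[-> -> /le_trans->] := s1 _ ps.
  by have /and3P[/(le_trans ab)-> -> ->] := t1 _ ps.
rewrite pairwise_cat s2 t2 !andbT; apply/allrelP => p q ps qt.
have /and3P[_ _ h1] := s1 _ ps; have /and3P[h2 _ _] := t1 _ qt.
exact: le_trans h2.
Qed.

Lemma abs_continuous_on_seq a b F : abs_continuous_on a b F ->
  forall eps : R, 0 < eps -> exists2 delta : R, 0 < delta &
    forall s, ordered_intervals a b s ->
      \sum_(p <- s) (p.2 - p.1) < delta ->
      \sum_(p <- s) cabs (F p.2 - F p.1) < eps.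
Proof.
move=> acF eps /acF[delta d0 dP]; exists delta => // s [/all_nthP s1 /pairwiseP s2].
rewrite !(big_nth (0, 0)) !big_mkord.
apply: (dP (size s) (fun i => (nth (0, 0) s i).1) (fun i => (nth (0, 0) s i).2)).
  by move=> i; have /and3P[-> -> ->] := s1 (0, 0) i (ltn_ord i).
apply/trivIsetP => i j _ _ ij; rewrite -subset0 => x [/=].
rewrite !in_itv/= => /andP[ix xi] /andP[jx xj].
have [lt_ij|lt_ij|/val_inj e] := ltngtP i j.
- have := s2 (0, 0) i j (ltn_ord i) (ltn_ord j) lt_ij.
  by rewrite leNgt (lt_trans jx xi).
- have := s2 (0, 0) j i (ltn_ord j) (ltn_ord i) lt_ij.
  by rewrite leNgt (lt_trans ix xj).
- by rewrite e eqxx in ij.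
Qed.

Lemma abs_continuous_on_dist a b F : abs_continuous_on a b F ->
  forall eps : R, 0 < eps -> exists2 delta : R, 0 < delta &
    forall u v, a <= u -> u <= v -> v <= b -> v - u < delta ->
      cabs (F v - F u) < eps.
Proof.
move=> /abs_continuous_on_seq acF eps /acF[delta d0 dP].
exists delta => // u v au uv vb uvd.
have := dP [:: (u, v)]; rewrite !big_seq1/=; apply => //.
by split => //=; rewrite au uv vb.
Qed.

Lemma abs_continuous_on_bounded a b F : a <= b -> abs_continuous_on a b F ->
  exists M : R, forall x, a <= x <= b -> cabs (F x) <= M.
Proof.
move=> ab /abs_continuous_on_dist /(_ 1 ltr01)[delta d0 dP].
apply: (@interval_induction _ (fun u v =>
  exists M : R, forall x, u <= x <= v -> cabs (F x) <= M)) => //.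
  move=> u v w _ uv vw _ [M MP] [N NP]; exists (Num.max M N) => x /andP[ux xw].
  rewrite le_max; have [xv|vx] := leP x v; first by rewrite MP// ux.
  by rewrite NP ?orbT// (ltW vx).
move=> x /andP[ax xb]; exists (delta / 2); first by rewrite divr_gt0.
move=> u v au ux xv vb ud vd; exists (cabs (F x) + 1) => y /andP[uy yv].
rewrite -lerBlDl; apply: le_trans (ler_norm _) _.
apply: le_trans (cabs_sub_le _ _) _.
have [yx|xy] := leP y x.
  by rewrite cabsC ltW// dP// ?(le_trans au)//; lra.
by rewrite ltW// dP// ?(ltW xy)// ?(le_trans yv)//; lra.
Qed.

(** All closure properties of absolute continuity come from this one: the
increments are dominated by those of two absolutely continuous functions. *)
Lemma abs_continuous_on_dominated a b F G H (M : R) :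
  abs_continuous_on a b G -> abs_continuous_on a b H ->
  (forall u v, a <= u -> u <= v -> v <= b ->
    cabs (F v - F u) <= M * (cabs (G v - G u) + cabs (H v - H u))) ->
  abs_continuous_on a b F.
Proof.
move=> acG acH FGH eps eps0.
pose K := `|M| + 1.
have K0 : 0 < K by rewrite ltr_wpDl.
have e20 : 0 < eps / (2 * K) by rewrite divr_gt0// mulr_gt0.
have [d1 d10 d1P] := acG _ e20; have [d2 d20 d2P] := acH _ e20.
exists (Num.min d1 d2); first by rewrite lt_min d10.
move=> n u v uv tI; rewrite lt_min => /andP[s1 s2].
have le1 : \sum_(i < n) cabs (F (v i) - F (u i)) <=
    K * (\sum_(i < n) cabs (G (v i) - G (u i)) + \sum_(i < n) cabs (H (v i) - H (u i))).
  rewrite -big_split/= mulr_sumr; apply: ler_sum => i _.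
  have [/andP[au uvi] vb] := uv i.
  apply: le_trans (FGH _ _ au uvi vb) _.
  rewrite ler_wpM2r ?addr_ge0 ?cabs_ge0// /K.
  by rewrite (le_trans (ler_norm M))// lerDl.
apply: le_lt_trans le1 _.
rewrite -ltr_pdivlMl//; apply: lt_le_trans (ltrD (d1P _ _ _ uv tI s1) (d2P _ _ _ uv tI s2)) _.
rewrite le_eqVlt; apply/orP; left; apply/eqP.
by field; rewrite gt_eqF.
Qed.

Lemma locally_abs_continuous_dominated F G H :
  locally_abs_continuous G -> locally_abs_continuous H ->
  (forall a b, a <= b -> exists M : R, forall u v, a <= u -> u <= v -> v <= b ->
    cabs (F v - F u) <= M * (cabs (G v - G u) + cabs (H v - H u))) ->
  locally_abs_continuous F.
Proof.
move=> acG acH FGH a b ab; have [M MP] := FGH _ _ ab.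
exact: abs_continuous_on_dominated (acG _ _ ab) (acH _ _ ab) MP.
Qed.

Lemma locally_abs_continuous_id : locally_abs_continuous (fun x : R => x%:C).
Proof.
move=> a b _ eps eps0; exists eps => // n u v uv _.
apply: le_lt_trans; apply: ler_sum => i _.
have [/andP[_ uvi] _] := uv i.
by rewrite cabs_realB ger0_norm// subr_ge0.
Qed.

Lemma locally_abs_continuousD F G :
  locally_abs_continuous F -> locally_abs_continuous G ->
  locally_abs_continuous (fun x => F x + G x).
Proof.
move=> acF acG; apply: (locally_abs_continuous_dominated acF acG) => a b _.
by exists 1 => u v _ _ _; rewrite mul1r opprD addrACA cabsD.
Qed.

Lemma locally_abs_continuous_conj F : locally_abs_continuous F ->
  locally_abs_continuous (fun x => conjc (F x)).
Proof.
move=> acF; apply: (locally_abs_continuous_dominated acF acF) => a b _.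
by exists 1 => u v _ _ _; rewrite mul1r cabs_conjB lerDl cabs_ge0.
Qed.

Lemma locally_abs_continuous_Re F : locally_abs_continuous F ->
  locally_abs_continuous (fun x => (Re (F x))%:C).
Proof.
move=> acF; apply: (locally_abs_continuous_dominated acF acF) => a b _.
exists 1 => u v _ _ _; rewrite mul1r cabs_realB.
by rewrite -cReN -cReD (le_trans (normr_Re_le _))// lerDl cabs_ge0.
Qed.

Lemma locally_abs_continuousM F G :
  locally_abs_continuous F -> locally_abs_continuous G ->
  locally_abs_continuous (fun x => F x * G x).
Proof.
move=> acF acG; apply: (locally_abs_continuous_dominated acF acG) => a b ab.
have [M MP] := abs_continuous_on_bounded ab (acF _ _ ab).
have [N NP] := abs_continuous_on_bounded ab (acG _ _ ab).
have M0 : 0 <= M by apply: le_trans (cabs_ge0 _) (MP a _); rewrite lexx.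
have N0 : 0 <= N by apply: le_trans (cabs_ge0 _) (NP a _); rewrite lexx.
exists (N + M) => u v au uv vb.
have -> : F v * G v - F u * G u = (F v - F u) * G v + F u * (G v - G u) by ring.
apply: le_trans (cabsD _ _) _; rewrite [leRHS]mulrDr !cabsM lerD//.
  rewrite mulrC ler_wpM2r ?cabs_ge0// (le_trans (NP _ _)) ?lerDl//.
  by rewrite vb (le_trans au).
rewrite ler_wpM2r ?cabs_ge0// (le_trans (MP _ _)) ?lerDr//.
by rewrite au (le_trans uv).
Qed.

Lemma locally_abs_continuous_real_comp (f g : R -> R) :
  locally_abs_continuous (fun x => (f x)%:C) ->
  (forall a b, a <= b -> exists M : R, forall u v, a <= u -> u <= v -> v <= b ->
    `|g (f v) - g (f u)| <= M * `|f v - f u|) ->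
  locally_abs_continuous (fun x => (g (f x))%:C).
Proof.
move=> acf gf; apply: (locally_abs_continuous_dominated acf acf) => a b ab.
have [M MP] := gf _ _ ab; exists `|M| => u v au uv vb.
rewrite !cabs_realB; apply: le_trans (MP _ _ au uv vb) _.
apply: le_trans (ler_wpM2r (normr_ge0 _) (ler_norm M)) _.
by rewrite ler_wpM2l// lerDl.
Qed.

(** Cousin's lemma takes the place of the mean value theorem, which fails for
complex values; the slack 1 absorbs the error of the linear approximation. *)
Lemma lipschitz_of_cder a b F (f : R -> R[i]) (M : R) : a <= b ->
  (forall x, a <= x <= b -> cder F x (f x) /\ cabs (f x) <= M) ->
  cabs (F b - F a) <= (M + 1) * (b - a).
Proof.
move=> ab Ff; apply: (@interval_induction _ (fun u v =>
  cabs (F v - F u) <= (M + 1) * (v - u))) => //.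
  move=> u v w _ _ _ _ h1 h2.
  rewrite -[w - u](subrKA v) mulrDr (le_trans (cabs_triangle _ (F v) _))//.
  exact: lerD.
move=> x /Ff[/cder_linear_approx/(_ 1 ltr01)[r r0 rP] fM].
exists r => // u v _ ux xv _ ur vr.
have M0 : 0 <= M by apply: le_trans (cabs_ge0 _) fM.
have hu : cabs (F u - F x) <= (M + 1) * (x - u).
  have := rP u; rewrite distrC ger0_norm ?subr_ge0// => /(_ ltac:(lra)) h.
  rewrite -[F u - F x](subrK ((u - x)%:C * f x)).
  apply: le_trans (cabsD _ _) _; rewrite addrC mulrDl lerD//.
  by rewrite cabsM cabs_real distrC ger0_norm ?subr_ge0// mulrC ler_wpM2r ?subr_ge0.
have hv : cabs (F v - F x) <= (M + 1) * (v - x).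
  have := rP v; rewrite ger0_norm ?subr_ge0// => /(_ ltac:(lra)) h.
  rewrite -[F v - F x](subrK ((v - x)%:C * f x)).
  apply: le_trans (cabsD _ _) _; rewrite addrC mulrDl lerD//.
  by rewrite cabsM cabs_real ger0_norm ?subr_ge0// mulrC ler_wpM2r ?subr_ge0.
rewrite -[v - u](subrKA x) mulrDr (le_trans (cabs_triangle _ (F x) _))//.
by rewrite lerD// cabsC.
Qed.

Lemma locally_abs_continuous_C1 F (f : R -> R[i]) :
  (forall x, cder F x (f x)) ->
  (forall a b, a <= b -> exists M : R, forall x, a <= x <= b -> cabs (f x) <= M) ->
  locally_abs_continuous F.
Proof.
move=> Ff bf.
apply: (locally_abs_continuous_dominated locally_abs_continuous_id
  locally_abs_continuous_id) => a b ab.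
have [M MP] := bf _ _ ab.
have M0 : 0 <= M by apply: le_trans (cabs_ge0 _) (MP a _); rewrite lexx.
exists (M + 1) => u v au uv vb.
apply: le_trans (lipschitz_of_cder uv (f := f) (M := M) _) _.
  move=> x /andP[ux xv]; split=> //; apply: MP.
  by rewrite (le_trans au)//= (le_trans xv).
rewrite cabs_realB ger0_norm ?subr_ge0// [leRHS]mulrDr lerDl.
by rewrite mulr_ge0 ?subr_ge0// addr_ge0.
Qed.

Lemma locally_abs_continuous_reflect F : locally_abs_continuous F ->
  locally_abs_continuous (fun x => F (- x)).
Proof.
move=> acF a b ab eps eps0.
have [|delta d0 dP] := acF (- b) (- a) _ eps eps0; first by rewrite lerN2.
exists delta => // n u v uv tI uvd.
under eq_bigr do rewrite cabsC.
apply: (dP n (fun i => - v i) (fun i => - u i)).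
- by move=> i; have [/andP[au uvi] vb] := uv i; rewrite !lerN2 au uvi vb.
- apply/trivIsetP => i j _ _ ij; rewrite -subset0 => x [/=].
  rewrite !in_itv/= => /andP[ix xi] /andP[jx xj].
  move/trivIsetP : tI => /(_ i j I I ij); rewrite -subset0 => /(_ (- x)); apply.
  by split => /=; rewrite in_itv/= ltrNl ltrNr; apply/andP.
- by under eq_bigr do rewrite opprK addrC.
Qed.

End AbsoluteContinuity.

(** * Comparison of increments *)

Section Comparison.
Variable R : realType.
Local Notation mu := (@lebesgue_measure R).

Lemma aeS (P Q : R -> Prop) : (forall x, P x -> Q x) ->
  {ae mu, forall x, P x} -> {ae mu, forall x, Q x}.
Proof. exact: (@filterS _ _ (ae_filter_ringOfSetsType mu)). Qed.

Lemma aeS2 (P Q S : R -> Prop) : (forall x, P x -> Q x -> S x) ->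
  {ae mu, forall x, P x} -> {ae mu, forall x, Q x} -> {ae mu, forall x, S x}.
Proof. exact: (@filterS2 _ _ (ae_filter_ringOfSetsType mu)). Qed.

Lemma aeT (P : R -> Prop) : (forall x, P x) -> {ae mu, forall x, P x}.
Proof.
move=> h; apply: (@aeS (fun=> True)) => //.
exact: (@filterT _ _ (ae_filter_ringOfSetsType mu)).
Qed.

Lemma ordered_intervals_length (U : set R) a b (s : seq (R * R)) :
  measurable U -> ordered_intervals a b s ->
  (forall p, p \in s -> `]p.1, p.2[ `<=` U) ->
  ((\sum_(p <- s) (p.2 - p.1))%:E <= mu U)%E.
Proof.
move=> + [+ +]; elim: s U => [|p s ih] U mU; first by rewrite big_nil measure_ge0.
move=> /=/andP[/and3P[_ p12 _] s1] /andP[/allP ps s2] sU.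
rewrite big_cons EFinD; pose V := U `&` `]p.2, +oo[.
have mV : measurable V by exact: measurableI.
have sV : forall q, q \in s -> `]q.1, q.2[ `<=` V.
  move=> q qs x xq; split; first by apply: (sU q) => //; rewrite inE qs orbT.
  move: xq => /=; rewrite !in_itv/= andbT => /andP[+ _].
  exact: le_lt_trans (ps _ qs).
have pU : `]p.1, p.2[ `<=` U by apply: sU; rewrite inE eqxx.
apply: (@le_trans _ _ (mu (`]p.1, p.2[ `|` V))); last first.
  by apply: le_measure; rewrite ?inE//; [exact: measurableU|move=> x [/pU//|[]]].
rewrite measureU//; last first.
  rewrite -subset0 => x [/=]; rewrite in_itv/= => /andP[_ xp] [_ /=].
  by rewrite in_itv/= andbT ltNge (ltW xp).
apply: leeD; last exact: ih.
rewrite [leRHS](@lebesgue_measure_itv R `]p.1, p.2[)/= lte_fin.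
by case: ltgtP p12 => // ->; rewrite subrr.
Qed.

(** Absolute continuity with an almost everywhere derivative: a class stable under
algebraic operations in which the equation and its consequences can be handled
without integrating complex functions. *)
Definition antideriv (F f : R -> R[i]) :=
  locally_abs_continuous F /\ {ae mu, forall x, cder F x (f x)}.

Definition antideriv_real (F f : R -> R) :=
  antideriv (fun x => (F x)%:C) (fun x => (f x)%:C).

(** Cover the null set where the derivatives misbehave by an open set of small
measure.  By Cousin's lemma the interval splits into pieces around good points,
where the increments compare up to a small multiple of the length, and pieces
inside the open set, where absolute continuity makes the total increment
small. *)
Theorem antideriv_comparison (F f : R -> R[i]) (G g : R -> R) a b : a <= b ->
  antideriv F f -> antideriv_real G g ->
  {ae mu, forall x, a <= x <= b -> cabs (f x) <= g x} ->
  cabs (F b - F a) <= G b - G a.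
Proof.
move=> ab [acF dF] [acG dG] fg; apply/ler_addgt0Pr; move=> /= e e0.
have e40 : 0 < e / 4 by rewrite divr_gt0.
have [d1 d10 d1P] := abs_continuous_on_seq (acF _ _ ab) e40.
have [d2 d20 d2P] := abs_continuous_on_seq (acG _ _ ab) e40.
pose d := Num.min d1 d2; have d0 : 0 < d by rewrite lt_min d10.
have [Z [mZ Z0 HZ]] : {ae mu, forall x, [/\ cder F x (f x),
    cder (fun y => (G y)%:C) x (g x)%:C & a <= x <= b -> cabs (f x) <= g x]}.
  by apply: aeS2 (aeS2 (fun x p q => conj p q) dF dG) fg => x [].
have {}Z0 : lebesgue_measure (Z : set R) = 0%E := Z0.
have [|U [oU ZU UZ]] := @lebesgue_regularity_outer R Z d mZ _ d0.
  exact: (eq_ind_r (fun t => (t < +oo)%E) (ltry 0) Z0).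
have mU : measurable U by exact: open_measurable.
have Ud : (mu U < d%:E)%E.
  have e1 : U = Z `|` (U `\` Z) by rewrite setDUK.
  rewrite e1; apply: le_lt_trans UZ.
  apply: le_trans (@measureU2 _ _ _ (@lebesgue_measure R) Z (U `\` Z) mZ _) _.
    exact: measurableD.
  exact: (eq_ind_r (fun t => (t + _ <= _)%E) (eq_ind_r (fun t => (t <= _)%E) (lexx _) (add0e _)) Z0).
pose eta := e / (2 * (b - a + 1)).
have ba1 : 0 < b - a + 1 by rewrite ltr_wpDl// subr_ge0.
have eta0 : 0 < eta by rewrite divr_gt0// mulr_gt0.
(* [s] collects the pieces around bad points, and [eta * (b - a)] bounds the error
   accumulated on the others. *)
have [s [s1 sU sP]] : exists s, [/\ ordered_intervals a b s,
    (forall p, p \in s -> `]p.1, p.2[ `<=` U) &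
    cabs (F b - F a) <= G b - G a + eta * (b - a) +
      (\sum_(p <- s) cabs (F p.2 - F p.1) +
       \sum_(p <- s) cabs ((G p.2)%:C - (G p.1)%:C))].
  apply: (@interval_induction _ (fun u v => exists s, [/\ ordered_intervals u v s,
    (forall p, p \in s -> `]p.1, p.2[ `<=` U) &
    cabs (F v - F u) <= G v - G u + eta * (v - u) +
      (\sum_(p <- s) cabs (F p.2 - F p.1) +
       \sum_(p <- s) cabs ((G p.2)%:C - (G p.1)%:C))])) => //.
    move=> u v w _ uv vw _ [s [s1 s2 s3]] [t [t1 t2 t3]].
    exists (s ++ t); split; first exact: ordered_intervals_cat s1 t1.
      by move=> p; rewrite mem_cat => /orP[/s2|/t2].
    rewrite !big_cat/=; have := cabs_triangle (F w) (F v) (F u).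
    move: s3 t3; set A := cabs _; set B := \sum_(p <- s) _; set C := \sum_(p <- s) _.
    set D := cabs _; set E := \sum_(p <- t) _; set K := \sum_(p <- t) _.
    set L := cabs _; lra.
  move=> x xab; have [xZ|nxZ] := pselect (Z x).
    have /open_subball := oU => /(_ x (ZU _ xZ))[r /= r0 rU].
    pose r' := r / 2; have r'0 : 0 < r' by rewrite divr_gt0.
    have r'r : r' < r by rewrite ltr_pdivrMr// mulr_natr mulr2n ltrDl.
    have xrU : ball x r' `<=` U.
      by apply: rU => //=; rewrite sub0r normrN gtr0_norm.
    exists r' => // u v _ ux xv _ ur vr.
    exists [:: (u, v)]; split.
    - by split => //=; rewrite !lexx (le_trans ux).
    - move=> p; rewrite inE => /eqP -> y /=; rewrite in_itv/= => /andP[uy yv].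
      by apply: xrU; rewrite /ball/= ltr_distlC; apply/andP; split; lra.
    - rewrite !big_seq1/= cabs_realB.
      have := ler_norm (- (G v - G u)); rewrite normrN.
      have : 0 <= eta * (v - u) by rewrite mulr_ge0 ?(ltW eta0)// subr_ge0 (le_trans ux).
      by set A := cabs _; set B := eta * _; lra.
  (* At a good point the linear approximations have error at most [eta / 2] times
     the distance, on each side and for each of [F] and [G]. *)
  have [dFx dGx fgx] : [/\ cder F x (f x),
    cder (fun y => (G y)%:C) x (g x)%:C & a <= x <= b -> cabs (f x) <= g x].
    by apply: contrapT => h; exact/nxZ/HZ.
  have eta20 : 0 < eta / 2 by rewrite divr_gt0.
  have [r1 r10 r1P] := cder_linear_approx dFx eta20.
  have [r2 r20 r2P] := cder_linear_approx dGx eta20.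
  exists (Num.min r1 r2); first by rewrite lt_min r10.
  move=> u v _ ux xv _ ur vr.
  have [u1 u2] : x - r1 < u /\ x - r2 < u.
    by split; apply: le_lt_trans ur; rewrite lerD2l lerN2 ge_min lexx ?orbT.
  have [v1 v2] : v < x + r1 /\ v < x + r2.
    by split; apply: lt_le_trans vr _; rewrite lerD2l ge_min lexx ?orbT.
  exists [::]; split => //; rewrite !big_nil !addr0.
  have hl y : `|y - x| < r1 -> `|y - x| < r2 ->
      cabs (F y - F x - (y - x)%:C * f x) <= eta / 2 * `|y - x| /\
      `|G y - G x - (y - x) * g x| <= eta / 2 * `|y - x|.
    by move=> yr1 yr2; split; [exact: r1P|rewrite -cabs_real !rmorphB rmorphM r2P].
  have xu : `|u - x| = x - u by rewrite distrC ger0_norm// subr_ge0.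
  have vx : `|v - x| = v - x by rewrite ger0_norm// subr_ge0.
  have [|| hu hGu] := hl u; [by rewrite xu; lra|by rewrite xu; lra|].
  have [|| hv hGv] := hl v; [by rewrite vx; lra|by rewrite vx; lra|].
  have E : F v - F u = (F v - F x - (v - x)%:C * f x)
      - (F u - F x - (u - x)%:C * f x) + (v - u)%:C * f x.
    by rewrite !rmorphB/=; ring.
  have h1 : cabs ((v - u)%:C * f x) <= (v - u) * g x.
    rewrite cabsM cabs_real ger0_norm ?subr_ge0 ?(le_trans ux)//.
    by rewrite ler_wpM2l ?fgx// subr_ge0 (le_trans ux).
  have := le_trans (cabsD _ _) (lerD (le_trans (cabsB _ _) (lerD hv hu)) h1).
  rewrite -E xu vx.
  move: hGu hGv; rewrite xu vx !ler_norml => /andP[gu1 gu2] /andP[gv1 gv2].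
  set A := cabs _; move: gu1 gu2 gv1 gv2.
  have -> : (u - x) * g x = u * g x - x * g x by ring.
  have -> : (v - x) * g x = v * g x - x * g x by ring.
  have -> : (v - u) * g x = v * g x - u * g x by ring.
  have -> : eta / 2 * (v - x) = eta * v / 2 - eta * x / 2 by field.
  have -> : eta / 2 * (x - u) = eta * x / 2 - eta * u / 2 by field.
  have -> : eta * (v - u) = eta * v - eta * u by ring.
  by lra.
have sd : \sum_(p <- s) (p.2 - p.1) < d.
  by rewrite -lte_fin; apply: le_lt_trans Ud; exact: ordered_intervals_length s1 sU.
have {}d1P : \sum_(p <- s) cabs (F p.2 - F p.1) < e / 4.
  by apply: d1P => //; apply: lt_le_trans sd _; rewrite ge_min lexx.
have {}d2P : \sum_(p <- s) cabs ((G p.2)%:C - (G p.1)%:C) < e / 4.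
  by apply: d2P => //; apply: lt_le_trans sd _; rewrite ge_min lexx orbT.
have he : eta * (b - a) <= e / 2.
  have -> : e / 2 = eta * (b - a + 1) by rewrite /eta; field; rewrite gt_eqF.
  by rewrite ler_wpM2l ?(ltW eta0)// lerDl.
move: sP d1P d2P he; set A := cabs _; set B := \sum_(p <- s) _.
by set C := \sum_(p <- s) _; set D := eta * _; lra.
Qed.

End Comparison.

(** * Calculus of antiderivatives *)

Section Antiderivatives.
Variable R : realType.
Local Notation mu := (@lebesgue_measure R).
Implicit Types (F G f g : R -> R[i]).

Lemma ae_reflect (P : R -> Prop) :
  {ae mu, forall x, P x} -> {ae mu, forall x, P (- x)}.
Proof.
move=> [Z [mZ Z0 PZ]]; exists (-%R @^-1` Z); split.
- rewrite -[X in measurable X]setTI.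
  exact: (@measurable_funN _ _ _ _ id).
- exact: etrans (lebesgue_measureN mZ) Z0.
- by move=> x /= h; apply: (PZ (- x)).
Qed.

Lemma eq_antideriv F f g : f = g -> antideriv F f -> antideriv F g.
Proof. by move=> ->. Qed.

Lemma antideriv_C1 F f : (forall x, cder F x (f x)) ->
  (forall a b, a <= b -> exists M : R, forall x, a <= x <= b -> cabs (f x) <= M) ->
  antideriv F f.
Proof. by move=> Ff bf; split; [exact: locally_abs_continuous_C1 bf|exact: aeT]. Qed.

Lemma antideriv_cst (c : R[i]) : antideriv (fun=> c) (fun=> 0).
Proof.
apply: antideriv_C1 => [x|a b ab]; first exact: cder_cst.
by exists 0 => x _; rewrite cabs0.
Qed.

Lemma antideriv_id : antideriv_real (fun x : R => x) (fun=> 1).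
Proof.
apply: antideriv_C1 => [x|a b ab]; first exact: cder_real.
by exists 1 => x _; rewrite cabs1.
Qed.

Lemma cabs_cexp (z : R[i]) : cabs (cexp z) = expR (Re z).
Proof.
rewrite cabsE Re_cexp Im_cexp !exprMn -mulrDr cos2Dsin2 mulr1.
by rewrite sqrtr_sqr ger0_norm// expR_ge0.
Qed.

Lemma antideriv_cexp (c : R[i]) :
  antideriv (fun x => cexp (x%:C * c)) (fun x => c * cexp (x%:C * c)).
Proof.
apply: antideriv_C1 => [x|a b ab]; first exact: cder_cexp.
exists (cabs c * expR (`|a * Re c| + `|b * Re c|)) => x /andP[ax xb].
rewrite cabsM ler_wpM2l ?cabs_ge0// cabs_cexp ReZ ler_expR.
have [c0|c0] := leP 0 (Re c).
  rewrite (le_trans (ler_wpM2r c0 xb))// (le_trans (ler_norm _))//.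
  by rewrite lerDr.
rewrite (le_trans (ler_wnM2r (ltW c0) ax))// (le_trans (ler_norm _))//.
by rewrite lerDl.
Qed.

Lemma antiderivD F G f g : antideriv F f -> antideriv G g ->
  antideriv (fun x => F x + G x) (fun x => f x + g x).
Proof.
move=> [aF dF] [aG dG]; split; first exact: locally_abs_continuousD.
by apply: aeS2 dF dG => x; exact: cderD.
Qed.

Lemma antiderivM F G f g : antideriv F f -> antideriv G g ->
  antideriv (fun x => F x * G x) (fun x => f x * G x + F x * g x).
Proof.
move=> [aF dF] [aG dG]; split; first exact: locally_abs_continuousM.
by apply: aeS2 dF dG => x; exact: cderM.
Qed.

Lemma antiderivZ (c : R[i]) F f : antideriv F f ->
  antideriv (fun x => c * F x) (fun x => c * f x).
Proof.
move=> aF; have := antiderivM (antideriv_cst c) aF.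
by apply: eq_antideriv; apply/funext => x; rewrite mul0r add0r.
Qed.

Lemma antiderivB F G f g : antideriv F f -> antideriv G g ->
  antideriv (fun x => F x - G x) (fun x => f x - g x).
Proof.
move=> aF aG; have := antiderivD aF (antiderivZ (-1) aG).
rewrite (_ : (fun x => F x - G x) = (fun x => F x + -1 * G x)).
  by apply: eq_antideriv; apply/funext => x; rewrite mulN1r.
by apply/funext => x; rewrite mulN1r.
Qed.

Lemma antideriv_conj F f : antideriv F f ->
  antideriv (fun x => conjc (F x)) (fun x => conjc (f x)).
Proof.
move=> [aF dF]; split; first exact: locally_abs_continuous_conj.
by apply: aeS dF => x; exact: cder_conj.
Qed.

Lemma antideriv_Re F f : antideriv F f ->
  antideriv_real (fun x => Re (F x)) (fun x => Re (f x)).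
Proof.
move=> [aF dF]; split; first exact: locally_abs_continuous_Re.
by apply: aeS dF => x; exact: cder_Re.
Qed.

Lemma antideriv_reflect F f : antideriv F f ->
  antideriv (fun x => F (- x)) (fun x => - f (- x)).
Proof.
move=> [aF dF]; split; first exact: locally_abs_continuous_reflect.
by apply: aeS (ae_reflect dF) => x; exact: cder_reflect.
Qed.

Lemma antideriv_realD (F f G g : R -> R) : antideriv_real F f ->
  antideriv_real G g -> antideriv_real (fun x => F x + G x) (fun x => f x + g x).
Proof.
move=> aF aG; have := antideriv_Re (antiderivD aF aG).
by rewrite /antideriv_real; congr antideriv; apply/funext => x; rewrite !cReD.
Qed.

Lemma antideriv_realM (F f G g : R -> R) : antideriv_real F f ->
  antideriv_real G g ->
  antideriv_real (fun x => F x * G x) (fun x => f x * G x + F x * g x).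
Proof.
move=> aF aG; have := antideriv_Re (antiderivM aF aG).
by rewrite /antideriv_real; congr antideriv; apply/funext => x;
  rewrite ?cReD !ReZ.
Qed.

Lemma antideriv_realZ (c : R) (F f : R -> R) : antideriv_real F f ->
  antideriv_real (fun x => c * F x) (fun x => c * f x).
Proof.
move=> aF; have := antideriv_Re (antiderivZ c%:C aF).
by rewrite /antideriv_real; congr antideriv; apply/funext => x; rewrite ReZ.
Qed.

Lemma antideriv_real_reflect (F f : R -> R) : antideriv_real F f ->
  antideriv_real (fun x => F (- x)) (fun x => - f (- x)).
Proof.
move=> aF; have := antideriv_Re (antideriv_reflect aF).
by rewrite /antideriv_real; congr antideriv; apply/funext => x; rewrite cReN.
Qed.

Lemma antideriv_nondecreasing (G g : R -> R) a b : a <= b ->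
  antideriv_real G g -> {ae mu, forall x, a <= x <= b -> 0 <= g x} ->
  G a <= G b.
Proof.
move=> ab aG g0; rewrite -subr_ge0 -(@cabs0 R).
have := antideriv_comparison ab (antideriv_cst 0) aG.
by rewrite subrr; apply; apply: aeS g0 => x h /h; rewrite cabs0.
Qed.

Lemma antideriv_real_comp (F f phi dphi : R -> R) : antideriv_real F f ->
  (forall x, is_derive (F x) (1 : R) phi (dphi (F x))) ->
  (forall a b, a <= b -> exists M : R, forall u v, a <= u -> u <= v -> v <= b ->
    `|phi (F v) - phi (F u)| <= M * `|F v - F u|) ->
  antideriv_real (fun x => phi (F x)) (fun x => dphi (F x) * f x).
Proof.
move=> [aF dF] dphiF lip; split; first exact: locally_abs_continuous_real_comp.
by apply: aeS dF => x [fr _]; apply: cder_real.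
Qed.

(** The sign condition makes the exponential 1-Lipschitz on the range of [F]; it
holds for the integrating factors used below. *)
Lemma antideriv_expR (F f : R -> R) : antideriv_real F f ->
  (forall x, F x <= 0) ->
  antideriv_real (fun x => expR (F x)) (fun x => expR (F x) * f x).
Proof.
move=> aF F0; apply: antideriv_real_comp => // a b ab.
exists 1 => u v _ _ _; rewrite mul1r.
have h (s t : R) : t <= 0 -> s <= t -> expR t - expR s <= t - s.
  move=> t0 st; have -> : expR s = expR (s - t) * expR t by rewrite -expRD subrK.
  have := expR_ge1Dx (s - t).
  have : expR t <= 1 by rewrite -expR0 ler_expR.
  have := expR_gt0 t; set y := expR t; set z := expR (s - t) => y0 y1 hz.
  have : y * (1 + (s - t)) <= y * z by rewrite ler_wpM2l// ltW.
  have : y * (t - s) <= 1 * (t - s) by rewrite ler_wpM2r// subr_ge0.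
  by nra.
have [uv|vu] := leP (F u) (F v).
  by rewrite !ger0_norm ?subr_ge0 ?ler_expR// h.
by rewrite !ltr0_norm ?subr_lt0 ?ltr_expR// !opprB h// ltW.
Qed.

Lemma cabs_sub_sqrt (e : R) (z w : R[i]) : 0 < e ->
  `|Num.sqrt (cabs z ^+ 2 + e) - Num.sqrt (cabs w ^+ 2 + e)| <= cabs (z - w).
Proof.
move=> e0; apply: le_trans (cabs_sub_le _ _).
set s := cabs z; set t := cabs w.
have s0 : 0 <= s by exact: cabs_ge0.
have t0 : 0 <= t by exact: cabs_ge0.
pose A := Num.sqrt (s ^+ 2 + e); pose B := Num.sqrt (t ^+ 2 + e).
have AS : A ^+ 2 = s ^+ 2 + e by rewrite sqr_sqrtr// addr_ge0 ?sqr_ge0// ltW.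
have BS : B ^+ 2 = t ^+ 2 + e by rewrite sqr_sqrtr// addr_ge0 ?sqr_ge0// ltW.
have sA : s <= A.
  by rewrite -[leLHS]ger0_norm// -sqrtr_sqr ler_wsqrtr// lerDl ltW.
have tB : t <= B.
  by rewrite -[leLHS]ger0_norm// -sqrtr_sqr ler_wsqrtr// lerDl ltW.
have A0 : 0 < A by rewrite sqrtr_gt0 ltr_wpDl// sqr_ge0.
have B0 : 0 < B by rewrite sqrtr_gt0 ltr_wpDl// sqr_ge0.
rewrite -/A -/B.
have E : (A - B) * (A + B) = (s - t) * (s + t).
  by rewrite -!subr_sqr AS BS; ring.
have AB0 : 0 < A + B by rewrite addr_gt0.
rewrite -(ler_pM2r AB0) -{1}(gtr0_norm AB0) -normrM E normrM ler_wpM2l//.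
by rewrite ger0_norm ?addr_ge0// lerD.
Qed.

(** A smooth substitute for the modulus, which need not be differentiable where
the function vanishes. *)
Lemma antideriv_sqrt (e : R) F f : 0 < e -> antideriv F f ->
  antideriv_real (fun x => Num.sqrt (cabs (F x) ^+ 2 + e))
    (fun x => Re (conjc (F x) * f x) / Num.sqrt (cabs (F x) ^+ 2 + e)).
Proof.
move=> e0 aF; split.
  apply: (locally_abs_continuous_dominated (proj1 aF) (proj1 aF)) => a b ab.
  exists 1 => u v _ _ _; rewrite mul1r cabs_realB.
  by apply: le_trans (cabs_sub_sqrt _ _ e0) _; rewrite lerDl cabs_ge0.
case: aF => _; apply: aeS => x [fr fi]; apply: cder_real.
have E : (fun y => Num.sqrt (cabs (F y) ^+ 2 + e)) =
    Num.sqrt \o ((fun y => Re (F y)) * (fun y => Re (F y)) +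
     (fun y => Im (F y)) * (fun y => Im (F y)) + cst e).
  by apply/funext => y; rewrite /= cabs_sqr /= !fctE -!expr2.
rewrite E.
have p0 : 0 < Re (F x) * Re (F x) + Im (F x) * Im (F x) + e.
  by rewrite ltr_wpDl// -!expr2 addr_ge0// sqr_ge0.
pose D := 2 * (Re (F x) * Re (f x) + Im (F x) * Im (f x)).
rewrite (_ : _ / _ = (2 * Num.sqrt (Re (F x) * Re (F x) + Im (F x) * Im (F x) + e))^-1 * D).
  apply: is_derive1_comp; first exact: is_derive1_sqrt.
  by apply: is_derive_eq; rewrite /GRing.scale/= /D; ring.
rewrite cabs_sqr -!expr2 /D.
have -> : Re (conjc (F x) * f x) = Re (F x) * Re (f x) + Im (F x) * Im (f x).
  by rewrite cReM cRe_conj cIm_conj mulNr opprK.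
have s0 : Num.sqrt (Re (F x) ^+ 2 + Im (F x) ^+ 2 + e) != 0.
  by rewrite gt_eqF// sqrtr_gt0; rewrite -!expr2 in p0.
by field.
Qed.

End Antiderivatives.

(** * Vanishing at infinity and primitives of integrable functions *)

Section Vanishing.
Variable R : realType.
Implicit Types (f g : R -> R).

Definition vanishes f := forall e : R, 0 < e ->
  exists X : R, forall x, X <= x -> `|f x| < e.

Lemma vanishes_le f g (X : R) :
  (forall x, X <= x -> `|f x| <= g x) -> vanishes g -> vanishes f.
Proof.
move=> fg vg e /vg[Y YP]; exists (Num.max X Y) => x; rewrite ge_max => /andP[Xx Yx].
by apply: le_lt_trans (fg _ Xx) _; apply: le_lt_trans (ler_norm _) (YP _ Yx).
Qed.

Lemma vanishesD f g : vanishes f -> vanishes g -> vanishes (fun x => f x + g x).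
Proof.
move=> vf vg e e0; have e20 : 0 < e / 2 by rewrite divr_gt0.
have [X XP] := vf _ e20; have [Y YP] := vg _ e20.
exists (Num.max X Y) => x; rewrite ge_max => /andP[Xx Yx].
rewrite [e]splitr; apply: le_lt_trans (ler_normD _ _) _.
exact: ltrD (XP _ Xx) (YP _ Yx).
Qed.

Lemma vanishesZ (c : R) f : vanishes f -> vanishes (fun x => c * f x).
Proof.
move=> vf e e0; have c0 : 0 < `|c| + 1 by rewrite ltr_wpDl.
have [X XP] := vf (e / (`|c| + 1)) (divr_gt0 e0 c0).
exists X => x /XP; rewrite ltr_pdivlMr// => h; apply: le_lt_trans h.
by rewrite normrM mulrC ler_wpM2l// lerDl.
Qed.

Lemma vanishes_sqr f : vanishes f -> vanishes (fun x => f x ^+ 2).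
Proof.
move=> vf e e0; pose d := Num.min 1 e.
have d0 : 0 < d by rewrite lt_min ltr01.
have [X XP] := vf _ d0; exists X => x /XP; rewrite lt_min => /andP[h1 he].
rewrite normrX expr2; apply: le_lt_trans he.
by rewrite -[leRHS]mulr1 ler_wpM2l// ltW.
Qed.

Lemma le_of_vanishes (A B : R) f (X : R) : vanishes f ->
  (forall x, X <= x -> A <= B + f x) -> A <= B.
Proof.
move=> vf h; apply/ler_addgt0Pr => e /vf[Y YP].
have := h (Num.max X Y); rewrite le_max lexx => /(_ isT) /le_trans; apply.
rewrite lerD2l; apply: le_trans (ler_norm _) _.
by apply/ltW/YP; rewrite le_max lexx orbT.
Qed.

Lemma cvg_vanishes f : f x @[x --> +oo] --> (0 : R) -> vanishes f.
Proof.
move=> /cvgrPdist_lt f0 e /f0 [M [_ MP]]; exists (M + 1) => x Mx.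
have := MP x; rewrite sub0r normrN; apply.
by rewrite (lt_le_trans _ Mx)// ltrDl.
Qed.

End Vanishing.

Section IntegralPrimitive.
Variable R : realType.
Local Notation mu := (@lebesgue_measure R).
Variable h : R -> R.
Hypothesis inth : mu.-integrable setT (EFin \o h).

Definition primitive (x : R) : R := \int[mu]_(t in `]-oo, x]) h t.

Let inthS (A : set R) : measurable A -> mu.-integrable A (EFin \o h).
Proof. by move=> mA; exact: integrableS inth. Qed.

Let inthn : mu.-integrable setT (EFin \o (fun x => `|h x|)).
Proof. by have := integrable_abse inth. Qed.

Let inthnS (A : set R) : measurable A -> mu.-integrable A (EFin \o (fun x => `|h x|)).
Proof. by move=> mA; exact: integrableS inthn. Qed.

Let mhn (A : set R) : measurable A ->
  measurable_fun A (EFin \o (fun x => `|h x|)).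
Proof. by move=> /inthnS /integrableP[]. Qed.

Let fin_numn (A : set R) : measurable A ->
  (\int[mu]_(t in A) `|h t|%:E)%E \is a fin_num.
Proof. by move=> mA; apply: integrable_fin_num => //; exact: inthnS. Qed.

Lemma primitiveB u v : u <= v ->
  primitive v - primitive u = \int[mu]_(t in `]u, v]) h t.
Proof. by move=> uv; rewrite /primitive Rintegral_itvB// ?bnd_simp//; exact: inthS. Qed.

(** Absolute continuity of the integral: over the union of the intervals, a set of
small measure, the integral of [|h|] is small. *)
Lemma primitive_abs_continuous : locally_abs_continuous (fun x => (primitive x)%:C).
Proof.
move=> a b ab eps eps0.
have [d [d0 dP]] := integral_normr_continuous inth eps0.
exists d => // n u v uv tI uvd.
pose A i := `]u i, v i[%classic : set R.
have mA i : measurable (A i) by exact: measurable_itv.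
pose U := \big[setU/set0]_(i <- enum 'I_n) A i.
have mU : measurable U by exact: bigsetU_measurable.
have tIs : trivIset [set` enum 'I_n] A by apply: sub_trivIset tI.
have muA i : mu (A i) = (v i - u i)%:E.
  have [/andP[_ uvi] _] := uv i.
  rewrite [LHS](@lebesgue_measure_itv R `]u i, v i[)/= lte_fin.
  by case: ltgtP uvi => // ->; rewrite subrr.
have muU : (mu U < d%:E)%E.
  rewrite (_ : mu U = (\sum_(i <- enum 'I_n) mu (A i))%E); last first.
    rewrite /U !big_enum/=; apply: measure_semi_additive_ord => //.
    by move: mU; rewrite /U big_enum.
  under eq_bigr do rewrite muA.
  by rewrite sumEFin lte_fin big_enum.
apply: le_lt_trans (dP _ mU muU).
rewrite -lee_fin [leRHS]fineK; last first.
  exact: fin_numn mU.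
rewrite ge0_integral_bigsetU ?enum_uniq//; last by first [exact: mhn|move=> x _; rewrite lee_fin].
rewrite -sumEFin big_enum/=; apply: lee_sum => i _.
have [/andP[_ uvi] _] := uv i.
rewrite cabs_realB primitiveB//.
rewrite -Rintegral_itv_bndo_bndc; last exact: inthS.
apply: le_trans (_ : (\int[mu]_(t in A i) `|h t|)%:E <= _)%E.
  by rewrite lee_fin le_normr_Rintegral//; exact: inthS.
by rewrite [leLHS]fineK//; exact: fin_numn.
Qed.

(** The almost everywhere derivative is the Lebesgue differentiation theorem. *)
Lemma primitive_antideriv : antideriv_real primitive h.
Proof.
split; first exact: primitive_abs_continuous.
have := @FTC1Ny _ h (fun y => inthS (measurable_itv _)).
move=> /(_ (open_integrable_locally openT inth)); apply: aeS => x [dx ex].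
by apply: cder_real; rewrite -ex derive1E; exact: derivableP.
Qed.

(** Monotone convergence of the integral of [|h|] along the exhaustion [F]. *)
Lemma integral_small_outside (F : nat -> set R) : nondecreasing_seq F ->
  (forall n, measurable (F n)) -> \bigcup_n F n = setT ->
  forall e : R, 0 < e -> exists n, forall A, measurable A -> A `<=` ~` F n ->
    `|\int[mu]_(t in A) h t| < e.
Proof.
move=> nF mF FT e e0.
have : (\int[mu]_(x in F n) `|h x|%:E)%E @[n --> \oo] -->
    (\int[mu]_(x in \bigcup_n F n) `|h x|%:E)%E.
  apply: ge0_nondecreasing_set_cvg_integral => // n; exact: mhn.
rewrite FT -[X in _ --> X](fineK (fin_numn measurableT)) => /fine_cvgP[_].
move=> /cvgrPdist_lt/(_ e e0)[n _ /(_ n (leqnn n))/= hn].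
exists n => A mA An.
apply: le_lt_trans hn.
rewrite -fineB; [|exact: fin_numn..].
have eT : setT = F n `|` ~` F n by rewrite setUv.
rewrite [X in fine (X - _)](_ : _ = \int[mu]_(x in F n) `|h x|%:E
    + \int[mu]_(x in ~` F n) `|h x|%:E)%E; last first.
  rewrite {1}eT integral_setU//.
  - exact: mF.
  - exact: (measurableC (mF n)).
  - by rewrite -eT; exact: mhn measurableT.
  - by apply/disj_setPS; rewrite setICr.
rewrite addeAC subee ?add0e; last exact: fin_numn.
rewrite [leRHS]ger0_norm; last by rewrite fine_ge0// integral_ge0.
have le1 : `|\int[mu]_(t in A) h t| <= \int[mu]_(t in A) `|h t|.
  by apply: le_normr_Rintegral => //; exact: inthS.
apply: le_trans le1 _; rewrite fine_le//.
- exact: fin_numn.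
- exact: fin_numn (measurableC (mF n)).
- apply: ge0_subset_integral => //.
  + exact: (measurableC (mF n)).
  + exact: mhn (measurableC (mF n)).
Qed.

Lemma primitive_vanishes_pinfty :
  vanishes (fun x => \int[mu]_t h t - primitive x).
Proof.
move=> e e0; pose F (n : nat) := `]-oo, (n%:R : R)]%classic.
have [||| n nP] := @integral_small_outside F _ _ _ e e0.
- move=> m n mn; apply/subsetPset => x; rewrite /F /= !in_itv/= => /le_trans; apply.
  by rewrite ler_nat.
- by move=> n; exact: measurable_itv.
- apply/seteqP; split=> // x _.
  exists (Num.truncn `|x|).+1 => //; rewrite /F /= in_itv/=.
  by rewrite (le_trans (ler_norm _))// ltW// truncnS_gt.
exists n%:R => x nx; rewrite /primitive -set_itvNyy.
rewrite Rintegral_itvB//; last exact: inthS.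
apply: nP => // y; rewrite /F /= !in_itv/= andbT => xy; apply/negP.
by rewrite -ltNge (le_lt_trans nx).
Qed.

Lemma primitive_vanishes_ninfty : vanishes (fun x => primitive (- x)).
Proof.
move=> e e0; pose F (n : nat) := `](- n%:R : R), +oo[%classic.
have [||| n nP] := @integral_small_outside F _ _ _ e e0.
- move=> m n mn; apply/subsetPset => x; rewrite /F /= !in_itv/= !andbT.
  by apply: le_lt_trans; rewrite lerN2 ler_nat.
- by move=> n; exact: measurable_itv.
- apply/seteqP; split=> // x _.
  exists (Num.truncn `|x|).+1 => //; rewrite /F /= in_itv/= andbT ltrNl.
  by rewrite (le_lt_trans (ler_norm _))// normrN truncnS_gt.
exists n%:R => x nx; rewrite /primitive.
apply: nP => // y; rewrite /F /= !in_itv/= andbT => xy; apply/negP.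
by rewrite -leNgt (le_trans xy)// lerN2.
Qed.

End IntegralPrimitive.

(** * Amplitudes of a solution on the half-line *)

Section Tails.
Variable R : realType.

Lemma tail_nonincreasing (Q h : R -> R) x y : antideriv_real Q (fun x => - h x) ->
  (forall x, 0 <= h x) -> x <= y -> Q y <= Q x.
Proof.
move=> aQ h0 xy; rewrite -lerN2.
have := antideriv_nondecreasing xy (antideriv_realZ (-1) aQ).
by rewrite !mulN1r; apply; apply: aeT => t _; rewrite mulN1r opprK.
Qed.

Lemma tail_ge0 (Q h : R -> R) x : antideriv_real Q (fun x => - h x) ->
  (forall x, 0 <= h x) -> vanishes Q -> 0 <= Q x.
Proof.
move=> aQ h0 vQ; rewrite -oppr_le0.
apply: (le_of_vanishes (f := fun x => -1 * Q x) (X := x)).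
  exact: vanishesZ.
by move=> y xy; rewrite add0r mulN1r lerN2; exact: tail_nonincreasing aQ h0 xy.
Qed.

(** [Q] stands for the tail integral of [h], so that its increments with the
opposite sign are the integrals of [h]. *)
Lemma tail_comparison (Q h : R -> R) (F f : R -> R[i]) (M x y : R) :
  antideriv_real Q (fun x => - h x) -> antideriv F f -> x <= y ->
  (forall t, x <= t <= y -> cabs (f t) <= M * h t) ->
  cabs (F y - F x) <= M * (Q x - Q y).
Proof.
move=> aQ aF xy fM.
have -> : M * (Q x - Q y) = (- M * Q y) - (- M * Q x) by ring.
apply: antideriv_comparison xy aF (antideriv_realZ (- M) aQ) _.
by apply: aeT => t /fM; rewrite mulrNN.
Qed.

Lemma tail_dominated (p S : R -> R[i]) (Q : R -> R) x :
  antideriv S (fun x => - p x) -> vanishes (fun x => cabs (S x)) ->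
  antideriv_real Q (fun x => - cabs (p x)) -> vanishes Q ->
  cabs (S x) <= Q x.
Proof.
move=> aS vS aQ vQ; apply: (le_of_vanishes vS (X := x)) => z xz.
have -> : S x = S z - (S z - S x) by ring.
apply: le_trans (cabsB _ _) _; rewrite addrC lerD2r.
have h t : x <= t <= z -> cabs (- p t) <= 1 * cabs (p t).
  by move=> _; rewrite cabsN mul1r.
apply: le_trans (tail_comparison aQ aS xz h) _; rewrite mul1r gerBl.
by apply: tail_ge0 aQ _ vQ => t; exact: cabs_ge0.
Qed.

Lemma antideriv_cabs_sqr (F f : R -> R[i]) : antideriv F f ->
  antideriv_real (fun x => cabs (F x) ^+ 2) (fun x => 2 * Re (conjc (F x) * f x)).
Proof.
move=> aF; have := antideriv_Re (antiderivM (antideriv_conj aF) aF).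
rewrite /antideriv_real; congr antideriv; apply/funext => x; congr (_%:C).
  by rewrite cReM cRe_conj cIm_conj cabs_sqr; ring.
by rewrite !ReImE cRe_conj !cIm_conj cRe_conj; ring.
Qed.

(** The derivative of [|A|^2 + |B|^2] when [A' = C] and [B' = C - 2 c B]: the free
part contributes a term of the sign of [- Re c], which is nonnegative for wave
numbers in the closed upper half-plane. *)
Lemma energy_derivative (A B C c : R[i]) :
  2 * Re (conjc A * C) + 2 * Re (conjc B * (C - 2 * c * B)) =
  2 * Re (conjc (A + B) * C) - 4 * Re c * cabs B ^+ 2.
Proof.
have -> : 2 * c * B = 2%:C * (c * B) by rewrite rmorph_nat mulrA.
by rewrite cabs_sqr !(ReImE, cRe_conj, cIm_conj)/=; ring.
Qed.

End Tails.

(** What the half-line analysis yields at the origin for a solution with value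
[F] there and with incident and reflected amplitudes [A] and [N]; the numbers
[Q], [T] and [S] stand for the integrals of [|q|], [x |q|] and [q], and [M]
bounds [f e^(-cx)].  The last clause concerns real wave numbers. *)
Definition amplitude_bounds (R : realType) (c A N F : R[i]) (Q T : R) (S : R[i]) :=
  let M := 3 / 2 * expR (Q / (2 * cabs c)) in
  [/\ cabs A ^+ 2 + cabs N ^+ 2 <= 4 * cabs c ^+ 2 * expR (Q / cabs c),
      cabs N <= M * Q,
      cabs (A - 2 * c) <= M * Q,
      cabs (A - 2 * c + S) <= M * Q ^+ 2 / cabs c &
      Re c = 0 -> cabs F <= expR T /\ cabs N <= expR T * Q].

Section HalfLine.
Variable R : realType.
Variables (q : R -> R[i]) (c : R[i]) (f f1 : R -> R[i]).
Hypotheses (c0 : c != 0) (cRe : Re c <= 0).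
Hypothesis af : antideriv f f1.
Hypothesis af1 : antideriv f1 (fun x => q x * f x + c ^+ 2 * f x).
Hypothesis flim : vanishes (fun x => cabs (f x * cexp (x%:C * - c) - 1)).
Variables (Q T : R -> R) (S : R -> R[i]).
Hypotheses (aQ : antideriv_real Q (fun x => - cabs (q x))) (vQ : vanishes Q).
Hypotheses (aT : antideriv_real T (fun x => - (`|x| * cabs (q x)))) (vT : vanishes T).
Hypotheses (aS : antideriv S (fun x => - q x)) (vS : vanishes (fun x => cabs (S x))).

(** With [c = ik], [a] and [n] are the incident and reflected amplitudes, both
relative to [e^(cx)]; [b] is the reflected amplitude relative to its own
exponential [e^(-cx)], so that its derivative only involves [q]. *)
Let m x := f x * cexp (x%:C * - c).
Let n x := (f1 x - c * f x) * cexp (x%:C * - c).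
Let a x := (f1 x + c * f x) * cexp (x%:C * - c).
Let b x := (f1 x - c * f x) * cexp (x%:C * c).
Let K := cabs c.

Let K0 : 0 < K. Proof. by rewrite lt_neqAle cabs_ge0 andbT eq_sym cabs_eq0. Qed.

Let amn x : a x - n x = 2 * c * m x.
Proof. by rewrite /a /n /m; ring. Qed.

Let am : antideriv m n.
Proof.
have := antiderivM af (antideriv_cexp (- c)); apply: eq_antideriv.
by apply/funext => x; rewrite /n; ring.
Qed.

Let aa : antideriv a (fun x => q x * m x).
Proof.
have := antiderivM (antiderivD af1 (antiderivZ c af)) (antideriv_cexp (- c)).
by apply: eq_antideriv; apply/funext => x; rewrite /m; ring.
Qed.

Let an : antideriv n (fun x => q x * m x - 2 * c * n x).
Proof.
have := antiderivM (antiderivB af1 (antiderivZ c af)) (antideriv_cexp (- c)).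
by apply: eq_antideriv; apply/funext => x; rewrite /m /n; ring.
Qed.

Let ab : antideriv b (fun x => q x * f x * cexp (x%:C * c)).
Proof.
have := antiderivM (antiderivB af1 (antiderivZ c af)) (antideriv_cexp c).
by apply: eq_antideriv; apply/funext => x; ring.
Qed.

Let Qge0 x : 0 <= Q x.
Proof. by apply: tail_ge0 aQ _ vQ => t; exact: cabs_ge0. Qed.

Let Qle x y : x <= y -> Q y <= Q x.
Proof. by apply: tail_nonincreasing aQ _ => t; exact: cabs_ge0. Qed.

Let Tge0 x : 0 <= T x.
Proof. by apply: tail_ge0 aT _ vT => t; rewrite mulr_ge0// cabs_ge0. Qed.

Let Tle x y : x <= y -> T y <= T x.
Proof. by apply: tail_nonincreasing aT _ => t; rewrite mulr_ge0// cabs_ge0. Qed.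

Let cabs2c : cabs (2 * c) = 2 * K.
Proof. by rewrite cabsM -[2%:R](rmorph_nat (real_complex R)) cabs_real normr_nat. Qed.

(** [a] has bounded variation near infinity and [m = (a - n) / 2c] converges
with derivative [n]; hence [n] is nearly constant there, and a nonzero constant
would make [m] drift. *)
Let vn : vanishes (fun x => cabs (n x)).
Proof.
move=> e e0; pose d := Num.min 1 (e / (2 * (4 + 4 * K))).
have KK : 0 < 4 + 4 * K by rewrite addr_gt0// mulr_gt0.
have d0 : 0 < d by rewrite lt_min ltr01 divr_gt0// mulr_gt0.
have de : d * (4 + 4 * K) < e.
  have : d <= e / (2 * (4 + 4 * K)) by rewrite ge_min lexx orbT.
  rewrite -(ler_pM2r KK) => /le_lt_trans; apply.
  have -> : e / (2 * (4 + 4 * K)) * (4 + 4 * K) = e / 2 by field; rewrite gt_eqF.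
  by rewrite ltr_pdivrMr// mulr_natr mulr2n ltrDl.
have [X XP] := flim d0; have [Y YP] := vQ d0.
exists (Num.max X Y) => x; rewrite ge_max => /andP[Xx Yx].
have hm t : x <= t -> cabs (m t - 1) <= d.
  move=> xt; apply/ltW; apply: le_lt_trans (XP t (le_trans Xx xt)).
  by rewrite ger0_norm ?cabs_ge0.
have hm2 t : x <= t -> cabs (m t) <= 2.
  move=> xt; rewrite -[m t](subrK 1) (le_trans (cabsD _ _))// cabs1.
  have := hm _ xt; have : d <= 1 by rewrite ge_min lexx.
  by set A := cabs _; lra.
have ha t : x <= t -> cabs (a t - a x) <= 2 * d.
  move=> xt; have := @tail_comparison _ _ _ _ _ 2 x t aQ aa xt.
  have h1 s : x <= s <= t -> cabs (q s * m s) <= 2 * cabs (q s).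
    by move=> /andP[xs _]; rewrite cabsM mulrC ler_wpM2r ?cabs_ge0// hm2.
  move=> /(_ h1) /le_trans; apply; rewrite ler_wpM2l//.
  have := YP x Yx; rewrite ger0_norm// => /ltW; apply: le_trans.
  by rewrite gerBl.
have hmm t : x <= t -> cabs (m t - m x) <= 2 * d.
  move=> xt; apply: le_trans (cabs_triangle _ 1 _) _.
  by rewrite (cabsC 1) mulr2n mulrDl mul1r lerD// hm.
have hn t : x <= t -> cabs (n t - n x) <= 2 * d + 2 * K * (2 * d).
  move=> xt; have -> : n t - n x = (a t - a x) - 2 * c * (m t - m x).
    by rewrite mulrBr -!amn; ring.
  apply: le_trans (cabsB _ _) _; rewrite lerD ?ha//.
  by rewrite (cabsM (2 * c)) cabs2c ler_wpM2l ?hmm// mulr_ge0// ltW.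
pose e' := 2 * d + 2 * K * (2 * d).
have x1 : x <= x + 1 by rewrite lerDl.
have := antideriv_comparison x1
  (antiderivB am (antiderivZ (n x) (antideriv_id R))) (antideriv_realZ e' (antideriv_id R)).
have h2 : {ae lebesgue_measure, forall t, x <= t <= x + 1 ->
    cabs (n t - n x * 1%:C) <= e' * 1}.
  by apply: aeT => t /andP[xt _]; rewrite !mulr1 hn.
move=> /(_ h2).
have -> : e' * (x + 1) - e' * x = e' by ring.
have -> : m (x + 1) - n x * (x + 1)%:C - (m x - n x * x%:C) = (m (x + 1) - m x) - n x.
  by rewrite rmorphD/=; ring.
move=> h3; rewrite ger0_norm ?cabs_ge0//; apply: le_lt_trans de.
have -> : n x = (m (x + 1) - m x) - ((m (x + 1) - m x) - n x) by ring.
apply: le_trans (cabsB _ _) _.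
apply: le_trans (lerD (hmm _ x1) h3) _.
by rewrite /e'; have := d0; nra.
Qed.

Let va : vanishes (fun x => cabs (a x - 2 * c)).
Proof.
apply: (vanishes_le (X := 0) _ (vanishesD vn (vanishesZ (2 * K) flim))) => x _.
rewrite ger0_norm ?cabs_ge0//.
have -> : a x - 2 * c = n x + 2 * c * (m x - 1) by rewrite mulrBr -amn; ring.
by apply: le_trans (cabsD _ _) _; rewrite (cabsM (2 * c)) cabs2c.
Qed.

Let E x := cabs (a x) ^+ 2 + cabs (n x) ^+ 2.
Let dE x := 2 * Re (conjc (a x) * (q x * m x)) +
  2 * Re (conjc (n x) * (q x * m x - 2 * c * n x)).

Let aE : antideriv_real E dE.
Proof. exact: antideriv_realD (antideriv_cabs_sqr aa) (antideriv_cabs_sqr an). Qed.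

(** Since [m = (a - n) / 2c], the perturbation is at most
[|q| / |c| * |a + n| |a - n|], and [2 |a + n| |a - n| <= 2 (|a|^2 + |n|^2)] by the
parallelogram identity. *)
Let dE_ge x : - (cabs (q x) / K * E x) <= dE x.
Proof.
have -> : dE x = 2 * Re (conjc (a x + n x) * (q x * m x)) - 4 * Re c * cabs (n x) ^+ 2.
  exact: energy_derivative.
have h1 : 2 * cabs (conjc (a x + n x) * (q x * m x)) <= cabs (q x) / K * E x.
  rewrite (cabsM (conjc (a x + n x))) (cabsM (q x)) cabs_conj.
  have -> : cabs (m x) = cabs (a x - n x) / (2 * K).
    by rewrite amn (cabsM (2 * c)) cabs2c; field; rewrite gt_eqF.
  have par : cabs (a x + n x) ^+ 2 + cabs (a x - n x) ^+ 2 = 2 * E x.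
    exact: cabs_parallelogram.
  have -> : 2 * (cabs (a x + n x) * (cabs (q x) * (cabs (a x - n x) / (2 * K)))) =
      cabs (q x) / K * (cabs (a x + n x) * cabs (a x - n x)).
    by field; rewrite gt_eqF.
  rewrite ler_wpM2l ?divr_ge0 ?cabs_ge0 ?(ltW K0)//.
  have := sqr_ge0 (cabs (a x + n x) - cabs (a x - n x)).
  by rewrite sqrrB; move: par; set A := cabs _; set B := cabs _; lra.
have h2 : 0 <= - (4 * Re c * cabs (n x) ^+ 2).
  by rewrite -mulNr mulr_ge0 ?sqr_ge0// -mulrN mulr_ge0// oppr_ge0.
have h3 : - cabs (conjc (a x + n x) * (q x * m x)) <= Re (conjc (a x + n x) * (q x * m x)).
  by have := normr_Re_le (conjc (a x + n x) * (q x * m x)); rewrite ler_norml => /andP[].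
move: h1 h2 h3; set A := cabs (_ * _); set B := Re (_ * _); set C := _ / K * _; lra.
Qed.

(** [E] times [exp (- Q / K)] is nondecreasing and tends to [4 K^2]. *)
Lemma jost_energy x : cabs (a x) ^+ 2 + cabs (n x) ^+ 2 <= 4 * K ^+ 2 * expR (Q x / K).
Proof.
pose g x := K^-1 * (-1 * Q x).
have ag : antideriv_real g (fun x => K^-1 * (-1 * - cabs (q x))).
  exact/antideriv_realZ/antideriv_realZ.
have g0 t : g t <= 0.
  by rewrite /g mulN1r mulrN oppr_le0 mulr_ge0// invr_ge0 ltW.
have aW := antideriv_realM aE (antideriv_expR ag g0).
have W x0 z : x0 <= z -> E x0 * expR (g x0) <= E z * expR (g z).
  move=> xz; apply: antideriv_nondecreasing xz aW _; apply: aeT => t _.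
  rewrite mulN1r opprK.
  have -> : dE t * expR (g t) + E t * (expR (g t) * (K^-1 * cabs (q t))) =
    expR (g t) * (dE t + cabs (q t) / K * E t) by ring.
  by rewrite mulr_ge0 ?expR_ge0// -lerBlDr sub0r.
have Ele z : E z <= 4 * K ^+ 2 + (4 * K * cabs (a z - 2 * c) + (cabs (a z - 2 * c) ^+ 2 + cabs (n z) ^+ 2)).
  rewrite /E !addrA lerD2r.
  have -> : 4 * K ^+ 2 + 4 * K * cabs (a z - 2 * c) + cabs (a z - 2 * c) ^+ 2 =
    (cabs (a z - 2 * c) + 2 * K) ^+ 2 by ring.
  rewrite ler_pXn2r// ?nnegrE ?addr_ge0 ?cabs_ge0 ?mulr_ge0 ?(ltW K0)//.
  by rewrite -{1}[a z](subrK (2 * c)) -cabs2c cabsD.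
have h : E x * expR (g x) <= 4 * K ^+ 2.
  apply: (le_of_vanishes (X := x)
    (vanishesD (vanishesZ (4 * K) va) (vanishesD (vanishes_sqr va) (vanishes_sqr vn)))) => z xz.
  apply: le_trans (W _ _ xz) _; apply: le_trans (Ele z).
  by rewrite -[leRHS]mulr1 ler_wpM2l ?addr_ge0 ?sqr_ge0// -expR0 ler_expR.
have -> : Q x / K = - g x by rewrite /g mulN1r mulrN opprK mulrC.
by rewrite expRN -[leRHS]/(_ / _) ler_pdivlMr// expR_gt0.
Qed.

Let cabs_n t : cabs (n t) = cabs (f1 t - c * f t) * expR (- (t * Re c)).
Proof. by rewrite /n cabsM cabs_cexp ReZ cReN mulrN. Qed.

Let cabs_b t : cabs (b t) = cabs (n t) * expR (2 * (t * Re c)).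
Proof.
rewrite /b cabsM cabs_cexp ReZ cabs_n -mulrA -expRD.
by congr (_ * expR _); ring.
Qed.

Let cabs_m t : cabs (m t) = cabs (f t) * expR (- (t * Re c)).
Proof. by rewrite /m cabsM cabs_cexp ReZ cReN mulrN. Qed.

Let cabs_db t : cabs (q t * f t * cexp (t%:C * c)) =
  cabs (m t) * expR (2 * (t * Re c)) * cabs (q t).
Proof.
rewrite (cabsM (q t * f t)) (cabsM (q t)) cabs_cexp ReZ cabs_m.
have -> : expR (t * Re c) = expR (- (t * Re c)) * expR (2 * (t * Re c)).
  by rewrite -expRD; congr expR; ring.
by ring.
Qed.

Let expRe_le1 t : 0 <= t -> expR (2 * (t * Re c)) <= 1.
Proof. by move=> t0; rewrite -expR0 ler_expR pmulr_rle0// mulr_ge0_le0. Qed.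

Let vb : vanishes (fun x => cabs (b x)).
Proof.
apply: (vanishes_le (X := 0) _ vn) => x x0; rewrite ger0_norm ?cabs_ge0// cabs_b.
by rewrite -[leRHS]mulr1 ler_wpM2l ?cabs_ge0// expRe_le1.
Qed.

(** The derivative of [b] is bounded by [M |q|] times a weight that does not
increase with [x]; the weight at [x] can be factored out of the integral from [x]
to infinity, where [b] vanishes, and it cancels in the return from [b] to [n]. *)
Let n_le (M x : R) : 0 <= x -> (forall t, x <= t -> cabs (m t) <= M) ->
  cabs (n x) <= M * Q x.
Proof.
move=> x0 mM; pose g := expR (2 * (x * Re c)).
have g0 : 0 < g by exact: expR_gt0.
have M0 : 0 <= M by apply: le_trans (cabs_ge0 _) (mM x (lexx x)).
have h : cabs (b x) <= M * g * Q x.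
  apply: (le_of_vanishes vb (X := x)) => z xz.
  have -> : b x = b z - (b z - b x) by ring.
  apply: le_trans (cabsB _ _) _; rewrite addrC lerD2r.
  apply: (@le_trans _ _ (M * g * (Q x - Q z))).
    apply: (tail_comparison aQ ab xz) => t /andP[xt _].
    rewrite cabs_db ler_wpM2r ?cabs_ge0// ler_pM ?cabs_ge0 ?expR_ge0 ?mM//.
    by rewrite ler_expR ler_pM2l// ler_wnM2r.
  by rewrite ler_wpM2l ?gerBl// mulr_ge0// ltW.
by move: h; rewrite cabs_b -/g mulrAC ler_pM2r.
Qed.

Let a_le (M x : R) : (forall t, x <= t -> cabs (m t) <= M) ->
  cabs (a x - 2 * c) <= M * Q x.
Proof.
move=> mM; have M0 : 0 <= M by apply: le_trans (cabs_ge0 _) (mM x (lexx x)).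
apply: (le_of_vanishes va (X := x)) => z xz.
have -> : a x - 2 * c = (a z - 2 * c) - (a z - a x) by ring.
apply: le_trans (cabsB _ _) _; rewrite addrC lerD2r.
apply: (@le_trans _ _ (M * (Q x - Q z))).
  apply: (tail_comparison aQ aa xz) => t /andP[xt _].
  by rewrite (cabsM (q t)) mulrC ler_wpM2r ?cabs_ge0 ?mM.
by rewrite ler_wpM2l ?gerBl.
Qed.

(** The energy bounds [|m| = |a - n| / 2K] by [sqrt 2 * exp (Q / 2K)], and [3 / 2] is
a rational bound for [sqrt 2]. *)
Let M := 3 / 2 * expR (Q 0 / (2 * K)).

Let mM t : 0 <= t -> cabs (m t) <= M.
Proof.
move=> t0; have M0 : 0 <= M by rewrite mulr_ge0 ?expR_ge0.
rewrite -(@ler_pXn2r _ 2)// ?nnegrE ?cabs_ge0//.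
have par : cabs (a t - n t) ^+ 2 <= 2 * (cabs (a t) ^+ 2 + cabs (n t) ^+ 2).
  by rewrite -cabs_parallelogram lerDr sqr_ge0.
have := le_trans par (ler_wpM2l (ler0n _ 2) (jost_energy t)).
rewrite amn (cabsM (2 * c)) cabs2c exprMn.
have eQ : expR (Q t / K) <= expR (Q 0 / K).
  by rewrite ler_expR ler_pM2r ?invr_gt0// Qle.
have -> : M ^+ 2 = 9 / 4 * expR (Q 0 / K).
  rewrite /M exprMn -expRM_natl; congr (_ * expR _); first by field.
  by field; rewrite gt_eqF.
have K2 : 0 < K ^+ 2 by rewrite exprn_gt0.
have := expR_gt0 (Q 0 / K).
move: eQ; set x := expR _; set y := expR _; set z := cabs _ ^+ 2 => xy y0 h.
have h2 : K ^+ 2 * z <= K ^+ 2 * (2 * y) by nra.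
by move: h2; rewrite ler_pM2l//; lra.
Qed.

Let n0E : n 0 = f1 0 - c * f 0.
Proof. by rewrite /n mul0r /cexp /= expR0 cos0 sin0 mul1r complexr0 mulr1. Qed.

Let a0E : a 0 = f1 0 + c * f 0.
Proof. by rewrite /a mul0r /cexp /= expR0 cos0 sin0 mul1r complexr0 mulr1. Qed.

Let m0E : m 0 = f 0.
Proof. by rewrite /m mul0r /cexp /= expR0 cos0 sin0 mul1r complexr0 mulr1. Qed.

Lemma jost_energy0 : cabs (f1 0 + c * f 0) ^+ 2 + cabs (f1 0 - c * f 0) ^+ 2
  <= 4 * cabs c ^+ 2 * expR (Q 0 / cabs c).
Proof. by rewrite -a0E -n0E jost_energy. Qed.

Lemma jost_reflected0 : cabs (f1 0 - c * f 0) <= M * Q 0.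
Proof. by rewrite -n0E; apply: n_le => // t; exact: mM. Qed.

Lemma jost_incident0 : cabs (f1 0 + c * f 0 - 2 * c) <= M * Q 0.
Proof. by rewrite -a0E; apply: a_le => t; exact: mM. Qed.

(** One Picard iteration: [m - 1] is of order [Q / K], so that [q m], the derivative
of [a], is [q] up to [|q| Q / K]. *)
Lemma jost_first_order0 :
  cabs (f1 0 + c * f 0 - 2 * c + S 0) <= M * Q 0 ^+ 2 / cabs c.
Proof.
have M0 : 0 <= M by rewrite mulr_ge0 ?expR_ge0.
have m1 t : 0 <= t -> cabs (m t - 1) <= M * Q 0 / K.
  move=> t0; have tM s : t <= s -> cabs (m s) <= M by move=> ts; exact/mM/(le_trans t0).
  have h : 2 * K * cabs (m t - 1) <= 2 * (M * Q 0).
    rewrite -cabs2c -cabsM mulrBr -amn mulr1.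
    have -> : a t - n t - 2 * c = (a t - 2 * c) - n t by ring.
    apply: le_trans (cabsB _ _) _; rewrite [leRHS]mulr_natl [leRHS]mulr2n.
    apply: lerD; first by apply: le_trans (a_le tM) _; rewrite ler_wpM2l// Qle.
    by apply: le_trans (n_le t0 tM) _; rewrite ler_wpM2l// Qle.
  by rewrite ler_pdivlMr// mulrC -(@ler_pM2l _ 2)// mulrA.
rewrite -a0E -/K.
have vD : vanishes (fun z => cabs (a z - 2 * c) + cabs (S z)) by exact: vanishesD.
apply: (le_of_vanishes vD (X := 0)) => z z0.
have -> : a 0 - 2 * c + S 0 = (a z - 2 * c + S z) - ((a z + S z) - (a 0 + S 0)) by ring.
apply: le_trans (cabsB _ _) _; rewrite addrC lerD ?cabsD//.
apply: (@le_trans _ _ (M * Q 0 / K * (Q 0 - Q z))).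
  apply: (tail_comparison aQ (antiderivD aa aS) z0) => t /andP[t0 _].
  have -> : q t * m t + - q t = (m t - 1) * q t by ring.
  by rewrite (cabsM (m t - 1)) ler_wpM2r ?cabs_ge0 ?m1.
rewrite expr2 mulrA [leRHS]mulrAC ler_wpM2l ?gerBl//.
by rewrite divr_ge0 ?mulr_ge0 ?(ltW K0).
Qed.

Section RealWavenumber.
Hypothesis c_imag : Re c = 0.

Let xQ_le x : 0 <= x -> x * Q x <= T x.
Proof.
move=> x0; rewrite -subr_le0.
apply: (le_of_vanishes (vanishesZ x vQ) (X := x)) => z xz; rewrite add0r.
have aG := antideriv_realD (antideriv_realZ x aQ) (antideriv_realZ (-1) aT).
have := antideriv_nondecreasing xz aG _.
rewrite !mulN1r => h; apply: le_trans (h _) _; last by rewrite gerBl.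
apply: aeT => t /andP[xt _].
have -> : x * - cabs (q t) + -1 * - (`|t| * cabs (q t)) = (`|t| - x) * cabs (q t) by ring.
by rewrite mulr_ge0 ?cabs_ge0// subr_ge0 (le_trans xt)// ler_norm.
Qed.

Let cabs_bn t : cabs (b t) = cabs (n t).
Proof. by rewrite cabs_b c_imag mulr0 mulr0 expR0 mulr1. Qed.

(** A smooth substitute for [|z|]; the parameter [d] eventually tends to 0. *)
Let rho d (z : R[i]) : R := Num.sqrt (cabs z ^+ 2 + d ^+ 2).

Let rho_ge d z : cabs z <= rho d z.
Proof.
by rewrite -[leLHS]ger0_norm ?cabs_ge0// -sqrtr_sqr ler_wsqrtr// lerDl sqr_ge0.
Qed.

Let rho_le d z : 0 <= d -> rho d z <= cabs z + d.
Proof.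
move=> d0; have h : 0 <= cabs z + d by rewrite addr_ge0// cabs_ge0.
rewrite -[leRHS]ger0_norm// -sqrtr_sqr ler_wsqrtr// sqrrD lerD2r lerDl.
by rewrite mulrn_wge0// mulr_ge0// cabs_ge0.
Qed.

Let drho_le d (z w : R[i]) : 0 < d -> `|Re (conjc z * w) / rho d z| <= cabs w.
Proof.
move=> d0; have r0 : 0 < rho d z.
  by rewrite sqrtr_gt0 ltr_wpDl ?sqr_ge0// exprn_gt0.
rewrite normrM [`|_^-1|]gtr0_norm ?invr_gt0// ler_pdivrMr//.
apply: le_trans (normr_Re_le _) _.
by rewrite cabsM cabs_conj mulrC ler_wpM2l ?cabs_ge0.
Qed.

(** At small real wave numbers the energy is useless.  Instead, going down from
infinity, [|m| + x |n|] grows at most at the rate [x |q|]: the growth of [|m|] is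
compensated by the decrease of the weight [x].  At infinity [x |n|] vanishes because
[|n| <= M Q] and [x Q <= T]. *)
Let low_energy x : 0 <= x -> cabs (m x) <= expR (T x).
Proof.
move=> x0; pose g t := -1 * T t.
have ag : antideriv_real g (fun t => -1 * - (`|t| * cabs (q t))) by exact: antideriv_realZ.
have g0 t : g t <= 0 by rewrite /g mulN1r oppr_le0.
have W d z : 0 < d -> x <= z ->
    cabs (m x) * expR (g x) <= cabs (m z) + d + z * (cabs (n z) + d).
  move=> d0 xz; have d20 : 0 < d ^+ 2 by rewrite exprn_gt0.
  have aL := antideriv_realM
    (antideriv_realD (antideriv_sqrt d20 am)
      (antideriv_realM (antideriv_id R) (antideriv_sqrt d20 ab)))
    (antideriv_expR ag g0).
  have := antideriv_nondecreasing xz aL _.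
  rewrite -!/(rho _ _) => h.
  have {}h : (rho d (m x) + x * rho d (b x)) * expR (g x) <=
      (rho d (m z) + z * rho d (b z)) * expR (g z).
    apply: h; apply: aeT => t /andP[xt tz].
    have t0 : 0 <= t by exact: le_trans xt.
    rewrite -!/(rho _ _) mulN1r opprK (ger0_norm t0).
    set A := Re _ / _; set B := Re _ / _.
    have hA : - cabs (n t) <= A.
      by have := drho_le (m t) (n t) d0; rewrite ler_norml => /andP[].
    have hB : - (cabs (m t) * cabs (q t)) <= B.
      have := drho_le (b t) (q t * f t * cexp (t%:C * c)) d0.
      by rewrite cabs_db c_imag !mulr0 expR0 mulr1 ler_norml => /andP[].
    have hm := rho_ge d (m t); have hb := rho_ge d (b t).
    rewrite cabs_bn in hb.
    have q0 := cabs_ge0 (q t); have n0 := cabs_ge0 (n t); have m0 := cabs_ge0 (m t).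
    have e0 := expR_ge0 (g t).
    rewrite [X in 0 <= X](_ : _ = expR (g t) *
      ((A + rho d (b t)) + t * (B + cabs (q t) * (rho d (m t) + t * rho d (b t))))); last by ring.
    apply: mulr_ge0 => //; apply: addr_ge0; first by move: hA hb; lra.
    apply: mulr_ge0 => //.
    have : 0 <= t * rho d (b t) by rewrite mulr_ge0// (le_trans n0).
    set P := rho d (m t) in hm *; set P' := t * _ => P0.
    have : cabs (q t) * cabs (m t) <= cabs (q t) * (P + P').
      by rewrite ler_wpM2l//; lra.
    by move: hB; rewrite [cabs (m t) * _]mulrC; lra.
  apply: (@le_trans _ _ ((rho d (m x) + x * rho d (b x)) * expR (g x))).
    rewrite ler_wpM2r ?expR_ge0//.
    apply: le_trans (rho_ge d _) _; rewrite lerDl mulr_ge0//.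
    by apply: le_trans (cabs_ge0 _) (rho_ge d _).
  apply: le_trans h _.
  have z0 : 0 <= z by exact: le_trans xz.
  have r1 := rho_le (m z) (ltW d0); have r2 := rho_le (b z) (ltW d0).
  rewrite cabs_bn in r2.
  have h0 : 0 <= rho d (m z) + z * rho d (b z).
    by rewrite addr_ge0 ?mulr_ge0// (le_trans (cabs_ge0 _) (rho_ge d _)).
  apply: (@le_trans _ _ (rho d (m z) + z * rho d (b z))).
    by rewrite -[leRHS]mulr1 ler_wpM2l// -expR0 ler_expR.
  by rewrite lerD// ler_wpM2l.
have h : cabs (m x) * expR (g x) <= 1.
  apply: (le_of_vanishes (vanishesD flim (vanishesZ M vT)) (X := x)) => z xz.
  have z0 : 0 <= z by exact: le_trans xz.
  apply: (@le_trans _ _ (cabs (m z) + z * cabs (n z))).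
    apply/ler_addgt0Pr => e e0.
    have z1 : 0 < 1 + z by rewrite ltr_wpDr.
    have := W (e / (1 + z)) z (divr_gt0 e0 z1) xz; move=> /le_trans; apply.
    rewrite le_eqVlt; apply/orP; left; apply/eqP.
    by field; rewrite gt_eqF.
  rewrite addrA lerD//.
    by have := cabsD (m z - 1) 1; rewrite subrK cabs1 addrC.
  have nz : cabs (n z) <= M * Q z.
    by apply: n_le => // t zt; exact/mM/(le_trans z0).
  apply: le_trans (ler_wpM2l z0 nz) _; rewrite mulrCA ler_wpM2l ?xQ_le//.
  by rewrite mulr_ge0 ?expR_ge0.
have -> : T x = - g x by rewrite /g mulN1r opprK.
by rewrite expRN -[leRHS]mul1r -[leRHS]/(_ / _) ler_pdivlMr// expR_gt0.
Qed.

Lemma jost_low_energy0 : cabs (f 0) <= expR (T 0).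
Proof. by rewrite -m0E low_energy. Qed.

Lemma jost_low_energy_deriv0 : cabs (f1 0 - c * f 0) <= expR (T 0) * Q 0.
Proof.
rewrite -n0E; apply: n_le => // t t0; apply: le_trans (low_energy t0) _.
by rewrite ler_expR Tle.
Qed.

End RealWavenumber.

Lemma jost_amplitudes0 :
  amplitude_bounds c (f1 0 + c * f 0) (f1 0 - c * f 0) (f 0) (Q 0) (T 0) (S 0).
Proof.
split; [exact: jost_energy0|exact: jost_reflected0|exact: jost_incident0| |].
  exact: jost_first_order0.
by move=> ci; split; [exact: jost_low_energy0|exact: jost_low_energy_deriv0].
Qed.

End HalfLine.

(** * Jost solutions as half-line solutions *)

Section Potential.
Variable R : realType.
Local Notation mu := (@lebesgue_measure R).
Variable q : R -> R[i].
Hypothesis hq : admissible_potential q.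

Let aq x : R := cabs (q x).

Let maq : measurable_fun setT aq.
Proof.
have [mr mi _] := hq.
have -> : aq = Num.sqrt \o (fun x => Re (q x) ^+ 2 + Im (q x) ^+ 2).
  by apply/funext => x; rewrite /aq cabsE.
apply: measurableT_comp.
  by apply: continuous_measurable_fun; exact: sqrt_continuous.
by apply: measurable_funD; apply: measurable_funX.
Qed.

Let mabs : measurable_fun setT (fun x : R => `|x|).
Proof. exact: normr_measurable. Qed.

Let i1 : mu.-integrable setT (EFin \o (fun x => (1 + `|x|) * aq x)).
Proof.
have [_ _ h] := hq; apply/integrableP; split.
  apply/measurable_EFinP; apply: measurable_funM => //.
  exact: measurable_funD.
apply: le_lt_trans h; rewrite le_eqVlt; apply/orP; left; apply/eqP.
apply: eq_integral => x _ /=.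
by rewrite ger0_norm// mulr_ge0 ?cabs_ge0// addr_ge0.
Qed.

Let integrable_dominated (h : R -> R) : measurable_fun setT h ->
  (forall x, `|h x| <= (1 + `|x|) * aq x) -> mu.-integrable setT (EFin \o h).
Proof.
move=> mh hle; apply: le_integrable i1 => //; first exact/measurable_EFinP.
move=> x _; rewrite /= lee_fin; apply: le_trans (hle x) _; exact: ler_norm.
Qed.

Let aq_le x : aq x <= (1 + `|x|) * aq x.
Proof. by rewrite mulrDl mul1r lerDl mulr_ge0// cabs_ge0. Qed.

Lemma integrable_potential : mu.-integrable setT (EFin \o (fun x => cabs (q x))).
Proof.
by apply: integrable_dominated => // x; rewrite ger0_norm ?cabs_ge0// aq_le.
Qed.

Lemma integrable_weighted_potential :
  mu.-integrable setT (EFin \o (fun x => `|x| * cabs (q x))).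
Proof.
apply: integrable_dominated => [|x]; first exact: measurable_funM.
by rewrite ger0_norm ?mulr_ge0 ?cabs_ge0// mulrDl mul1r lerDr cabs_ge0.
Qed.

Lemma integrable_Re_potential : mu.-integrable setT (EFin \o (fun x => Re (q x))).
Proof.
have [mr _ _] := hq; apply: integrable_dominated => // x.
exact: le_trans (normr_Re_le _) (aq_le x).
Qed.

Lemma integrable_Im_potential : mu.-integrable setT (EFin \o (fun x => Im (q x))).
Proof.
have [_ mi _] := hq; apply: integrable_dominated => // x.
exact: le_trans (normr_Im_le _) (aq_le x).
Qed.

End Potential.

Section Tail.
Variable R : realType.
Local Notation mu := (@lebesgue_measure R).
Variable h : R -> R.
Hypothesis inth : mu.-integrable setT (EFin \o h).

Definition tail (h : R -> R) (x : R) : R := \int[mu]_t h t - primitive h x.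

Lemma tail_antideriv : antideriv_real (tail h) (fun x => - h x).
Proof.
have [aF dF] := antiderivB (antideriv_cst (\int[mu]_t h t)%:C) (primitive_antideriv inth).
have e1 : (fun x => (tail h x)%:C) =
    (fun x => (\int[mu]_t h t)%:C - (primitive h x)%:C).
  by apply/funext => x; rewrite /tail rmorphB.
rewrite /antideriv_real e1; split=> //; apply: aeS dF => x.
by rewrite sub0r rmorphN.
Qed.

Lemma tail_vanishes : vanishes (tail h).
Proof. exact: primitive_vanishes_pinfty. Qed.

Lemma reflected_tail_antideriv :
  antideriv_real (fun x => primitive h (- x)) (fun x => - h (- x)).
Proof. exact: antideriv_real_reflect (primitive_antideriv inth). Qed.

Lemma tail0D : tail h 0 + primitive h (- 0) = \int[mu]_t h t.
Proof. by rewrite oppr0 subrK. Qed.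

End Tail.

Section JostHalfLine.
Variable R : realType.
Local Notation mu := (@lebesgue_measure R).
Variables (q : R -> R[i]) (k : R[i]).
Let c : R[i] := 'i%C * k.

Let c2 : c ^+ 2 = - k ^+ 2.
Proof. by rewrite /c exprMn sqr_i mulN1r. Qed.

Lemma schrodinger_antideriv f : schrodinger_solution q k f ->
  antideriv f (cderiv f) /\
  antideriv (cderiv f) (fun x => q x * f x + c ^+ 2 * f x).
Proof.
move=> [df acf eqf]; split.
  apply: antideriv_C1 => [x|a b ab]; first exact/cderivableP/df.
  exact: abs_continuous_on_bounded (acf _ _ ab).
split=> //; apply: aeS eqf => x [/cderivableP + e].
have -> // : cderiv (cderiv f) x = q x * f x + c ^+ 2 * f x.
by rewrite c2 mulNr -e; ring.
Qed.

Lemma jost_plus_half_line f : jost_plus q k f ->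
  [/\ antideriv f (cderiv f),
      antideriv (cderiv f) (fun x => q x * f x + c ^+ 2 * f x) &
      vanishes (fun x => cabs (f x * cexp (x%:C * - c) - 1))].
Proof.
move=> [/schrodinger_antideriv[a1 a2] lim]; split=> //.
apply: cvg_vanishes; rewrite (_ : (fun x => _) =
  fun x => cabs (f x * cexp (- ('i%C * x%:C * k)) - 1)) //; apply/funext => x.
by congr (cabs (f x * cexp _ - 1)); rewrite /c; ring.
Qed.

(** Reflection turns the left Jost solution into a right one for the reflected
potential, at the same wave number. *)
Lemma jost_minus_half_line f : jost_minus q k f ->
  [/\ antideriv (fun x => f (- x)) (fun x => - cderiv f (- x)),
      antideriv (fun x => - cderiv f (- x))
        (fun x => q (- x) * f (- x) + c ^+ 2 * f (- x)) &
      vanishes (fun x => cabs (f (- x) * cexp (x%:C * - c) - 1))].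
Proof.
move=> [/schrodinger_antideriv[a1 a2] lim]; split.
- exact: antideriv_reflect.
- have := antiderivZ (-1) (antideriv_reflect a2).
  rewrite (_ : (fun x => -1 * cderiv f (- x)) = (fun x => - cderiv f (- x))).
    by apply: eq_antideriv; apply/funext => x; rewrite mulrNN mul1r.
  by apply/funext => x; rewrite mulN1r.
- move=> e e0; move/cvgrPdist_lt : lim => /(_ e e0)[X [_ XP]].
  exists (- X + 1) => x Xx.
  have := XP (- x); rewrite sub0r normrN.
  rewrite (_ : cexp _ = cexp (x%:C * - c)); last first.
    by congr cexp; rewrite /c rmorphN; ring.
  by apply; rewrite ltrNl (lt_le_trans _ Xx)// ltrDl.
Qed.

End JostHalfLine.

(** * Bounds for psi *)

Section AmplitudeAlgebra.
Variable R : realType.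
Implicit Types (c A N F S : R[i]) (Q T : R).

Let M c Q : R := 3 / 2 * expR (Q / (2 * cabs c)).

(** Cauchy-Schwarz, which pairs the energies of the two sides. *)
Lemma amplitude_modulus c A N F Q T S A' N' F' Q' T' S' : c != 0 ->
  amplitude_bounds c A N F Q T S -> amplitude_bounds c A' N' F' Q' T' S' ->
  cabs ((A * A' - N * N') / (4 * c ^+ 2)) <= expR ((Q + Q') / 2 / cabs c).
Proof.
move=> c0 [h _ _ _ _] [h' _ _ _ _].
have K0 : 0 < cabs c by rewrite lt_neqAle cabs_ge0 andbT eq_sym cabs_eq0.
have e4 : cabs (4 * c ^+ 2) = 4 * cabs c ^+ 2.
  by rewrite cabsM expr2 cabsM -[4%:R](rmorph_nat (real_complex R)) cabs_real normr_nat.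
rewrite cabsM cabsV e4 ler_pdivrMr ?mulr_gt0 ?exprn_gt0//.
rewrite -(@ler_pXn2r _ 2)// ?nnegrE ?cabs_ge0 ?mulr_ge0 ?expR_ge0 ?exprn_ge0 ?cabs_ge0//.
have := cabsB (A * A') (N * N'); rewrite (cabsM A) (cabsM N) => h1.
apply: (@le_trans _ _ ((cabs A * cabs A' + cabs N * cabs N') ^+ 2)).
  by rewrite ler_pXn2r// nnegrE ?addr_ge0 ?mulr_ge0 ?cabs_ge0.
apply: (@le_trans _ _ ((cabs A ^+ 2 + cabs N ^+ 2) * (cabs A' ^+ 2 + cabs N' ^+ 2))).
  have := sqr_ge0 (cabs A * cabs N' - cabs A' * cabs N).
  set x := cabs A; set y := cabs A'; set z := cabs N; set w := cabs N'; nra.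
apply: le_trans (ler_pM _ _ h h') _; rewrite ?addr_ge0 ?sqr_ge0//.
rewrite le_eqVlt; apply/orP; left; apply/eqP.
have -> : expR ((Q + Q') / 2 / cabs c) * (4 * cabs c ^+ 2) =
   4 * cabs c ^+ 2 * expR ((Q + Q') / 2 / cabs c) by ring.
rewrite exprMn -expRM_natl.
have -> : 2%:R * ((Q + Q') / 2 / cabs c) = Q / cabs c + Q' / cabs c.
  by field; rewrite gt_eqF.
by rewrite expRD; ring.
Qed.

(** The products of two small amplitudes are of second order, and what remains is
the sum of the first-order errors of the two sides. *)
Lemma amplitude_first_order c A N F Q T S A' N' F' Q' T' S' (s : R) : c != 0 ->
  0 <= Q -> 0 <= Q' ->
  amplitude_bounds c A N F Q T S -> amplitude_bounds c A' N' F' Q' T' S' ->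
  s = (Q + Q') / 2 / cabs c ->
  cabs ((A * A' - N * N') / (4 * c ^+ 2) - 1 + (S + S') / (2 * c)) <=
    9 / 2 * expR (2 * s) * s ^+ 2.
Proof.
move=> c0 Q0 Q'0 [_ hN hA hS _] [_ hN' hA' hS' _] sE.
have K0 : 0 < cabs c by rewrite lt_neqAle cabs_ge0 andbT eq_sym cabs_eq0.
have n2 (n : nat) : cabs (n%:R : R[i]) = n%:R.
  by rewrite -(rmorph_nat (real_complex R)) cabs_real normr_nat.
have cn0 n : (n.+1%:R : R[i]) != 0 by rewrite pnatr_eq0.
have -> : (A * A' - N * N') / (4 * c ^+ 2) - 1 + (S + S') / (2 * c) =
   ((A - 2 * c + S) + (A' - 2 * c + S')) / (2 * c) +
   ((A - 2 * c) * (A' - 2 * c) - N * N') / (4 * c ^+ 2).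
  by field.
pose X := 3 / 2 * expR s.
have X0 : 0 <= X by rewrite mulr_ge0 ?expR_ge0.
have X1 : 1 <= X.
  have : 1 <= expR s by rewrite -expR0 ler_expR sE divr_ge0 ?divr_ge0 ?addr_ge0 ?(ltW K0).
  by rewrite /X; lra.
have MX : M c Q <= X.
  rewrite /M /X ler_wpM2l// ler_expR sE invfM mulrA ler_pM2r ?invr_gt0//.
  by rewrite ler_pM2r ?invr_gt0// lerDl.
have MX' : M c Q' <= X.
  rewrite /M /X ler_wpM2l// ler_expR sE invfM mulrA ler_pM2r ?invr_gt0//.
  by rewrite ler_pM2r ?invr_gt0// lerDr.
have {}hN : cabs N <= X * Q by apply: le_trans hN _; rewrite ler_wpM2r.
have {}hA : cabs (A - 2 * c) <= X * Q by apply: le_trans hA _; rewrite ler_wpM2r.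
have {}hN' : cabs N' <= X * Q' by apply: le_trans hN' _; rewrite ler_wpM2r.
have {}hA' : cabs (A' - 2 * c) <= X * Q' by apply: le_trans hA' _; rewrite ler_wpM2r.
have {}hS : cabs (A - 2 * c + S) <= X * Q ^+ 2 / cabs c.
  by apply: le_trans hS _; rewrite ler_pM2r ?invr_gt0// ler_wpM2r// sqr_ge0.
have {}hS' : cabs (A' - 2 * c + S') <= X * Q' ^+ 2 / cabs c.
  by apply: le_trans hS' _; rewrite ler_pM2r ?invr_gt0// ler_wpM2r// sqr_ge0.
apply: le_trans (cabsD _ _) _; rewrite !(cabsM _ (_^-1)) !cabsV.
have -> : cabs (2 * c) = 2 * cabs c by rewrite cabsM n2.
have -> : cabs (4 * c ^+ 2) = 4 * cabs c ^+ 2 by rewrite cabsM n2 expr2 cabsM.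
have h1 := le_trans (cabsD _ _) (lerD hS hS').
have h2 : cabs ((A - 2 * c) * (A' - 2 * c) - N * N') <= 2 * (X * Q * (X * Q')).
  apply: le_trans (cabsB _ _) _; rewrite !cabsM [leRHS]mulr_natl [leRHS]mulr2n.
  by apply: lerD; apply: ler_pM; rewrite ?cabs_ge0.
have i2 : 0 <= (2 * cabs c)^-1 by rewrite invr_ge0 mulr_ge0// ltW.
have i4 : 0 <= (4 * cabs c ^+ 2)^-1 by rewrite invr_ge0 mulr_ge0// exprn_ge0// ltW.
apply: le_trans (lerD (ler_wpM2r i2 h1) (ler_wpM2r i4 h2)) _.
have -> : 9 / 2 * expR (2 * s) * s ^+ 2 = X ^+ 2 * (Q + Q') ^+ 2 / (2 * cabs c ^+ 2).
  rewrite /X exprMn -expRM_natl; have -> : s ^+ 2 = (Q + Q') ^+ 2 / (4 * cabs c ^+ 2).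
    by rewrite sE; field; rewrite gt_eqF.
  by field; rewrite gt_eqF.
have -> : (X * Q ^+ 2 / cabs c + X * Q' ^+ 2 / cabs c) / (2 * cabs c) +
    2 * (X * Q * (X * Q')) / (4 * cabs c ^+ 2) =
    (X * (Q ^+ 2 + Q' ^+ 2) + X ^+ 2 * (Q * Q')) / (2 * cabs c ^+ 2).
  by field; rewrite gt_eqF.
rewrite ler_pM2r ?invr_gt0 ?mulr_gt0 ?exprn_gt0//.
have : X * (Q ^+ 2 + Q' ^+ 2) <= X ^+ 2 * (Q ^+ 2 + Q' ^+ 2).
  by rewrite ler_wpM2r ?addr_ge0 ?sqr_ge0// expr2 ler_peMl.
have : 0 <= X ^+ 2 * (Q * Q') by rewrite mulr_ge0 ?sqr_ge0 ?mulr_ge0.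
by rewrite sqrrD; set Y := X ^+ 2; lra.
Qed.

(** Eliminating [A] and [A'] removes the cancelling products of order 0 in [c], and
only one power of [c] is left in the denominator. *)
Lemma amplitude_low_energy c A N F Q T S A' N' F' Q' T' S' : c != 0 -> Re c = 0 ->
  A - N = 2 * c * F -> A' - N' = 2 * c * F' ->
  amplitude_bounds c A N F Q T S -> amplitude_bounds c A' N' F' Q' T' S' ->
  cabs ((A * A' - N * N') / (4 * c ^+ 2)) <=
    expR (T + T') * ((Q + Q') / 2 + cabs c) / cabs c.
Proof.
move=> c0 ci e e' [_ _ _ _ /(_ ci)[hF hN]] [_ _ _ _ /(_ ci)[hF' hN']].
have K0 : 0 < cabs c by rewrite lt_neqAle cabs_ge0 andbT eq_sym cabs_eq0.
have cn0 n : (n.+1%:R : R[i]) != 0 by rewrite pnatr_eq0.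
have -> : (A * A' - N * N') / (4 * c ^+ 2) = (F' * (N + c * F) + F * (N' + c * F')) / (2 * c).
  have -> : A = N + 2 * c * F by rewrite -e; ring.
  have -> : A' = N' + 2 * c * F' by rewrite -e'; ring.
  by field.
rewrite cabsM cabsV cabsM -[2%:R](rmorph_nat (real_complex R)) cabs_real normr_nat.
have hh (E E' q : R) (f g n : R[i]) : cabs f <= E -> cabs g <= E' -> cabs n <= E * q ->
    cabs (g * (n + c * f)) <= E' * E * (q + cabs c).
  move=> hf hg hn; rewrite cabsM -mulrA ler_pM ?cabs_ge0//.
  apply: le_trans (cabsD _ _) _; rewrite mulrDr lerD// cabsM mulrC.
  by rewrite ler_wpM2r ?cabs_ge0.
have := le_trans (cabsD _ _) (lerD (hh _ _ _ _ _ _ hF hF' hN) (hh _ _ _ _ _ _ hF' hF hN')).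
move=> h; rewrite ler_pdivrMr ?mulr_gt0//; apply: le_trans h _.
rewrite expRD le_eqVlt; apply/orP; left; apply/eqP.
by field; rewrite gt_eqF.
Qed.

End AmplitudeAlgebra.

Section PsiBounds.
Variable R : realType.
Local Notation mu := (@lebesgue_measure R).
Variables (q : R -> R[i]) (fp fm : R -> R[i] -> R[i]).
Hypothesis hq : admissible_potential q.
Hypothesis hfp : forall k : R[i], 0 <= Im k -> jost_plus q k (fp ^~ k).
Hypothesis hfm : forall k : R[i], 0 <= Im k -> jost_minus q k (fm ^~ k).
Local Notation psi := (jost_psi fp fm).

Definition potential_integral : R[i] :=
  (\int[mu]_x Re (q x)) +i* (\int[mu]_x Im (q x)).

(** Right and left tail integrals of [q]. *)
Let tailC x : R[i] :=
  (tail (fun x => Re (q x)) x)%:C + 'i%C * (tail (fun x => Im (q x)) x)%:C.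
Let rtailC x : R[i] :=
  (primitive (fun x => Re (q x)) (- x))%:C +
  'i%C * (primitive (fun x => Im (q x)) (- x))%:C.

Let cabs_i : cabs ('i%C : R[i]) = 1.
Proof. by rewrite cabsE /= expr0n add0r expr1n sqrtr1. Qed.

Let tailC_le (x y : R) : cabs (x%:C + 'i%C * y%:C) <= `|x| + `|y|.
Proof.
by apply: le_trans (cabsD _ _) _; rewrite cabsM cabs_i mul1r !cabs_real.
Qed.

Let antideriv_tailC : antideriv tailC (fun x => - q x).
Proof.
have := antiderivD (tail_antideriv (integrable_Re_potential hq))
  (antiderivZ 'i%C (tail_antideriv (integrable_Im_potential hq))).
apply: eq_antideriv; apply/funext => x.
by rewrite [q x in RHS]complexE !rmorphN mulrN opprD.
Qed.

Let vanishes_norm (f : R -> R) : vanishes f -> vanishes (fun x => `|f x|).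
Proof. by move=> vf e /vf[X XP]; exists X => x /XP; rewrite normr_id. Qed.

Let tailC_vanishes : vanishes (fun x => cabs (tailC x)).
Proof.
apply: (vanishes_le (X := 0) _ (vanishesD
  (vanishes_norm (tail_vanishes (integrable_Re_potential hq)))
  (vanishes_norm (tail_vanishes (integrable_Im_potential hq))))) => x _.
by rewrite ger0_norm ?cabs_ge0// tailC_le.
Qed.

Let antideriv_rtailC : antideriv rtailC (fun x => - q (- x)).
Proof.
have := antiderivD (reflected_tail_antideriv (integrable_Re_potential hq))
  (antiderivZ 'i%C (reflected_tail_antideriv (integrable_Im_potential hq))).
apply: eq_antideriv; apply/funext => x.
by rewrite [q (- x) in RHS]complexE !rmorphN mulrN opprD.
Qed.

Let rtailC_vanishes : vanishes (fun x => cabs (rtailC x)).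
Proof.
apply: (vanishes_le (X := 0) _ (vanishesD
  (vanishes_norm (primitive_vanishes_ninfty (integrable_Re_potential hq)))
  (vanishes_norm (primitive_vanishes_ninfty (integrable_Im_potential hq))))) => x _.
by rewrite ger0_norm ?cabs_ge0// tailC_le.
Qed.

(** The Wronskian at the origin in terms of the amplitudes of the two Jost
solutions; the left one is reflected to a right one. *)
Lemma psi_amplitudes (k : R[i]) : 0 <= Im k -> k != 0 ->
  let c := 'i%C * k in
  exists (A N F : R[i]) (Q T : R) (S : R[i]) (A' N' F' : R[i]) (Q' T' : R) (S' : R[i]),
  [/\ amplitude_bounds c A N F Q T S, amplitude_bounds c A' N' F' Q' T' S',
      psi k = (A * A' - N * N') / (4 * c ^+ 2),
      A - N = 2 * c * F /\ A' - N' = 2 * c * F' &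
      [/\ 0 <= Q, 0 <= Q', (Q + Q') / 2 = r_c q, T + T' = weighted_norm1 q &
          S + S' = potential_integral] ].
Proof.
move=> k0 kn0 c.
have c0 : c != 0 by rewrite mulf_neq0// -cabs_eq0 cabs_i oner_eq0.
have cRe : Re c <= 0 by rewrite /c cReM /= mul0r mul1r sub0r oppr_le0.
have iq := integrable_potential hq; have iw := integrable_weighted_potential hq.
have aT' : antideriv_real (fun x => primitive (fun x => `|x| * cabs (q x)) (- x))
    (fun x => - (`|x| * cabs (q (- x)))).
  have := reflected_tail_antideriv iw; congr antideriv.
  by apply/funext => x; rewrite normrN.
have [a1 a2 a3] := jost_plus_half_line (hfp k0).
have [b1 b2 b3] := jost_minus_half_line (hfm k0).
have H1 := jost_amplitudes0 c0 cRe a1 a2 a3 (tail_antideriv iq) (tail_vanishes iq)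
  (tail_antideriv iw) (tail_vanishes iw) antideriv_tailC tailC_vanishes.
have H2 := jost_amplitudes0 c0 cRe b1 b2 b3 (reflected_tail_antideriv iq)
  (primitive_vanishes_ninfty iq) aT' (primitive_vanishes_ninfty iw)
  antideriv_rtailC rtailC_vanishes.
do 12 eexists; split; [exact: H1|exact: H2| | |].
- rewrite /jost_psi /jost_w oppr0 -(mulrA 2) -/c.
  have i0 : ('i%C : R[i]) != 0 by rewrite -cabs_eq0 cabs_i oner_eq0.
  have n0 : forall n, (n.+1%:R : R[i]) != 0 by move=> n; rewrite pnatr_eq0.
  by field.
- by split; ring.
- split.
  + by apply: tail_ge0 (tail_antideriv iq) _ (tail_vanishes iq) => t; exact: cabs_ge0.
  + apply: (@tail_ge0 _ (fun x => primitive (fun x => cabs (q x)) (- x)) _ 0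
      (reflected_tail_antideriv iq) _ (primitive_vanishes_ninfty iq)).
    by move=> t; exact: cabs_ge0.
  + by rewrite tail0D /r_c mulrC.
  + rewrite tail0D /weighted_norm1; apply: eq_Rintegral => x _.
    by rewrite cabsM cabs_real.
  + rewrite /tailC /rtailC /potential_integral addrACA -mulrDr -!rmorphD !tail0D.
    by rewrite [RHS]complexE.
Qed.

Let Knz (k : R[i]) : k != 0 -> 'i%C * k != 0 :> R[i].
Proof. by move=> k0; rewrite mulf_neq0// -cabs_eq0 cabs_i oner_eq0. Qed.

Let cabs_ik (k : R[i]) : cabs ('i%C * k) = cabs k.
Proof. by rewrite cabsM cabs_i mul1r. Qed.

Lemma psi_le_energy (k : R[i]) : 0 <= Im k -> k != 0 -> cabs (psi k) <= expR (r_c q / cabs k).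
Proof.
move=> k0 kn0.
have [A [N [F [Q [T [S [A' [N' [F' [Q' [T' [S' ]]]]]]]]]]]] := psi_amplitudes k0 kn0.
move=> [h h' -> _ [_ _ <- _ _]]; rewrite -(cabs_ik k).
exact: amplitude_modulus (Knz kn0) h h'.
Qed.

Lemma psi_first_order (k : R[i]) : 0 <= Im k -> k != 0 ->
  cabs (psi k - 1 + potential_integral / (2 * ('i%C * k))) <=
  9 / 2 * expR (2 * (r_c q / cabs k)) * (r_c q / cabs k) ^+ 2.
Proof.
move=> k0 kn0.
have [A [N [F [Q [T [S [A' [N' [F' [Q' [T' [S' ]]]]]]]]]]]] := psi_amplitudes k0 kn0.
move=> [h h' -> _ [q0 q0' <- _ <-]]; rewrite -(cabs_ik k).
exact: amplitude_first_order (Knz kn0) q0 q0' h h' _.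
Qed.

Lemma psi_le_low_energy (t : R) : t != 0 ->
  cabs (psi t%:C) <= expR (weighted_norm1 q) * (r_c q + `|t|) / `|t|.
Proof.
move=> t0; have k0 : 0 <= Im (t%:C) by [].
have kn0 : t%:C != 0 :> R[i] by rewrite -cabs_eq0 cabs_real normr_eq0.
have [A [N [F [Q [T [S [A' [N' [F' [Q' [T' [S' ]]]]]]]]]]]] := psi_amplitudes k0 kn0.
move=> [h h' -> [e e'] [q0 q0' <- <- _]].
have ci : Re ('i%C * t%:C : R[i]) = 0 by rewrite cReM /= mul0r mulr0 subr0.
have := amplitude_low_energy (Knz kn0) ci e e' h h'.
by rewrite cabs_ik cabs_real.
Qed.

Lemma potential_integral_le : cabs potential_integral <= 2 * r_c q.
Proof.
have iq := integrable_potential hq.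
have h1 := tail_dominated 0 antideriv_tailC tailC_vanishes
  (tail_antideriv iq) (tail_vanishes iq).
have h2 := tail_dominated 0 antideriv_rtailC rtailC_vanishes
  (reflected_tail_antideriv iq) (primitive_vanishes_ninfty iq).
have -> : potential_integral = tailC 0 + rtailC 0.
  rewrite /tailC /rtailC /potential_integral addrACA -mulrDr -!rmorphD !tail0D.
  by rewrite [LHS]complexE.
have -> : 2 * r_c q = tail (fun x => cabs (q x)) 0 + primitive (fun x => cabs (q x)) (- 0).
  by rewrite tail0D /r_c mulVKf// pnatr_eq0.
exact: le_trans (cabsD _ _) (lerD h1 h2).
Qed.

Lemma r_c_ge0 : 0 <= r_c q.
Proof. by rewrite mulr_ge0// Rintegral_ge0// => x _; exact: cabs_ge0. Qed.

Lemma weighted_norm1_ge0 : 0 <= weighted_norm1 q.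
Proof. by rewrite Rintegral_ge0// => x _; exact: cabs_ge0. Qed.

End PsiBounds.

Section LogBounds.
Variable R : realType.

(** The condition on [y] covers [z = 0], where the logarithm is 0. *)
Lemma ln_cabs_le (z : R[i]) (y : R) : 1 <= y -> cabs z <= y -> ln (cabs z) <= ln y.
Proof.
move=> y1 zy; have [z0|z0] := ltP 0 (cabs z).
  by rewrite ler_ln ?posrE// (lt_le_trans ltr01).
by rewrite ln0// ln_ge0.
Qed.

(** [1 + x <= (1 + sqrt x)^2 <= exp (2 sqrt x)]. *)
Lemma ln1D_le_sqrt (x : R) : 0 <= x -> ln (1 + x) <= 2 * Num.sqrt x.
Proof.
move=> x0; have x1 : 0 < 1 + x by rewrite ltr_pwDl.
rewrite -[leRHS]expRK ler_ln ?posrE ?expR_gt0// expRM_natl.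
have s0 := sqrtr_ge0 x; have := expR_ge1Dx (Num.sqrt x) => h.
apply: (@le_trans _ _ ((1 + Num.sqrt x) ^+ 2)).
  rewrite sqrrD sqr_sqrtr// expr1n mul1r -addrA lerD2l lerDr.
  by rewrite mulrn_wge0.
by rewrite ler_pXn2r// nnegrE ?expR_ge0// addr_ge0.
Qed.

Lemma expR_half_le2 (x : R) : x <= 1 / 2 -> expR x <= 2.
Proof.
move=> x2; have := expR_ge1Dx (- x); rewrite expRN => h.
rewrite -[leRHS]invrK -[expR x]invrK lef_pV2 ?posrE ?invr_gt0 ?expR_gt0//.
by apply: le_trans h; lra.
Qed.

End LogBounds.

Section PsiLogBounds.
Variable R : realType.
Variables (q : R -> R[i]) (fp fm : R -> R[i] -> R[i]).
Hypothesis hq : admissible_potential q.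
Hypothesis hfp : forall k : R[i], 0 <= Im k -> jost_plus q k (fp ^~ k).
Hypothesis hfm : forall k : R[i], 0 <= Im k -> jost_minus q k (fm ^~ k).
Local Notation r := (r_c q).

Definition log_psi (t : R) : R := ln (cabs (jost_psi fp fm t%:C)).

Let r0 : 0 <= r. Proof. exact: r_c_ge0. Qed.

Lemma log_psi_le_low_energy (t : R) : 0 < t ->
  log_psi t <= weighted_norm1 q + 2 * (Num.sqrt r / Num.sqrt t) /\
  log_psi (- t) <= weighted_norm1 q + 2 * (Num.sqrt r / Num.sqrt t).
Proof.
move=> t0.
suff h s : `|s| = t -> log_psi s <= weighted_norm1 q + 2 * (Num.sqrt r / Num.sqrt t).
  by split; apply: h; rewrite ?normrN gtr0_norm.
move=> st; have s0 : s != 0 by rewrite -normr_eq0 st gt_eqF.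
have := psi_le_low_energy hq hfp hfm s0; rewrite st.
have -> : expR (weighted_norm1 q) * (r + t) / t = expR (weighted_norm1 q) * (1 + r / t).
  by field; rewrite gt_eqF.
have rt : 0 <= r / t by rewrite divr_ge0// ltW.
have e1 : 1 <= expR (weighted_norm1 q).
  by rewrite -expR0 ler_expR weighted_norm1_ge0.
move=> /ln_cabs_le; rewrite -/(log_psi s) => h.
apply: le_trans (h _) _.
  by rewrite -[leLHS]mulr1 ler_pM// lerDl.
rewrite lnM ?posrE ?expR_gt0 ?ltr_pwDl// expRK lerD2l.
have -> : Num.sqrt r / Num.sqrt t = Num.sqrt (r / t) by rewrite (sqrtrM _ r0) sqrtrV ?ltW.
exact: ln1D_le_sqrt.
Qed.

Lemma log_psi_le_energy t : t != 0 -> log_psi t <= r / `|t|.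
Proof.
move=> t0; have kn0 : t%:C != 0 :> R[i] by rewrite -cabs_eq0 cabs_real normr_eq0.
have := @psi_le_energy _ _ _ _ hq hfp hfm t%:C (lexx 0) kn0.
rewrite cabs_real => /ln_cabs_le; rewrite expRK; apply.
by rewrite -expR0 ler_expR divr_ge0.
Qed.

(** The first-order terms of [psi (t)] and [psi (- t)] cancel in the product.  With
[s = r / t <= 1 / 4] the remaining terms are at most
[s^2 + 18 (1 + s) s^2 + 81 s^4 <= 29 s^2]. *)
Lemma log_psi_pair_le (t : R) : 0 < t -> 4 * r <= t ->
  log_psi t + log_psi (- t) <= 29 * r ^+ 2 / t ^+ 2.
Proof.
move=> t0 rt; pose s := r / t.
have s0 : 0 <= s by rewrite divr_ge0// ltW.
have s4 : s <= 1 / 4 by rewrite ler_pdivrMr//; lra.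
pose z : R[i] := potential_integral q / (2 * ('i%C * t%:C)).
have zs : cabs z <= s.
  rewrite /z cabsM cabsV !cabsM cabs_real gtr0_norm//.
  have -> : cabs ('i%C : R[i]) = 1 by rewrite cabsE /= expr0n add0r expr1n sqrtr1.
  rewrite -[2%:R](rmorph_nat (real_complex R)) cabs_real normr_nat mul1r.
  rewrite ler_pdivrMr ?mulr_gt0// /s.
  have -> : r / t * (2 * t) = 2 * r by field; rewrite gt_eqF.
  exact: potential_integral_le.
have e2 : 9 / 2 * expR (2 * s) * s ^+ 2 <= 9 * s ^+ 2.
  rewrite ler_wpM2r ?sqr_ge0//.
  have := @expR_half_le2 _ (2 * s) _; move=> h; have {}h : expR (2 * s) <= 2 by apply: h; lra.
  by lra.
have nz (u : R) : `|u| = t -> u%:C != 0 :> R[i].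
  by move=> ut; rewrite -cabs_eq0 cabs_real ut gt_eqF.
have nt : `|t| = t by rewrite gtr0_norm.
have nNt : `|- t| = t by rewrite normrN.
have hp := @psi_first_order _ _ _ _ hq hfp hfm t%:C (lexx 0) (nz _ nt).
have hm := @psi_first_order _ _ _ _ hq hfp hfm (- t)%:C (lexx 0) (nz _ nNt).
move: hp hm; rewrite !cabs_real nt nNt -/s -/z => hp hm.
have zN : potential_integral q / (2 * ('i%C * (- t)%:C)) = - z.
  by rewrite rmorphN !mulrN invrN mulrN.
rewrite zN in hm.
have {}hp := le_trans hp e2; have {}hm := le_trans hm e2.
pose P := jost_psi fp fm t%:C; pose N := jost_psi fp fm (- t)%:C.
rewrite -/P -/N in hp hm *.
have s2 : s ^+ 2 <= 1 / 16.
  by rewrite (_ : 1 / 16 = (1 / 4) ^+ 2); [rewrite ler_pXn2r// nnegrE|field].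
have far (w w' : R[i]) : cabs w' <= s -> cabs (w - 1 + w') <= 9 * s ^+ 2 -> 0 < cabs w.
  move=> h1 h2; have := cabsB (w - 1 + w') w'.
  have := cabsB w (w - 1 + w' - w').
  have -> : w - (w - 1 + w' - w') = 1 by ring.
  by rewrite cabs1; lra.
have P0 : 0 < cabs P by exact: far zs hp.
have N0 : 0 < cabs N by apply: far hm; rewrite cabsN.
rewrite /log_psi -/P -/N -lnM ?posrE// -cabsM.
have lnle (x : R) : 0 < x -> ln x <= x - 1.
  by move=> x0; have := @le_ln1Dx _ (x - 1); rewrite addrCA subrr addr0; apply; lra.
apply: le_trans (lnle _ _) _; first by rewrite cabsM mulr_gt0.
rewrite lerBlDr.
set A := P - 1 + z in hp; set B := N - 1 + - z in hm.
have -> : P * N = 1 - z * z + (1 - z) * B + (1 + z) * A + A * B.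
  by rewrite /A /B; ring.
have z1 : cabs (1 - z) <= 1 + s by apply: le_trans (cabsB _ _) _; rewrite cabs1 lerD2l.
have z2 : cabs (1 + z) <= 1 + s by apply: le_trans (cabsD _ _) _; rewrite cabs1 lerD2l.
have t1 : cabs (1 - z * z) <= 1 + s ^+ 2.
  apply: le_trans (cabsB _ _) _; rewrite cabs1 lerD2l cabsM expr2.
  by rewrite ler_pM ?cabs_ge0.
have t2 : cabs ((1 - z) * B) <= (1 + s) * (9 * s ^+ 2).
  by rewrite cabsM ler_pM ?cabs_ge0.
have t3 : cabs ((1 + z) * A) <= (1 + s) * (9 * s ^+ 2).
  by rewrite cabsM ler_pM ?cabs_ge0.
have t4 : cabs (A * B) <= 9 * s ^+ 2 * (9 * s ^+ 2).
  by rewrite cabsM ler_pM ?cabs_ge0.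
have := le_trans (cabsD _ _) (lerD (le_trans (cabsD _ _)
  (lerD (le_trans (cabsD _ _) (lerD t1 t2)) t3)) t4).
move=> /le_trans; apply.
have -> : 29 * r ^+ 2 / t ^+ 2 = 29 * s ^+ 2 by rewrite /s; field; rewrite gt_eqF.
have h5 : s * s ^+ 2 <= 1 / 4 * s ^+ 2 by rewrite ler_wpM2r ?sqr_ge0.
have h6 : s ^+ 2 * s ^+ 2 <= 1 / 16 * s ^+ 2 by rewrite ler_wpM2r ?sqr_ge0.
have -> : (1 + s) * (9 * s ^+ 2) = 9 * s ^+ 2 + 9 * (s * s ^+ 2) by ring.
have -> : 9 * s ^+ 2 * (9 * s ^+ 2) = 81 * (s ^+ 2 * s ^+ 2) by ring.
by have := sqr_ge0 s; lra.
Qed.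

End PsiLogBounds.

(** * Integrals of the three bounds *)

Section ElementaryIntegrals.
Variable R : realType.
Local Notation mu := (@lebesgue_measure R).

Implicit Types (a b c d x A al be : R).

Lemma is_derive_continuous (F : R -> R) x d : is_derive x (1 : R) F d ->
  {for x, continuous F}.
Proof. by move=> [dF _]; exact/differentiable_continuous/derivable1_diffP. Qed.

Lemma integral_of_derivative (f F : R -> R) a b : a <= b ->
  (forall x, a <= x <= b -> is_derive x (1 : R) F (f x)) ->
  (forall x, a <= x <= b -> {for x, continuous f}) ->
  (\int[mu]_(x in `[a, b]) (f x)%:E = (F b - F a)%:E)%E.
Proof.
rewrite le_eqVlt => /predU1P[<- _ _|ab dF cf].
  by rewrite set_itv1 integral_set1 subrr.
have cF x : a <= x <= b -> {for x, continuous F}.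
  by move=> /dF; exact: is_derive_continuous.
have ltab x : x \in `]a, b[ -> a <= x <= b.
  by rewrite in_itv/= => /andP[/ltW-> /ltW->].
have aa : a <= a <= b by rewrite lexx ltW.
have bb : a <= b <= b by rewrite lexx andbT ltW.
rewrite EFinB; apply: continuous_FTC2 => //.
- by apply: continuous_in_subspaceT => x; rewrite inE/= in_itv/= => /cf.
- split.
  + by move=> x /ltab/dF[].
  + exact/cvg_at_right_filter/cF.
  + exact/cvg_at_left_filter/cF.
- by move=> x /ltab/dF dFx; rewrite derive1E; exact: derive_val.
Qed.

(** The integrand is unbounded at 0: monotone convergence along [[1 / (i + 1), 1]]. *)
Lemma integral_reciprocal_sqrt (al be : R) : 0 <= al -> 0 <= be ->
  (\int[mu]_(t in `]0%R, 1%R]) (al + be / Num.sqrt t)%:E <= (al + 2 * be)%:E)%E.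
Proof.
move=> al0 be0; pose F (i : nat) := `[(i.+1%:R : R)^-1, 1]%classic.
have UF : \bigcup_i F i = `]0, 1]%classic.
  apply/seteqP; split => x; rewrite /F /=.
    move=> [i _] /=; rewrite !in_itv/= => /andP[ix ->]; rewrite andbT.
    by rewrite (lt_le_trans _ ix)// invr_gt0 ltr0n.
  rewrite in_itv/= => /andP[x0 x1]; exists (Num.truncn x^-1) => //=.
  rewrite in_itv/= x1 andbT invf_ple ?posrE ?ltr0n//.
  by rewrite ltW// truncnS_gt.
have mF i : measurable (F i) by exact: measurable_itv.
have F0 i x : F i x -> 0 < x.
  by rewrite /F /= in_itv/= => /andP[+ _]; apply: lt_le_trans; rewrite invr_gt0 ltr0n.
have der x : 0 < x ->
    is_derive x (1 : R) (fun t => al * t + 2 * be * Num.sqrt t) (al + be / Num.sqrt x).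
  move=> x0; have s0 : Num.sqrt x != 0 by rewrite gt_eqF// sqrtr_gt0.
  have ds := is_derive1_sqrt x0.
  rewrite (_ : (fun t => _) = (al \*: id + (2 * be) \*: Num.sqrt)); last by apply/funext.
  by apply: is_derive_eq; rewrite /GRing.scale/=; field.
have cont x : 0 < x -> {for x, continuous (fun t => al + be / Num.sqrt t)}.
  move=> x0; apply: cvgD; first exact: cvg_cst.
  apply: cvgM; first exact: cvg_cst.
  by apply: cvgV; [rewrite gt_eqF// sqrtr_gt0|exact: sqrt_continuous].
have bound i : (\int[mu]_(t in F i) (al + be / Num.sqrt t)%:E <= (al + 2 * be)%:E)%E.
  have i0 : 0 < (i.+1%:R : R)^-1 by rewrite invr_gt0 ltr0n.
  have i1 : (i.+1%:R : R)^-1 <= 1 by rewrite invf_le1 ?ltr0n// ler1n.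
  have eF := @integral_of_derivative _ (fun t => al * t + 2 * be * Num.sqrt t) _ _ i1
    (fun x h => der x (lt_le_trans i0 (proj1 (andP h))))
    (fun x h => cont x (lt_le_trans i0 (proj1 (andP h)))).
  by rewrite /F eF lee_fin sqrtr1 !mulr1 gerBl addr_ge0 ?mulr_ge0 ?sqrtr_ge0.
have : (\int[mu]_(t in F i) (al + be / Num.sqrt t)%:E)%E @[i --> \oo] -->
    (\int[mu]_(t in \bigcup_i F i) (al + be / Num.sqrt t)%:E)%E.
  apply: ge0_nondecreasing_set_cvg_integral => //.
  - move=> i j ij; apply/subsetPset => x; rewrite /F /= !in_itv/= => /andP[ix ->].
    rewrite andbT; apply: le_trans ix.
    by rewrite lef_pV2 ?posrE ?ltr0n// ler_nat.
  - move=> i; apply/measurable_EFinP; apply: subspace_continuous_measurable_fun => //.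
    by apply: continuous_in_subspaceT => x; rewrite inE => /F0 /cont.
  - by move=> i x _; rewrite lee_fin addr_ge0// divr_ge0// sqrtr_ge0.
rewrite UF => cv; rewrite -(cvg_lim _ cv)//.
apply: lime_le; first by apply/cvg_ex; eexists; exact: cv.
exact: nearW.
Qed.

Lemma integral_reciprocal (c A : R) : 1 <= A ->
  (\int[mu]_(t in `[1%R, A]) (c / t)%:E = (c * ln A)%:E)%E.
Proof.
move=> A1.
have -> : c * ln A = c * ln A - c * ln 1 by rewrite ln1 mulr0 subr0.
apply: (@integral_of_derivative _ (fun t => c * ln t)) => // x /andP[x1 _].
  have x0 : 0 < x by rewrite (lt_le_trans ltr01).
  have dl := is_derive1_ln x0.
  rewrite (_ : (fun t => _) = c \*: (@ln R)); last by apply/funext.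
  by apply: is_derive_eq.
have x0 : 0 < x by rewrite (lt_le_trans ltr01).
apply: cvgM; first exact: cvg_cst.
by apply: cvgV => //; rewrite gt_eqF.
Qed.

Lemma integral_reciprocal_sqr (c A : R) : 0 <= c -> 0 < A ->
  (\int[mu]_(t in `[A, +oo[) (c / t ^+ 2)%:E = (c / A)%:E)%E.
Proof.
move=> c0 A0.
have der x : 0 < x -> is_derive x (1 : R) (fun t => - (c / t)) (c / x ^+ 2).
  move=> x0; have xn0 : x != 0 by rewrite gt_eqF.
  rewrite (_ : (fun t => _) = (- c) \*: (fun t => t^-1)); last first.
    by apply/funext => t; rewrite /= /GRing.scale/= mulNr.
  have di : is_derive x (1 : R) (fun t : R => t^-1) (- x ^- 2 *: 1).
    exact: is_deriveV.
  by apply: is_derive_eq; rewrite /GRing.scale/=; field.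
rewrite (@ge0_continuous_FTC2y _ _ (fun t => - (c / t)) _ 0).
- by rewrite -EFinB sub0r opprK.
- by move=> x Ax; rewrite divr_ge0// sqr_ge0.
- apply: continuous_in_subspaceT => x; rewrite inE/= in_itv/= andbT => Ax.
  have x0 : 0 < x by exact: lt_le_trans Ax.
  apply: cvgM; first exact: cvg_cst.
  apply: cvgV; first by rewrite gt_eqF// exprn_gt0.
  exact: exprn_continuous.
- rewrite -[X in _ --> X]oppr0 -(mulr0 c); apply: cvgN; apply: cvgM; first exact: cvg_cst.
  apply/cvgrPdist_lt => e e0; exists (e^-1); split => [|x ex]; first exact: num_real.
  have x0 : 0 < x by rewrite (lt_trans _ ex)// invr_gt0.
  by rewrite sub0r normrN gtr0_norm ?invr_gt0// invf_plt ?posrE.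
- by move=> x Ax; have [] := der x (lt_trans A0 Ax).
- by apply: cvg_at_right_filter; exact: is_derive_continuous (der _ A0).
- move=> x; rewrite in_itv/= andbT => Ax.
  by rewrite derive1E; apply: derive_val; exact: der (lt_trans A0 Ax).
Qed.

End ElementaryIntegrals.

Section EvenWeight.
Variable R : realType.
Local Notation mu := (@lebesgue_measure R).
Implicit Types (h g : R -> R).

Let mopp : measurable_fun setT (-%R : measurableTypeR R -> measurableTypeR R).
Proof. exact: (@measurable_funN _ _ _ _ id). Qed.

Let ge0_integral_reflect (f : R -> \bar R) : measurable_fun setT f ->
  (forall x, 0 <= f x)%E -> (\int[mu]_x f (- x)%R = \int[mu]_x f x)%E.
Proof.
move=> mf f0; rewrite -[LHS](ge0_integral_pushforward mopp mu measurableT)//.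
by apply: eq_measure_integral => A mA _; exact: lebesgue_measureN.
Qed.

Lemma integrable_reflect h : mu.-integrable setT (EFin \o h) ->
  mu.-integrable setT (EFin \o (fun x => h (- x))).
Proof.
move=> /integrableP[mh ih]; apply/integrableP; split.
  exact: (measurableT_comp mh mopp).
rewrite (ge0_integral_reflect (f := fun x => `|(h x)%:E|%E))//.
exact: measurableT_comp.
Qed.

Lemma Rintegral_reflect h : mu.-integrable setT (EFin \o h) ->
  \int[mu]_(x in `]-oo, 0]) h x = \int[mu]_(x in `[0, +oo[) h (- x).
Proof.
move=> ih; have [mh _] := integrableP _ _ _ ih.
have e : `[0, +oo[%classic = (-%R : R -> R) @^-1` `]-oo, 0]%classic.
  by apply/seteqP; split => x /=; rewrite !in_itv/= andbT oppr_le0.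
rewrite /Rintegral e; congr fine.
have iD : mu.-integrable (-%R @^-1` `]-oo, 0]%classic) ((EFin \o h) \o -%R).
  by rewrite -e; exact: integrableS (integrable_reflect ih).
rewrite -[RHS](integral_pushforward mopp mh iD)//.
by apply/esym/eq_measure_integral => A mA _; exact: lebesgue_measureN.
Qed.

Lemma Rintegral_even_part h : mu.-integrable setT (EFin \o h) ->
  \int[mu]_x h x = \int[mu]_(x in `]0, +oo[) (h x + h (- x)).
Proof.
move=> ih; have iN := integrable_reflect ih.
have iS (A : set R) : measurable A -> mu.-integrable A (EFin \o h).
  by move=> mA; exact: integrableS ih.
have iNS (A : set R) : measurable A -> mu.-integrable A (EFin \o (fun x => h (- x))).
  by move=> mA; exact: integrableS iN.
rewrite RintegralD//; [|exact: iS|exact: iNS].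
have e : setT = `]-oo, 0] `|` `]0, +oo[ :> set R.
  apply/seteqP; split=> // x _ /=; rewrite !in_itv/= andbT.
  by case: (leP x 0) => _; [left|right].
rewrite [in LHS]e Rintegral_setU//; last 2 first.
- by rewrite -e.
- apply/disj_setPS => x [] /=; rewrite !in_itv/= andbT => x0 x1.
  by move: (lt_le_trans x1 x0); rewrite ltxx.
rewrite addrC Rintegral_reflect//; congr (_ + _).
by rewrite -Rintegral_itv_obnd_cbnd//; exact: iNS.
Qed.

Lemma Rintegral_le_bound (D : set R) h g (B : R) : measurable D ->
  mu.-integrable D (EFin \o h) -> measurable_fun D g ->
  (forall x, D x -> 0 <= g x) -> (forall x, D x -> h x <= g x) ->
  (\int[mu]_(x in D) (g x)%:E <= B%:E)%E ->
  \int[mu]_(x in D) h x <= B.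
Proof.
move=> mD ih mg g0 hg gB.
have ig : mu.-integrable D (EFin \o g).
  apply/integrableP; split; first exact/measurable_EFinP.
  rewrite (_ : (\int[mu]_(x in D) `|(EFin \o g) x|)%E = (\int[mu]_(x in D) (g x)%:E)%E).
    exact: le_lt_trans gB (ltry _).
  by apply: eq_integral => x; rewrite inE => Dx /=; rewrite ger0_norm ?g0.
apply: (@le_trans _ _ (\int[mu]_(x in D) g x)); first exact: le_Rintegral.
rewrite -lee_fin; apply: le_trans gB.
by rewrite [leLHS]fineK//; exact: integrable_fin_num.
Qed.

(** The positive or the negative part has an infinite integral; the extended-real
integral is then infinite, and its real value is 0 by convention. *)
Lemma Rintegral_non_integrable h : measurable_fun setT h ->
  ~ mu.-integrable setT (EFin \o h) -> \int[mu]_x h x = 0.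
Proof.
move=> mh nih; rewrite /Rintegral integralE.
set P := (\int[mu]_x _^\+ x)%E; set N := (\int[mu]_x _^\- x)%E.
have P0 : (0 <= P)%E by exact: integral_ge0.
have N0 : (0 <= N)%E by exact: integral_ge0.
have [Py|Pf] := eqVneq P +oo%E.
  have [Ny|Nf] := eqVneq N +oo%E; first by rewrite Py Ny.
  by rewrite Py; case: N N0 Nf.
have [Ny|Nf] := eqVneq N +oo%E; first by rewrite Ny; case: P P0 Pf.
exfalso; apply: nih; apply/integrableP; split; first exact/measurable_EFinP.
have mE : measurable_fun setT (EFin \o h) by exact/measurable_EFinP.
have -> : (\int[mu]_x `|(EFin \o h) x| = P + N)%E.
  rewrite /P /N -ge0_integralD//.
  - by apply: eq_integral => x _; exact: (congr1 (@^~ x) (fune_abse (EFin \o h))).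
  - exact: measurable_funepos.
  - exact: measurable_funeneg.
by rewrite lte_add_pinfty// ltey.
Qed.

Variables (L : R -> R) (n r : R).
Hypotheses (mL : measurable_fun setT L) (n0 : 0 <= n) (r0 : 0 <= r).
Hypothesis low : forall t, 0 < t -> L t + L (- t) <= 2 * n + 4 * Num.sqrt r / Num.sqrt t.
Hypothesis mid : forall t, 0 < t -> L t + L (- t) <= 2 * r / t.
Hypothesis high : forall t, 0 < t -> 4 * r <= t -> L t + L (- t) <= 29 * r ^+ 2 / t ^+ 2.

Let A : R := Num.max 1 (4 * r).

Let G : R := 2 * n + 8 * Num.sqrt r + 2 * r * ln A + 29 * r ^+ 2 / A.

Let A1 : 1 <= A. Proof. by rewrite le_max lexx. Qed.

Let A0 : 0 < A. Proof. exact: lt_le_trans ltr01 A1. Qed.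

Lemma split_bound_ge0 : 0 <= G.
Proof.
by rewrite /G !addr_ge0 ?mulr_ge0 ?sqrtr_ge0 ?ln_ge0 ?sqr_ge0 ?invr_ge0 ?(ltW A0).
Qed.

(** The pieces [(0, 1]], [(1, A]] and [(A, +oo)] contribute the three parts of [G];
when [W * L] is not integrable its integral is 0, and [G] is nonnegative. *)
Lemma weighted_integral_le (W : R -> R) : measurable_fun setT W ->
  (forall t, 0 <= W t <= 1) -> (forall t, W (- t) = W t) ->
  \int[mu]_t (W t * L t) <= G.
Proof.
move=> mW W01 We.
have [ih|nih] := pselect (mu.-integrable setT (EFin \o (fun t => W t * L t))); last first.
  by rewrite Rintegral_non_integrable ?split_bound_ge0//; exact: measurable_funM.
rewrite Rintegral_even_part//.
under eq_Rintegral do rewrite We -mulrDr.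
pose h t := W t * (L t + L (- t)).
have ih2 : mu.-integrable setT (EFin \o h).
  have := integrableD measurableT ih (integrable_reflect ih).
  by apply: eq_integrable => // x _; rewrite /h /= We -EFinD -mulrDr.
have ihS (D : set R) : measurable D -> mu.-integrable D (EFin \o h).
  by move=> mD; exact: integrableS ih2.
have s1 : \int[mu]_(t in `]0, +oo[) h t = \int[mu]_(t in `]0, 1]) h t +
    (\int[mu]_(t in `]1, A]) h t + \int[mu]_(t in `]A, +oo[) h t).
  have e1 := @Rintegral_itvB _ h (BRight 0) +oo%O 1 (ihS _ (measurable_itv _)) _ _.
  have e2 := @Rintegral_itvB _ h (BRight 1) +oo%O A (ihS _ (measurable_itv _)) _ _.
  rewrite -e2 ?bnd_simp// -e1 ?bnd_simp//.
  by ring.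
have hle t (B : R) : 0 <= B -> L t + L (- t) <= B -> h t <= B.
  move=> B0 LB; have /andP[w0 w1] := W01 t; rewrite /h.
  apply: (@le_trans _ _ (W t * B)); first by rewrite ler_wpM2l.
  by rewrite -[leRHS]mul1r ler_wpM2r.
have pos29 (x : R) : 0 <= 29 * r ^+ 2 / x ^+ 2.
  by apply: divr_ge0; [apply: mulr_ge0 => //; exact: sqr_ge0|exact: sqr_ge0].
have cinv (e x : R) : 0 < x -> {for x, continuous (fun t : R => e / t)}.
  move=> x0; apply: cvgM; first exact: cvg_cst.
  by apply: cvgV => //; rewrite gt_eqF.
have cinv2 (e x : R) : 0 < x -> {for x, continuous (fun t : R => e / t ^+ 2)}.
  move=> x0; apply: cvgM; first exact: cvg_cst.
  apply: cvgV; first by rewrite gt_eqF// exprn_gt0.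
  exact: exprn_continuous.
have csq (e e' x : R) : 0 < x -> {for x, continuous (fun t : R => e + e' / Num.sqrt t)}.
  move=> x0; apply: cvgD; first exact: cvg_cst.
  apply: cvgM; first exact: cvg_cst.
  by apply: cvgV; [rewrite gt_eqF// sqrtr_gt0|exact: sqrt_continuous].
have mcont (D : set R) g : measurable D -> (forall x, D x -> {for x, continuous g}) ->
    measurable_fun D g.
  move=> mD cg; apply: subspace_continuous_measurable_fun => //.
  by apply: continuous_in_subspaceT => x; rewrite inE => /cg.
rewrite s1 /G -!addrA addrA; apply: lerD; last apply: lerD.
- apply: (Rintegral_le_bound (g := fun t => 2 * n + 4 * Num.sqrt r / Num.sqrt t)) => //.
  + exact: ihS.
  + by apply: mcont => // x /=; rewrite in_itv/= => /andP[x0 _]; exact: csq.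
  + by move=> x _; rewrite addr_ge0 ?divr_ge0 ?mulr_ge0 ?sqrtr_ge0.
  + move=> x /=; rewrite in_itv/= => /andP[x0 _]; apply: hle; last exact: low.
    by rewrite addr_ge0 ?divr_ge0 ?mulr_ge0 ?sqrtr_ge0.
  + have -> : 8 * Num.sqrt r = 2 * (4 * Num.sqrt r) by ring.
    by apply: integral_reciprocal_sqrt; rewrite mulr_ge0 ?sqrtr_ge0.
- apply: (Rintegral_le_bound (g := fun t => 2 * r / t)) => //.
  + exact: ihS.
  + by apply: mcont => // x /=; rewrite in_itv/= => /andP[x0 _]; exact/cinv/(lt_trans ltr01).
  + by move=> x /=; rewrite in_itv/= => /andP[x0 _];
      rewrite divr_ge0 ?mulr_ge0// ltW// (lt_trans ltr01).
  + move=> x /=; rewrite in_itv/= => /andP[x1 _].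
    have x0 := lt_trans ltr01 x1; apply: hle; last exact: mid.
    by rewrite divr_ge0 ?mulr_ge0// ltW.
  + rewrite -integral_reciprocal//; apply: ge0_subset_integral => //.
    * apply/measurable_EFinP; apply: mcont => // x /=; rewrite in_itv/= => /andP[x1 _].
      exact/cinv/(lt_le_trans ltr01).
    * move=> x /=; rewrite in_itv/= => /andP[x1 _].
      by rewrite lee_fin divr_ge0 ?mulr_ge0// (le_trans ler01).
    * by apply: subset_itvr; rewrite bnd_simp.
- apply: (Rintegral_le_bound (g := fun t => 29 * r ^+ 2 / t ^+ 2)) => //.
  + exact: ihS.
  + by apply: mcont => // x /=; rewrite in_itv/= andbT => x0; exact/cinv2/(lt_trans A0).
  + move=> x /=; rewrite in_itv/= andbT => Ax.
    apply: hle; first exact: pos29.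
    apply: high; first exact: lt_trans Ax.
    by rewrite (le_trans _ (ltW Ax))// le_max lexx orbT.
  + rewrite -integral_reciprocal_sqr ?mulr_ge0 ?sqr_ge0//; apply: ge0_subset_integral => //.
    * apply/measurable_EFinP; apply: mcont => // x /=; rewrite in_itv/= andbT => x1.
      exact/cinv2/(lt_le_trans A0).
    * by move=> x _; rewrite lee_fin; exact: pos29.
    * by apply: subset_itvr; rewrite bnd_simp.
Qed.

Lemma C_0_ge12 : 12 <= C_0 :> R.
Proof.
rewrite /C_0; have e2 : 2 <= expR 1 :> R by have := @expR_ge1Dx R 1.
have l0 : 0 <= ln (3 * expR 1 / 2 : R) by apply: ln_ge0; lra.
have h2 : 4 <= expR 1 ^+ 2 :> R.
  have -> : 4 = 2 ^+ 2 :> R by rewrite -natrX.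
  by apply: lerXn2r => //; rewrite nnegrE ?expR_ge0.
have h4 : 16 <= expR 1 ^+ 4 :> R.
  have -> : 16 = 2 ^+ 4 :> R by rewrite -natrX.
  by apply: lerXn2r => //; rewrite nnegrE ?expR_ge0.
by lra.
Qed.

(** Both cases of the maximum [A] follow from [C_0 >= 12].  If [4 r >= 1], then
[2 r ln A = 2 r ln r + 2 r ln 4] already contains [2 r ln r].  Otherwise [ln A = 0]
and [r ln r >= 2 (r - sqrt r)], from [ln s >= 1 - 1 / s] at [s = sqrt r].  In both
the remaining [sqrt r] is absorbed by the constant 2 and a multiple of [r]. *)
Lemma split_bound_le : G <= 2 + 2 * n + 2 * r * (C_0 + ln r).
Proof.
have [r00|rn0] := eqVneq r 0.
  by rewrite /G r00 sqrtr0 expr0n /= !mulr0 !mul0r !addr0 lerDr.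
have rp : 0 < r by rewrite lt_neqAle eq_sym rn0.
pose s := Num.sqrt r; have s0 : 0 < s by rewrite sqrtr_gt0.
have rs : r = s ^+ 2 by rewrite sqr_sqrtr.
have lnr : ln r = 2 * ln s by rewrite rs lnXn// mulr_natl.
have ln_s : 1 - s^-1 <= ln s.
  have := @le_ln1Dx R (s^-1 - 1); rewrite addrCA subrr addr0 lnV ?posrE//.
  have : 0 < s^-1 by rewrite invr_gt0.
  by move=> h /(_ ltac:(lra)); lra.
have rlnr : 2 * (r - s) <= r * ln r.
  rewrite lnr; have -> : 2 * (r - s) = r * (2 * (1 - s^-1)).
    by rewrite rs; field; rewrite gt_eqF.
  by rewrite ler_pM2l//; lra.
have rA : 29 * r ^+ 2 / A <= 29 / 4 * r.
  rewrite ler_pdivrMr//; have : 4 * r <= A by rewrite le_max lexx orbT.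
  by rewrite expr2; nra.
have C12 := C_0_ge12.
have rC : 24 * r <= 2 * r * C_0 by nra.
rewrite /G mulrDr -/s -[2 * r * ln r]mulrA.
have [r4|r4] := leP 1 (4 * r).
  have lA : 2 * r * ln A = 2 * (r * ln r) + 2 * r * ln 4.
    rewrite (_ : A = 4 * r); last by apply/max_idPr.
    by rewrite lnM ?posrE//; ring.
  have l4 : ln 4 <= 3 :> R by have := @le_ln1Dx R 3; rewrite -natr1 addrC; apply; lra.
  have : 2 * r * ln 4 <= 2 * r * 3 by rewrite ler_wpM2l// mulr_ge0.
  have : 8 * s <= 2 + 8 * r by rewrite rs; have := sqr_ge0 (2 * s - 1); nra.
  by move: rA; rewrite lA; set X := 29 * _ / _; lra.
have lA : ln A = 0 by rewrite (_ : A = 1) ?ln1//; apply/max_idPl/ltW.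
have : 12 * s <= 2 + 18 * r by rewrite rs; have := sqr_ge0 (3 * s - 1); nra.
by move: rA; rewrite lA mulr0; set X := 29 * _ / _; lra.
Qed.

End EvenWeight.

(** * The factors on the imaginary axis *)

Section PoissonKernel.
Variable R : realType.
Implicit Types (y t T : R) (k : R[i]).

Definition iy y : R[i] := 0 +i* y.

Lemma ImV_iy y t : y != 0 -> Im ((iy y - t%:C)^-1) = - (y / (t ^+ 2 + y ^+ 2)).
Proof.
move=> y0; have ImV (z : R[i]) : Im z^-1 = - (Im z / (Re z ^+ 2 + Im z ^+ 2)) by case: z.
by rewrite ImV !ReImE /= subr0 sub0r sqrrN.
Qed.

Lemma poisson_denominator_gt0 y t : y != 0 -> 0 < t ^+ 2 + y ^+ 2.
Proof. by move=> y0; rewrite ltr_wpDl ?sqr_ge0// exprn_even_gt0. Qed.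

Lemma poisson_continuous y : y != 0 -> continuous (fun t => y / (t ^+ 2 + y ^+ 2)).
Proof.
move=> y0 t; apply: cvgM; first exact: cvg_cst.
apply: cvgV; first by rewrite gt_eqF// poisson_denominator_gt0.
by apply: cvgD; [exact: exprn_continuous|exact: cvg_cst].
Qed.

Lemma poisson_measurable y : y != 0 ->
  measurable_fun setT (fun t => y / (t ^+ 2 + y ^+ 2)).
Proof. by move=> y0; apply: continuous_measurable_fun; exact: poisson_continuous. Qed.

(** On [[- T, T]], which carries [nu], the weight [y^2 / (t^2 + y^2)] is at least
[1 - T^2 / y^2]. *)
Lemma Im_factor_K_le (nu : {finite_measure set (measurableTypeR R) -> \bar R}) T y :
  0 < y -> nu (~` `[- T, T]) = 0%E ->
  y * Im (factor_K nu (iy y)) <=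
    - (pi^-1 * (fine (nu setT) * (1 - T ^+ 2 / y ^+ 2))).
Proof.
move=> y0 nuT; have yn0 : y != 0 by rewrite gt_eqF.
pose g t := y / (t ^+ 2 + y ^+ 2).
have g0 t : 0 <= g t by rewrite divr_ge0 ?(ltW y0)// ltW// poisson_denominator_gt0.
have gV t : g t <= y^-1.
  rewrite ler_pdivrMr ?poisson_denominator_gt0// mulrDr [y ^+ 2]expr2 mulKf// lerDr.
  by rewrite mulr_ge0 ?sqr_ge0// invr_ge0 ltW.
have mg : measurable_fun setT (g : measurableTypeR R -> R) by exact: poisson_measurable.
have nuoo : (nu setT < +oo)%E by rewrite ltey_eq fin_num_measure.
have ig : nu.-integrable setT (EFin \o g).
  apply: measurable_bounded_integrable => //.
  exists y^-1; split; first exact: num_real.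
  by move=> x yx t _; rewrite /= ger0_norm// (le_trans (gV t))// ltW.
have IK : Im (factor_K nu (iy y)) = pi^-1 * - \int[nu]_t g t.
  rewrite /factor_K ImZ; congr (_ * _).
  rewrite -[LHS]/(\int[nu]_t Im ((iy y - (t : R)%:C)^-1)).
  under eq_Rintegral do rewrite ImV_iy// -mulN1r.
  by rewrite RintegralZl// mulN1r.
pose J : set (measurableTypeR R) := `[- T, T]%classic.
have mJ : measurable J by exact: measurable_itv.
have nuJ : nu J = nu setT.
  by rewrite -(setUv J) measureU ?setICr// ?[X in (_ + X)%E]nuT ?adde0//; exact: measurableC.
have lowb : fine (nu setT) * (y / (T ^+ 2 + y ^+ 2)) <= \int[nu]_t g t.
  rewrite -lee_fin [leRHS]fineK; last exact: integrable_fin_num.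
  rewrite EFinM fineK ?fin_num_measure// -nuJ muleC -integral_cst//.
  apply: (@le_trans _ _ (\int[nu]_(t in J) (g t)%:E)%E).
    apply: ge0_le_integral => //.
    - by move=> t _; rewrite lee_fin g0.
    - by apply/measurable_EFinP; exact: measurable_funS mg.
    - move=> t; rewrite /J /= in_itv/= => /andP[t1 t2].
      rewrite lee_fin ler_pM2l// lef_pV2 ?posrE ?poisson_denominator_gt0// lerD2r.
      by rewrite -[t ^+ 2]real_normK ?num_real// ler_pXn2r ?nnegrE// ?ler_norml ?t1//
        (le_trans _ (_ : `|t| <= T))// ler_norml t1.
  apply: ge0_subset_integral => //.
    exact/measurable_EFinP.
  by move=> t _; rewrite lee_fin g0.
rewrite IK mulrN mulrN lerN2 [leRHS]mulrCA ler_pM2l ?invr_gt0 ?pi_gt0//.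
apply: (@le_trans _ _ (y * (fine (nu setT) * (y / (T ^+ 2 + y ^+ 2))))); last first.
  by rewrite ler_pM2l.
rewrite [leRHS]mulrCA ler_wpM2l ?fine_ge0//.
rewrite mulrA ler_pdivlMr ?poisson_denominator_gt0//.
have -> : (1 - T ^+ 2 / y ^+ 2) * (T ^+ 2 + y ^+ 2) = y * y - T ^+ 2 * T ^+ 2 / y ^+ 2.
  by field.
by rewrite gerBl divr_ge0 ?sqr_ge0// mulr_ge0 ?sqr_ge0.
Qed.

(** The weight [y^2 / (t^2 + y^2)] is even with values in [[0, 1]], so the bound of the
previous part applies for every [y]. *)
Lemma Im_factor_M_ge (psi : R[i] -> R[i]) (n r y : R) : 0 < y -> 0 <= n -> 0 <= r ->
  let L t := ln (cabs (psi t%:C)) in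
  measurable_fun setT L ->
  (forall t, 0 < t -> L t + L (- t) <= 2 * n + 4 * Num.sqrt r / Num.sqrt t) ->
  (forall t, 0 < t -> L t + L (- t) <= 2 * r / t) ->
  (forall t, 0 < t -> 4 * r <= t -> L t + L (- t) <= 29 * r ^+ 2 / t ^+ 2) ->
  - (y * Im (factor_M psi (iy y))) <= pi^-1 * (2 + 2 * n + 2 * r * (C_0 + ln r)).
Proof.
move=> y0 n0 r0 L mL low mid high; have yn0 : y != 0 by rewrite gt_eqF.
pose h t := L t * - (y / (t ^+ 2 + y ^+ 2)).
have IM : Im (factor_M psi (iy y)) = pi^-1 * \int[lebesgue_measure]_t h t.
  rewrite /factor_M ImZ; congr (_ * _).
  by apply: eq_Rintegral => t _; rewrite ImZ ImV_iy.
have mh : measurable_fun setT h.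
  by apply: measurable_funM => //; apply: measurableT_comp => //; exact: poisson_measurable.
rewrite IM mulrCA -mulrN ler_pM2l ?invr_gt0 ?pi_gt0//.
apply: le_trans (split_bound_le n r0).
have [ih|nih] := pselect (lebesgue_measure.-integrable setT (EFin \o h)); last first.
  by rewrite Rintegral_non_integrable// mulr0 oppr0; exact: split_bound_ge0.
rewrite -mulNr -RintegralZl//.
have -> : \int[lebesgue_measure]_t (- y * h t) =
    \int[lebesgue_measure]_t (y ^+ 2 / (t ^+ 2 + y ^+ 2) * L t).
  by apply: eq_Rintegral => t _; rewrite /h; ring.
apply: weighted_integral_le => //.
- have -> : (fun t => y ^+ 2 / (t ^+ 2 + y ^+ 2)) = (fun t => y * (y / (t ^+ 2 + y ^+ 2))).
    by apply/funext => t; rewrite mulrA.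
  by apply: measurable_funM => //; exact: poisson_measurable.
- move=> t; rewrite divr_ge0 ?sqr_ge0 ?(ltW (poisson_denominator_gt0 _ _))//=.
  by rewrite ler_pdivrMr ?poisson_denominator_gt0// mul1r lerDr sqr_ge0.
- by move=> t; rewrite sqrrN.
Qed.

End PoissonKernel.

Section BlaschkeProduct.
Variable R : realType.

(** The limit of a divergent sequence is by convention 0, which satisfies the bound. *)
Lemma cabs_lim_le (u : nat -> Cx R) (B : R) m : 0 <= B ->
  (forall n, (m <= n)%N -> cabs (u n) <= B) -> cabs (lim (u @ \oo)) <= B.
Proof.
move=> B0 uB; have [cu|dv] := pselect (cvg (u @ \oo)); last first.
  rewrite (dvgP dv); suff -> : (point : Cx R) = (0 : R[i]) by rewrite cabs0.
  by [].
apply/ler_addgt0Pr => e e0.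
have e0' : 0 < e%:C :> Cx R by rewrite ltcR.
move/cvgrPdist_lt : cu => /(_ _ e0')[p _ pP].
have := pP (maxn m p) (leq_maxr _ _); rewrite /= -[X in X < _]/(cabs _)%:C ltcR => h.
rewrite -[X in cabs X](subrK (u (maxn m p))) addrC.
by apply: le_trans (cabsD _ _) _; rewrite lerD ?uB ?leq_maxl// ltW.
Qed.

(** The squared modulus is [1 - 4 y Im z / |iy - conj z|^2], and [1 - x <= exp (- x)]. *)
Lemma blaschke_factor_le (z : R[i]) (y : R) : 0 < y -> 0 < Im z ->
  cabs ((iy y - z) / (iy y - Num.conj z)) <=
    expR (- (2 * y * Im z / (Re z ^+ 2 + (y + Im z) ^+ 2))).
Proof.
rewrite -[Num.conj z]/(conjc z) => y0 z0; case: z z0 => x e /= e0.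
have D0 : 0 < x ^+ 2 + (y + e) ^+ 2.
  by rewrite ltr_wpDl ?sqr_ge0// exprn_gt0// addr_gt0.
rewrite -(@ler_pXn2r _ 2)// ?nnegrE ?cabs_ge0 ?expR_ge0//.
rewrite cabsM cabsV exprMn exprVn !cabs_sqr /= -expRM_natl.
rewrite sub0r sqrrN opprK.
have -> : x ^+ 2 + (y - e) ^+ 2 = x ^+ 2 + (y + e) ^+ 2 - 4 * y * e by ring.
rewrite mulrBl divff ?gt_eqF//.
apply: le_trans (expR_ge1Dx _); rewrite lerD2l le_eqVlt; apply/orP; left; apply/eqP.
by field; rewrite gt_eqF.
Qed.

(** All factors have modulus at most 1, so the finite products only decrease. *)
Lemma cabs_blaschke_le (N : option nat) (kz : nat -> R[i]) (y : R) (n : nat) : 0 < y ->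
  (forall j, zidx N j -> 0 < Im (kz j)) ->
  cabs (blaschke N kz (iy y)) <=
    expR (- \sum_(j < n | zidx N j)
      2 * y * Im (kz j) / (Re (kz j) ^+ 2 + (y + Im (kz j)) ^+ 2)).
Proof.
move=> y0 kz0; rewrite /blaschke; apply: (@cabs_lim_le _ _ n); first exact: expR_ge0.
have le1 m : cabs (\prod_(j < m | zidx N j) ((iy y - kz j) / (iy y - Num.conj (kz j)))) <=
  expR (- \sum_(j < m | zidx N j)
      2 * y * Im (kz j) / (Re (kz j) ^+ 2 + (y + Im (kz j)) ^+ 2)).
  rewrite -sumrN expR_sum; elim/big_ind2 : _ => [|a b c d ab cd|j /kz0 j0].
  - by rewrite cabs1.
  - by rewrite cabsM ler_pM ?cabs_ge0.
  - exact: blaschke_factor_le.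
move=> m nm; apply: le_trans (le1 m) _.
rewrite ler_expR lerN2 -!(big_mkord (zidx N)
  (fun j => 2 * y * Im (kz j) / (Re (kz j) ^+ 2 + (y + Im (kz j)) ^+ 2))).
rewrite (big_cat_nat (leq0n n) nm)//= lerDl; apply: sumr_ge0 => j /kz0 j0.
by rewrite divr_ge0 ?addr_ge0 ?sqr_ge0// !mulr_ge0// ltW.
Qed.

End BlaschkeProduct.

(** * Comparison at infinity *)

Section Asymptotics.
Variable R : realType.

Lemma vanishes_inv (C : R) : vanishes (fun y => C / y).
Proof.
move=> e e0; exists ((`|C| + 1) / e) => y Cy.
have C1 : 0 < `|C| + 1 by rewrite ltr_wpDl.
have y0 : 0 < y by apply: lt_le_trans Cy; rewrite divr_gt0.
rewrite normrM [`|y^-1|]gtr0_norm ?invr_gt0// ltr_pdivrMr// mulrC.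
by move: Cy; rewrite ler_pdivrMr// => h; apply: lt_le_trans h; rewrite ltrDl.
Qed.

(** [|p| >= Re p >= 1 + u] with [u = P / 2y - d / y^2], and
[ln (1 + u) >= u - 2 u^2] for [|u| <= 1 / 2]. *)
Lemma ln_cabs_ge (p w : R[i]) (P d y : R) : 1 <= y -> 0 <= d ->
  `|P| / 2 + d <= y / 2 -> Re w = - (P / (2 * y)) ->
  cabs (p - 1 + w) <= d / y ^+ 2 ->
  0 < cabs p /\ P / 2 - (d + 2 * (`|P| / 2 + d) ^+ 2) / y <= y * ln (cabs p).
Proof.
move=> y1 d0 Cy wE hp; have y0 : 0 < y by exact: lt_le_trans y1.
have yn0 : y != 0 by rewrite gt_eqF.
pose C : R := `|P| / 2 + d; pose u := P / (2 * y) - d / y ^+ 2.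
have C0 : 0 <= C by rewrite addr_ge0 ?divr_ge0.
have y2 : y <= y ^+ 2 by rewrite expr2 ler_peMl// ltW.
have uC : `|u| <= C / y.
  apply: le_trans (ler_normB _ _) _.
  have -> : C / y = `|P| / 2 / y + d / y by rewrite /C mulrDl.
  apply: lerD.
    rewrite normrM [`|(2 * y)^-1|]ger0_norm ?invr_ge0 ?mulr_ge0 ?(ltW y0)//.
    by rewrite invfM mulrA.
  rewrite ger0_norm ?divr_ge0 ?sqr_ge0//.
  by rewrite ler_wpM2l// lef_pV2 ?posrE// exprn_gt0.
have u2 : `|u| <= 1 / 2.
  by apply: le_trans uC _; rewrite ler_pdivrMr//; move: Cy; rewrite -/C; lra.
have [u3 u4] : - (1 / 2) <= u /\ u <= 1 / 2 by move: u2; rewrite ler_norml => /andP.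
have Rep : 1 + u <= cabs p.
  apply: le_trans (Re_le_cabs p).
  have -> : Re p = Re (p - 1 + w) + 1 - Re w by rewrite !ReImE /=; ring.
  have : - (d / y ^+ 2) <= Re (p - 1 + w).
    have := le_trans (normr_Re_le _) hp; rewrite ler_norml => /andP[]//.
  by rewrite wE /u; lra.
have p0 : 0 < cabs p by apply: lt_le_trans Rep; lra.
split=> //.
have u1 : 0 < 1 + u by lra.
have lnu : u - 2 * u ^+ 2 <= ln (1 + u).
  have V : ln (1 + u)^-1 <= (1 + u)^-1 - 1.
    rewrite -[X in ln X](subrKC 1); apply: le_ln1Dx.
    by rewrite ltrBrDr addNr invr_gt0.
  rewrite lnV ?posrE// in V.
  have V2 : (1 + u)^-1 - 1 <= - (u - 2 * u ^+ 2).
    rewrite lerBlDr -[(1 + u)^-1]mul1r ler_pdivrMr// expr2.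
    have : 0 <= u * u * (1 + 2 * u) by rewrite -expr2 mulr_ge0 ?sqr_ge0//; lra.
    by lra.
  by lra.
have lnp : ln (1 + u) <= ln (cabs p) by rewrite ler_ln ?posrE.
apply: (@le_trans _ _ (y * (u - 2 * u ^+ 2))); last by rewrite ler_pM2l// (le_trans lnu).
have -> : y * (u - 2 * u ^+ 2) = P / 2 - d / y - 2 * (y * u ^+ 2).
  by rewrite /u; field.
have : y * u ^+ 2 <= C ^+ 2 / y.
  have -> : C ^+ 2 / y = y * (C / y) ^+ 2 by field.
  rewrite ler_pM2l// -[u ^+ 2]real_normK ?num_real// ler_pXn2r// nnegrE//.
  by rewrite divr_ge0// ltW.
rewrite mulrDl -[2 * C ^+ 2 / y]mulrA -/C.
by set Y := C ^+ 2 / y; set Z := y * _; lra.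
Qed.

End Asymptotics.

Unset Implicit Arguments.

Theorem theorem1p4 (R : realType) (q : R -> R[i])
    (fp fm : R -> R[i] -> R[i])
    (N : option nat) (kz : nat -> R[i])
    (nu : {finite_measure set (measurableTypeR R) -> \bar R})
    (hq : admissible_potential q)
    (hfp : forall k : R[i], 0 <= complex.Im k -> jost_plus q k (fp ^~ k))
    (hfm : forall k : R[i], 0 <= complex.Im k -> jost_minus q k (fm ^~ k))
    (hkz : enumerates_zeros (jost_w fp fm) N kz)
    (hnu : canonical_factorization (jost_psi fp fm) N kz nu) :
  (B0 N kz + (pi^-1)%:E * nu setT
     + (2^-1 * \int[lebesgue_measure]_x complex.Re (q x))%:E
   <= (2 / pi * (1 + weighted_norm1 q)
       + 2 / pi * r_c q * (C_0 + ln (r_c q)))%:E)%E.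
Proof.
have [kz0 _] := hkz.
have [[D cD nuD] _ [mL _ _] fact] := hnu.
pose P := \int[lebesgue_measure]_x Re (q x).
pose n := weighted_norm1 q; pose r := r_c q.
have n0 : 0 <= n by exact: weighted_norm1_ge0.
have r0 : 0 <= r by exact: r_c_ge0.
pose V := fine (nu setT).
have V0 : 0 <= V by rewrite fine_ge0.
pose G := 2 + 2 * n + 2 * r * (C_0 + ln r).
have [T nuT] : exists T : R, nu (~` `[- T, T]%classic) = 0%E.
  have [T0 [_ /(_ (T0 + 1))TP]] := compact_bounded cD.
  exists (T0 + 1); apply/eqP; rewrite -measure_le0 -nuD le_measure ?inE//.
  - by apply: measurableC; exact: measurable_itv.
  - by apply: measurableC; exact: compact_measurable.
  - apply: subsetC => x Dx /=; rewrite in_itv/= -ler_norml.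
    by apply: TP => //; rewrite ltrDl.
have low (t : R) : 0 < t -> log_psi fp fm t + log_psi fp fm (- t) <=
    2 * n + 4 * Num.sqrt r / Num.sqrt t.
  move=> t0; have [h1 h2] := log_psi_le_low_energy hq hfp hfm t0.
  apply: le_trans (lerD h1 h2) _; rewrite -/n -/r -[4 * _ / _]mulrA.
  by set X := _ / _; lra.
have mid (t : R) : 0 < t -> log_psi fp fm t + log_psi fp fm (- t) <= 2 * r / t.
  move=> t0; have tn0 : t != 0 by rewrite gt_eqF.
  have h1 := log_psi_le_energy hq hfp hfm tn0.
  have h2 : log_psi fp fm (- t) <= r / `|- t|.
    by apply: log_psi_le_energy => //; rewrite oppr_eq0.
  rewrite normrN in h2; apply: le_trans (lerD h1 h2) _.
  by rewrite -/r gtr0_norm// -[2 * r / t]mulrA; lra.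
have high (t : R) : 0 < t -> 4 * r <= t ->
    log_psi fp fm t + log_psi fp fm (- t) <= 29 * r ^+ 2 / t ^+ 2.
  exact: log_psi_pair_le.
(* The second-order constant of [psi (iy)]: for [4 r <= y] the exponential factor in
   [psi_first_order] is at most 2. *)
pose d := 9 * r ^+ 2; have d0 : 0 <= d by rewrite mulr_ge0// sqr_ge0.
pose C1 := d + 2 * (`|P| / 2 + d) ^+ 2.
(* The bound is proved for each finite set of zeros: multiply the logarithm of the
   factorization at [iy] by [y] and let [y] tend to infinity. *)
have key m : 2 * \sum_(j < m | zidx N j) Im (kz j) <= pi^-1 * G - pi^-1 * V - P / 2.
  (* [E / y] bounds the distance of the Blaschke part to its limit. *)
  pose E := \sum_(j < m | zidx N j) 2 * Im (kz j) *
    (Re (kz j) ^+ 2 + 2 * Im (kz j) + Im (kz j) ^+ 2).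
  pose C := C1 + E + pi^-1 * (V * T ^+ 2).
  apply: (le_of_vanishes (vanishes_inv C)
    (X := Num.max 1 (Num.max (4 * r) (2 * (`|P| / 2 + d))))) => y.
  rewrite !ge_max => /and3P[y1 ry Py].
  have y0 : 0 < y by exact: lt_le_trans y1.
  have yn0 : y != 0 by rewrite gt_eqF.
  pose psi := jost_psi fp fm (iy y).
  have Imk : 0 < Im (iy y) by [].
  have kn0 : iy y != 0 by rewrite -cabs_eq0 cabsE /= expr0n add0r sqrtr_sqr normr_eq0.
  have ck : cabs (iy y) = y by rewrite cabsE /= expr0n add0r sqrtr_sqr gtr0_norm.
  have [psi0 psil] : 0 < cabs psi /\ P / 2 - C1 / y <= y * ln (cabs psi).
    apply: (@ln_cabs_ge _ _ (potential_integral q / (2 * ('i%C * iy y)))) => //.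
    - by move: Py; lra.
    - have -> : 'i%C * iy y = (- y)%:C by rewrite /iy; apply: eq_ReIm; rewrite ?cReM ?cImM /=; ring.
      have -> : potential_integral q / (2 * (- y)%:C) =
          (- (2 * y))^-1%:C * potential_integral q.
        by rewrite fmorphV !(rmorphN, rmorphM) rmorph_nat mulrN mulrC.
      by rewrite ReZ invrN mulNr mulrC.
    - have := psi_first_order hq hfp hfm (ltW Imk) kn0; rewrite ck -/psi -/r.
      move=> /le_trans; apply; rewrite expr_div_n /d -[leRHS]mulrA.
      have e2 : expR (2 * (r / y)) <= 2.
        by apply: expR_half_le2; rewrite mulrA ler_pdivrMr//; lra.
      by rewrite ler_wpM2r ?divr_ge0 ?sqr_ge0//; lra.
  have psiu : ln (cabs psi) <=
      - (\sum_(j < m | zidx N j) 2 * y * Im (kz j) / (Re (kz j) ^+ 2 + (y + Im (kz j)) ^+ 2))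
      + Im (factor_K nu (iy y)) - Im (factor_M (jost_psi fp fm) (iy y)).
    rewrite -[leRHS]expRK ler_ln ?posrE ?expR_gt0// /psi (fact _ Imk).
    rewrite cabsM (cabsM (blaschke _ _ _)) 2!cabs_cexp.
    have -> : Re (- ('i%C * factor_K nu (iy y))) = Im (factor_K nu (iy y)).
      by rewrite !ReImE /=; ring.
    have -> : Re ('i%C * factor_M (jost_psi fp fm) (iy y)) =
        - Im (factor_M (jost_psi fp fm) (iy y)).
      by rewrite !ReImE /=; ring.
    rewrite [leRHS]expRD [X in _ <= X * _]expRD.
    apply: ler_wpM2r; first exact: expR_ge0.
    by apply: ler_wpM2r; [exact: expR_ge0 | exact: cabs_blaschke_le].
  have hK := Im_factor_K_le y0 nuT.
  have hM := Im_factor_M_ge y0 n0 r0 mL low mid high.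
  have hB : 2 * \sum_(j < m | zidx N j) Im (kz j) - E / y <=
      y * \sum_(j < m | zidx N j) 2 * y * Im (kz j) / (Re (kz j) ^+ 2 + (y + Im (kz j)) ^+ 2).
    rewrite !mulr_sumr mulr_suml -sumrB; apply: ler_sum => j /kz0.
    move: (kz j) => [x e] /= e0.
    have D0 : 0 < x ^+ 2 + (y + e) ^+ 2.
      by rewrite ltr_wpDl ?sqr_ge0// exprn_gt0// addr_gt0.
    have -> : y * (2 * y * e / (x ^+ 2 + (y + e) ^+ 2)) =
        2 * e - 2 * e * ((x ^+ 2 + 2 * y * e + e ^+ 2) / (x ^+ 2 + (y + e) ^+ 2)).
      by field; rewrite gt_eqF.
    rewrite -[2 * e * _ / y]mulrA lerD2l lerN2.
    apply: ler_wpM2l; first by rewrite mulr_ge0 ?(ltW e0).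
    rewrite ler_pdivrMr// [leRHS]mulrAC ler_pdivlMr//.
    have h1 : y ^+ 2 <= x ^+ 2 + (y + e) ^+ 2.
      by have := sqr_ge0 x; have := sqr_ge0 e; have : 0 <= y * e; [rewrite mulr_ge0 ?ltW|nra].
    have h2 : (x ^+ 2 + 2 * y * e + e ^+ 2) <= y * (x ^+ 2 + 2 * e + e ^+ 2).
      have : 0 <= (y - 1) * (x ^+ 2 + e ^+ 2).
        by rewrite mulr_ge0 ?subr_ge0// addr_ge0 ?sqr_ge0.
      by nra.
    have h3 : 0 <= x ^+ 2 + 2 * e + e ^+ 2.
      by rewrite !addr_ge0 ?sqr_ge0 ?mulr_ge0 ?(ltW e0).
    apply: (@le_trans _ _ (y * (x ^+ 2 + 2 * e + e ^+ 2) * y)).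
      by rewrite ler_wpM2r ?(ltW y0).
    have -> : y * (x ^+ 2 + 2 * e + e ^+ 2) * y = (x ^+ 2 + 2 * e + e ^+ 2) * y ^+ 2 by ring.
    by rewrite ler_wpM2l.
  have hT : V * (T ^+ 2 / y ^+ 2) <= V * T ^+ 2 / y.
    rewrite -mulrA ler_wpM2l// ler_wpM2l ?sqr_ge0//.
    by rewrite lef_pV2 ?posrE ?exprn_gt0// expr2 ler_peMl// ltW.
  have hT' : pi^-1 * (V * (T ^+ 2 / y ^+ 2)) <= pi^-1 * (V * T ^+ 2 / y).
    by rewrite ler_wpM2l// invr_ge0 pi_ge0.
  have := le_trans psil (ler_wpM2l (ltW y0) psiu).
  rewrite mulrBr mulrDr mulrN.
  have -> : C / y = C1 / y + E / y + pi^-1 * (V * T ^+ 2 / y).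
    by rewrite /C !mulrDl -!mulrA.
  move: hK hM hB hT'; rewrite -/V -/G.
  have -> : pi^-1 * (V * (1 - T ^+ 2 / y ^+ 2)) = pi^-1 * V - pi^-1 * (V * (T ^+ 2 / y ^+ 2)).
    by ring.
  set a1 := y * Im (factor_K _ _); set a2 := y * Im (factor_M _ _).
  set a3 := y * \sum_(j < m | _) _; set a4 := \sum_(j < m | _) _.
  by lra.
have hB : (B0 N kz <= (pi^-1 * G - pi^-1 * V - P / 2)%:E)%E.
  rewrite /B0; set X := pi^-1 * G - pi^-1 * V - P / 2.
  have -> : X%:E = (2%:E * (X / 2)%:E)%E by rewrite -EFinM mulrC divfK// pnatr_eq0.
  rewrite lee_pmul2l//; apply: lime_le.
    by apply: is_cvg_nneseries => j _ /kz0 j0; rewrite lee_fin ltW.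
  apply: nearW => m; rewrite sumEFin lee_fin big_mkord ler_pdivlMr// mulrC.
  exact: key.
have -> : nu setT = V%:E by rewrite fineK// fin_num_measure.
rewrite -EFinM; apply: (@le_trans _ _
  ((pi^-1 * G - pi^-1 * V - P / 2)%:E + (pi^-1 * V)%:E + (2^-1 * P)%:E)%E).
  by rewrite !leeD2r.
rewrite -!EFinD lee_fin le_eqVlt; apply/orP; left; apply/eqP.
by rewrite /G -/n -/r; set c := pi^-1; field.
Qed.
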